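(* The function $g_1^4(\tau)+g_2^4(\tau)$ is a modular function on $\Gamma_0(10)$ and satisfies \[ g_1^4(\tau)+g_2^4(\tau)=\frac{1}{g(\tau)}-2+3g(\tau). \]
   Context: Throughout, $\tau\in\mathbb{H}$, $q=e^{2\pi i\tau}$, $(a;q)_\infty=\prod_{n\ge0}(1-aq^n)$, $\eta(\tau)=q^{1/24}(q;q)_\infty$. Define $g_1(\tau)=\dfrac{(-q;q^5)_\infty(-q^4;q^5)_\infty}{(q;q^5)_\infty(q^4;q^5)_\infty}$, $g_2(\tau)=\dfrac{(-q^2;q^5)_\infty(-q^3;q^5)_\infty}{(q^2;q^5)_\infty(q^3;q^5)_\infty}$, and $g(\tau)=\dfrac{\eta^2(2\tau)\eta^4(5\tau)}{\eta^4(\tau)\eta^2(10\tau)}$. A modular function on a congruence subgroup $\Gamma$ is a function meromorphic on $\mathbb{H}$, invariant under $\Gamma$, and meromorphic at all cusps. $\Gamma_0(10)$ is the group of matrices in $\mathrm{SL}_2(\mathbb{Z})$ with lower-left entry divisible by $10$. *)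

(* Defs.v *)
From Stdlib Require Import Reals ZArith.
From Coquelicot Require Import Coquelicot.
Open Scope R_scope.

Definition Cexp (z : C) : C :=
  (exp (Re z) * cos (Im z), exp (Re z) * sin (Im z)).

Definition qq (tau : C) : C := Cexp (Cmult (RtoC (2 * PI)) (Cmult Ci tau)).

Fixpoint qpoch_part (a p : C) (N : nat) : C :=
  match N with
  | O => RtoC 1
  | S N' => Cmult (qpoch_part a p N') (Cminus (RtoC 1) (Cmult a (Cpow p N')))
  end.

Definition qpoch (a p : C) : C :=
  (real (Lim_seq (fun N => Re (qpoch_part a p N))),
   real (Lim_seq (fun N => Im (qpoch_part a p N)))).

Definition eta (tau : C) : C :=
  Cmult (Cexp (Cmult (RtoC (2 * PI / 24)) (Cmult Ci tau)))
        (qpoch (qq tau) (qq tau)).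

Definition g1 (tau : C) : C :=
  let q := qq tau in
  Cdiv (Cmult (qpoch (Copp q) (Cpow q 5)) (qpoch (Copp (Cpow q 4)) (Cpow q 5)))
       (Cmult (qpoch q (Cpow q 5)) (qpoch (Cpow q 4) (Cpow q 5))).

Definition g2 (tau : C) : C :=
  let q := qq tau in
  Cdiv (Cmult (qpoch (Copp (Cpow q 2)) (Cpow q 5)) (qpoch (Copp (Cpow q 3)) (Cpow q 5)))
       (Cmult (qpoch (Cpow q 2) (Cpow q 5)) (qpoch (Cpow q 3) (Cpow q 5))).

Definition g (tau : C) : C :=
  Cdiv (Cmult (Cpow (eta (Cmult (RtoC 2) tau)) 2) (Cpow (eta (Cmult (RtoC 5) tau)) 4))
       (Cmult (Cpow (eta tau) 4) (Cpow (eta (Cmult (RtoC 10) tau)) 2)).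

Definition mobius (a b c d : Z) (tau : C) : C :=
  Cdiv (Cplus (Cmult (RtoC (IZR a)) tau) (RtoC (IZR b)))
       (Cplus (Cmult (RtoC (IZR c)) tau) (RtoC (IZR d))).

Definition holo_at (h : C -> C) (z : C) : Prop :=
  @ex_derive C_AbsRing C_NormedModule h z.

Definition meromorphic_on_H (f : C -> C) : Prop :=
  forall z0 : C, 0 < Im z0 ->
    exists (m : nat) (h : C -> C) (r : R),
      0 < r /\ r <= Im z0 /\
      (forall z, Cmod (Cminus z z0) < r -> holo_at h z) /\
      (forall z, Cmod (Cminus z z0) < r -> z <> z0 ->
         Cmult (f z) (Cpow (Cminus z z0) m) = h z).

Definition invariant_Gamma0 (N : Z) (f : C -> C) : Prop :=
  forall a b c d : Z, (a * d - b * c = 1)%Z -> (N | c)%Z ->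
    forall tau : C, 0 < Im tau -> f (mobius a b c d tau) = f tau.

(* Meromorphic at all cusps: for every gamma = (a b; c d) in SL_2(Z),
   f(gamma tau) has a Laurent expansion with finitely many negative terms
   in q_h = e^{2 pi i tau / h} for some width h > 0, valid for Im tau large:
   f(gamma tau) = q_h^{-n0} * sum_{n >= 0} coef n q_h^n. *)
Definition meromorphic_at_cusps (f : C -> C) : Prop :=
  forall a b c d : Z, (a * d - b * c = 1)%Z ->
    exists (h : nat) (n0 : nat) (coef : nat -> C) (Y : R),
      (0 < h)%nat /\
      forall tau : C, 0 < Im tau -> Y < Im tau ->
        let qh := Cexp (Cmult (RtoC (2 * PI / INR h)) (Cmult Ci tau)) in
        @is_series C_AbsRing C_NormedModule (fun n => Cmult (coef n) (Cpow qh n))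
                   (Cmult (f (mobius a b c d tau)) (Cpow qh n0)).

Definition modular_function_Gamma0 (N : Z) (f : C -> C) : Prop :=
  meromorphic_on_H f /\ invariant_Gamma0 N f /\ meromorphic_at_cusps f.

(* Main.v *)
(** Put [a = g1], [b = g2]. Splitting the infinite products modulo 5 gives [g = (a b)^2], and the identity is
    the square of [(a b)^2 - 1 = a b (a^2 - b^2)]. By the Jacobi triple product [a] and [b] are quotients of
    the theta functions [theta (-q)], [theta q], [theta (-q^2)], [theta (q^2)] of base [q^5], and the latter
    relation follows from the formula for a product of two theta functions, applied six times.

    Modularity is then a property of the eta quotient [g]. The logarithmic derivative of [eta^2] is the
    Eisenstein series of weight two, whose behaviour under [tau -> -1/tau] is obtained by comparing the two
    orders of summation over the lattice; hence [eta^2 (-1/tau) / (tau eta^2 tau)] has derivative zero and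
    equals its value [-i] at [tau = i]. Euclid's algorithm in SL_2(Z) extends this to all matrices, with a
    multiplier that is a twelfth root of unity; these roots of unity cancel in [g] on [Gamma_0(10)]. At the
    cusps, [eta^2 (n gamma tau)] is [c tau + d] times a monomial times a power series that does not vanish
    at 0, both in a root of [q]. *)
Require Import Defs.
From Stdlib Require Import List Reals ZArith Lra Lia Psatz.
From Coquelicot Require Import Coquelicot.
Open Scope R_scope.

(** * Limits and absolutely convergent series of complex numbers *)

(** The square of eta is the natural unit: [g] contains only even powers of eta, whereas a law for
    eta itself would need a branch of the square root of [c tau + d] and 24th roots of unity. No
    contour integral and no sine product is used: the cotangent expansion comes from the duplication
    formula, zero derivative implies constancy because the half-plane is convex, and power series
    are controlled by explicit coefficient bounds. The obstacle is the conditional convergence of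
    the weight two lattice sum; an array with known telescoping row sums is subtracted first, so
    that only an absolutely convergent rest has its summations exchanged. The multiplier is tracked
    by a closed integer formula modulo 12, which turns each of its properties into a finite check on
    residues modulo 3 and 4. Since [g] is holomorphic without zeros on the half-plane, poles of the
    right-hand side can occur only at the cusps; there a single root of [q], of order
    [120 = 12 * 10], serves all four factors of [g]. *)

Lemma exp_le_exp x y : x <= y -> exp x <= exp y.
Proof. intros [h| ->]; [left; now apply exp_increasing|apply Rle_refl]. Qed.

Definition Clim (u : nat -> C) (l : C) : Prop :=
  forall eps : R, 0 < eps -> exists N : nat, forall n : nat, (N <= n)%nat ->
    Cmod (u n - l) < eps.

Fixpoint Csum (a : nat -> C) (n : nat) : C :=
  match n with O => 0%C | S k => (Csum a k + a k)%C end.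

Fixpoint Rsum (b : nat -> R) (n : nat) : R :=
  match n with O => 0 | S k => Rsum b k + b k end.

Definition Cser (a : nat -> C) (l : C) : Prop := Clim (Csum a) l.

Lemma Cmod_sub_sym (x y : C) : Cmod (x - y) = Cmod (y - x).
Proof. rewrite <- Cmod_opp. f_equal. ring. Qed.

Lemma Cmod_sub_triangle (x y z : C) : Cmod (x - z) <= Cmod (x - y) + Cmod (y - z).
Proof. replace (x - z)%C with ((x - y) + (y - z))%C by ring. apply Cmod_triangle. Qed.

Lemma Cmod_triangle_sub (x y : C) : Cmod x - Cmod y <= Cmod (x - y).
Proof. generalize (Cmod_triangle (x - y) y). replace (x - y + y)%C with x by ring. lra. Qed.

Lemma Cmod_triangle_minus (x y : C) : Cmod (x - y) <= Cmod x + Cmod y.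
Proof. unfold Cminus. rewrite <- (Cmod_opp y). apply Cmod_triangle. Qed.

Lemma Cmod_le_eps_0 (x : C) : (forall eps, 0 < eps -> Cmod x <= eps) -> x = 0%C.
Proof.
intros H. apply Cmod_eq_0. destruct (Rle_lt_dec (Cmod x) 0) as [h|h].
- generalize (Cmod_ge_0 x); lra.
- specialize (H (Cmod x / 2)). lra.
Qed.

Lemma Clim_unique u l l' : Clim u l -> Clim u l' -> l = l'.
Proof.
intros H H'. cut (l - l' = 0)%C.
{ intros E. replace l with (l - l' + l')%C by ring. rewrite E. ring. }
apply Cmod_le_eps_0. intros eps He.
destruct (H (eps/2)) as [N HN]; [lra|]. destruct (H' (eps/2)) as [N' HN']; [lra|].
specialize (HN (N+N')%nat ltac:(lia)). specialize (HN' (N+N')%nat ltac:(lia)).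
generalize (Cmod_sub_triangle l (u (N+N')%nat) l'). rewrite (Cmod_sub_sym l (u _)). lra.
Qed.

Lemma Clim_const c : Clim (fun _ => c) c.
Proof. intros eps He. exists O. intros n _. replace (c - c)%C with (RtoC 0) by ring. rewrite Cmod_0. lra. Qed.

Lemma Clim_ext u v l : (forall n, u n = v n) -> Clim u l -> Clim v l.
Proof. intros E H eps He. destruct (H eps He) as [N HN]. exists N. intros n Hn. rewrite <- E. auto. Qed.

Lemma Clim_ext_eventually N0 u v l :
  (forall n, (N0 <= n)%nat -> u n = v n) -> Clim u l -> Clim v l.
Proof.
intros E H eps He. destruct (H eps He) as [N HN]. exists (N + N0)%nat. intros n Hn.
rewrite <- E by lia. apply HN. lia.
Qed.

Lemma Clim_add u v l m : Clim u l -> Clim v m -> Clim (fun n => u n + v n)%C (l + m)%C.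
Proof.
intros H H' eps He.
destruct (H (eps/2)) as [N HN]; [lra|]. destruct (H' (eps/2)) as [N' HN']; [lra|].
exists (N+N')%nat. intros n Hn.
specialize (HN n ltac:(lia)). specialize (HN' n ltac:(lia)).
replace (u n + v n - (l + m))%C with ((u n - l) + (v n - m))%C by ring.
generalize (Cmod_triangle (u n - l) (v n - m)). lra.
Qed.

Lemma Clim_bounded u l : Clim u l -> exists M, 0 < M /\ forall n, Cmod (u n) <= M.
Proof.
intros H. destruct (H 1) as [N HN]; [lra|].
assert (exists M, forall n, (n < N)%nat -> Cmod (u n) <= M) as [M HM].
{ clear. induction N as [|N [M HM]]. exists 0; intros; lia.
  exists (Rmax M (Cmod (u N))). intros n Hn.
  destruct (Nat.eq_dec n N) as [->|Hne]. apply Rmax_r.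
  eapply Rle_trans; [apply HM; lia|apply Rmax_l]. }
exists (Rmax M (Cmod l + 1)). split.
{ generalize (Cmod_ge_0 l) (Rmax_r M (Cmod l + 1)). lra. }
intros n. destruct (le_lt_dec N n) as [h|h].
- generalize (HN n h) (Cmod_triangle_sub (u n) l) (Rmax_r M (Cmod l + 1)). lra.
- eapply Rle_trans; [apply HM; lia|apply Rmax_l].
Qed.

Lemma Clim_mul u v l m : Clim u l -> Clim v m -> Clim (fun n => u n * v n)%C (l * m)%C.
Proof.
intros H H'. destruct (Clim_bounded u l H) as [M [HM0 HM]]. intros eps He.
pose proof (Cmod_ge_0 m) as Hm.
destruct (H (eps / (2 * (Cmod m + 1)))) as [N HN].
{ apply Rdiv_lt_0_compat; lra. }
destruct (H' (eps / (2 * M))) as [N' HN'].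
{ apply Rdiv_lt_0_compat; lra. }
exists (N+N')%nat. intros n Hn.
specialize (HN n ltac:(lia)). specialize (HN' n ltac:(lia)).
replace (u n * v n - l * m)%C with (u n * (v n - m) + (u n - l) * m)%C by ring.
eapply Rle_lt_trans; [apply Cmod_triangle|]. rewrite !Cmod_mult.
assert (Cmod (u n) * Cmod (v n - m) <= M * Cmod (v n - m)).
{ apply Rmult_le_compat_r. apply Cmod_ge_0. apply HM. }
assert (M * Cmod (v n - m) < eps / 2).
{ apply Rmult_lt_compat_l with (r := M) in HN'; auto.
  replace (M * (eps / (2 * M))) with (eps / 2) in HN' by (field; lra). exact HN'. }
assert (Cmod (u n - l) * Cmod m <= Cmod (u n - l) * (Cmod m + 1)).
{ apply Rmult_le_compat_l. apply Cmod_ge_0. lra. }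
assert (Cmod (u n - l) * (Cmod m + 1) < eps / 2).
{ apply Rmult_lt_compat_r with (r := Cmod m + 1) in HN; [|lra].
  replace (eps / (2 * (Cmod m + 1)) * (Cmod m + 1)) with (eps / 2) in HN by (field; lra). exact HN. }
lra.
Qed.

Lemma Clim_scal c u l : Clim u l -> Clim (fun n => c * u n)%C (c * l)%C.
Proof. intros H. apply Clim_mul; auto using Clim_const. Qed.

Lemma Clim_opp u l : Clim u l -> Clim (fun n => - u n)%C (- l)%C.
Proof.
intros H. apply Clim_ext with (fun n => (-(1)) * u n)%C. intros; ring.
replace (-l)%C with ((-(1)) * l)%C by ring. now apply Clim_scal.
Qed.

Lemma Clim_sub u v l m : Clim u l -> Clim v m -> Clim (fun n => u n - v n)%C (l - m)%C.
Proof. intros H H'. apply Clim_add; auto using Clim_opp. Qed.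

Lemma Clim_subseq u l (phi : nat -> nat) :
  (forall n, (n <= phi n)%nat) -> Clim u l -> Clim (fun n => u (phi n)) l.
Proof.
intros Hphi H eps He. destruct (H eps He) as [N HN]. exists N. intros n Hn.
apply HN. specialize (Hphi n). lia.
Qed.

Lemma Clim_le_dist u l x e N :
  (forall n, (N <= n)%nat -> Cmod (u n - x) <= e) -> Clim u l -> Cmod (l - x) <= e.
Proof.
intros Hb H. apply le_epsilon. intros eps He. destruct (H eps He) as [N' HN'].
specialize (HN' (N+N')%nat ltac:(lia)). specialize (Hb (N+N')%nat ltac:(lia)).
generalize (Cmod_sub_triangle l (u (N+N')%nat) x). rewrite (Cmod_sub_sym l (u _)). lra.
Qed.

Lemma Clim_le_Cmod u l M : (forall n, Cmod (u n) <= M) -> Clim u l -> Cmod l <= M.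
Proof.
intros Hb H. replace l with (l - 0)%C by ring.
apply (Clim_le_dist u l 0 M O); auto. intros n _. replace (u n - 0)%C with (u n) by ring. auto.
Qed.

Lemma Clim_squeeze_0 u (b : nat -> R) :
  (forall n, Cmod (u n) <= b n) ->
  (forall eps, 0 < eps -> exists N, forall n, (N <= n)%nat -> b n < eps) -> Clim u 0.
Proof.
intros Hb H eps He. destruct (H eps He) as [N HN]. exists N. intros n Hn.
replace (u n - 0)%C with (u n) by ring. specialize (HN n Hn). specialize (Hb n). lra.
Qed.

Lemma Clim_inv (u : nat -> C) (l : C) : l <> 0 -> Clim u l -> Clim (fun n => / u n)%C (/ l)%C.
Proof.
intros Hl H eps He. pose proof (proj1 (Cmod_gt_0 l) Hl) as Hl'.
destruct (H (Cmod l / 2)) as [N HN]; [lra|].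
destruct (H (eps * (Cmod l * Cmod l / 2))) as [N' HN'].
{ apply Rmult_lt_0_compat; auto. apply Rdiv_lt_0_compat; [|lra]. now apply Rmult_lt_0_compat. }
exists (N+N')%nat. intros n Hn.
specialize (HN n ltac:(lia)). specialize (HN' n ltac:(lia)).
assert (Cmod l / 2 < Cmod (u n)).
{ generalize (Cmod_triangle_sub l (u n)). rewrite Cmod_sub_sym. lra. }
assert (Hun : u n <> 0) by (apply Cmod_gt_0; lra).
replace (/ u n - / l)%C with ((l - u n) / (u n * l))%C by (field; auto).
rewrite Cmod_div by (apply Cmult_neq_0; auto). rewrite Cmod_mult, Cmod_sub_sym.
apply Rlt_div_l. apply Rmult_lt_0_compat; lra.
eapply Rlt_le_trans; [exact HN'|]. apply Rmult_le_compat_l; [lra|].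
replace (Cmod l * Cmod l / 2) with (Cmod l / 2 * Cmod l) by field.
apply Rmult_le_compat_r; lra.
Qed.

Lemma Cmod_le_Re_Im (z : C) : Cmod z <= Rabs (Re z) + Rabs (Im z).
Proof.
unfold Cmod. apply Rsqr_incr_0_var.
2: generalize (Rabs_pos (Re z)) (Rabs_pos (Im z)); lra.
rewrite Rsqr_sqrt.
- unfold Rsqr, Re, Im. rewrite <- (pow2_abs (fst z)), <- (pow2_abs (snd z)).
  generalize (Rabs_pos (fst z)) (Rabs_pos (snd z)). nra.
- generalize (pow2_ge_0 (fst z)) (pow2_ge_0 (snd z)). lra.
Qed.

Lemma Rabs_Re_le (z : C) : Rabs (Re z) <= Cmod z.
Proof. apply re_le_Cmod. Qed.

Lemma Rabs_Im_le (z : C) : Rabs (Im z) <= Cmod z.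
Proof. eapply Rle_trans; [|apply Rmax_Cmod]. apply Rmax_r. Qed.

Lemma Clim_is_lim_seq u l :
  Clim u l -> is_lim_seq (fun n => Re (u n)) (Re l) /\ is_lim_seq (fun n => Im (u n)) (Im l).
Proof.
intros H. split; apply is_lim_seq_spec; intros [eps He]; destruct (H eps He) as [N HN];
  exists N; intros n Hn; eapply Rle_lt_trans; try apply (HN n Hn); simpl.
- replace (Re (u n) - Re l) with (Re (u n - l)%C) by reflexivity. apply Rabs_Re_le.
- replace (Im (u n) - Im l) with (Im (u n - l)%C) by reflexivity. apply Rabs_Im_le.
Qed.

Lemma Clim_cauchy u :
  (forall eps, 0 < eps -> exists N, forall n m, (N <= n)%nat -> (N <= m)%nat ->
     Cmod (u n - u m) < eps) -> exists l, Clim u l.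
Proof.
intros H.
assert (HR : ex_finite_lim_seq (fun n => Re (u n))).
{ apply ex_lim_seq_cauchy_corr. intros [eps He]. destruct (H eps He) as [N HN].
  exists N. intros n m Hn Hm. eapply Rle_lt_trans; [|apply (HN n m Hn Hm)]. simpl.
  replace (Re (u n) - Re (u m)) with (Re (u n - u m)%C) by reflexivity. apply Rabs_Re_le. }
assert (HI : ex_finite_lim_seq (fun n => Im (u n))).
{ apply ex_lim_seq_cauchy_corr. intros [eps He]. destruct (H eps He) as [N HN].
  exists N. intros n m Hn Hm. eapply Rle_lt_trans; [|apply (HN n m Hn Hm)]. simpl.
  replace (Im (u n) - Im (u m)) with (Im (u n - u m)%C) by reflexivity. apply Rabs_Im_le. }
destruct HR as [x Hx]. destruct HI as [y Hy]. exists (x, y).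
apply is_lim_seq_spec in Hx. apply is_lim_seq_spec in Hy.
intros eps He.
destruct (Hx (mkposreal (eps/2) ltac:(lra))) as [N HN].
destruct (Hy (mkposreal (eps/2) ltac:(lra))) as [N' HN']. simpl in *.
exists (N+N')%nat. intros n Hn. specialize (HN n ltac:(lia)). specialize (HN' n ltac:(lia)).
eapply Rle_lt_trans; [apply Cmod_le_Re_Im|].
replace (Re (u n - (x, y))%C) with (Re (u n) - x) by reflexivity.
replace (Im (u n - (x, y))%C) with (Im (u n) - y) by reflexivity. lra.
Qed.

(** * Finite sums *)

Lemma Csum_ext a b n : (forall k, (k < n)%nat -> a k = b k) -> Csum a n = Csum b n.
Proof. induction n; simpl; intros H; auto. rewrite IHn, H; auto. Qed.

Lemma Csum_add a b n : Csum (fun k => a k + b k)%C n = (Csum a n + Csum b n)%C.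
Proof. induction n; simpl. ring. rewrite IHn. ring. Qed.

Lemma Csum_sub a b n : Csum (fun k => a k - b k)%C n = (Csum a n - Csum b n)%C.
Proof. induction n; simpl. ring. rewrite IHn. ring. Qed.

Lemma Csum_scal c a n : Csum (fun k => c * a k)%C n = (c * Csum a n)%C.
Proof. induction n; simpl. ring. rewrite IHn. ring. Qed.

Lemma Csum_split a n m : Csum a (n + m) = (Csum a n + Csum (fun k => a (n + k)%nat) m)%C.
Proof.
induction m; simpl. rewrite Nat.add_0_r. ring.
rewrite Nat.add_succ_r. simpl. rewrite IHm. ring.
Qed.

Lemma Csum_shift a n : Csum a (S n) = (a O + Csum (fun k => a (S k)) n)%C.
Proof. exact (eq_trans (Csum_split a 1 n) (f_equal2 Cplus (Cplus_0_l (a O)) eq_refl)). Qed.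

Lemma Csum_rev a n : Csum a n = Csum (fun k => a (n - 1 - k)%nat) n.
Proof.
revert a. induction n; intros a; auto. rewrite Csum_shift. cbn [Csum]. rewrite IHn.
rewrite Cplus_comm. f_equal.
- apply Csum_ext. intros k Hk. f_equal. lia.
- f_equal. lia.
Qed.

Lemma Rsum_nonneg b n : (forall k, 0 <= b k) -> 0 <= Rsum b n.
Proof. intros H. induction n; simpl. lra. specialize (H n). lra. Qed.

Lemma Rsum_le a b n : (forall k, (k < n)%nat -> a k <= b k) -> Rsum a n <= Rsum b n.
Proof. induction n; simpl; intros H. lra. specialize (IHn ltac:(intros; apply H; lia)).
specialize (H n ltac:(lia)). lra. Qed.

Lemma Rsum_mono b n m : (forall k, 0 <= b k) -> (n <= m)%nat -> Rsum b n <= Rsum b m.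
Proof. intros H Hnm. induction Hnm. lra. simpl. specialize (H m). lra. Qed.

Lemma Rsum_scal c b n : Rsum (fun k => c * b k) n = c * Rsum b n.
Proof. induction n; simpl. ring. rewrite IHn. ring. Qed.

Lemma Rsum_add a b n : Rsum (fun k => a k + b k) n = Rsum a n + Rsum b n.
Proof. induction n; simpl. ring. rewrite IHn. ring. Qed.

Lemma Rsum_ext a b n : (forall k, (k < n)%nat -> a k = b k) -> Rsum a n = Rsum b n.
Proof. induction n; simpl; intros H; auto. rewrite IHn, H; auto. Qed.

Lemma Csum_dist_le a b n m : (forall k, Cmod (a k) <= b k) -> (n <= m)%nat ->
  Cmod (Csum a m - Csum a n) <= Rsum b m - Rsum b n.
Proof.
intros H Hnm. induction Hnm as [|m Hnm IH].
- replace (Csum a n - Csum a n)%C with (RtoC 0) by ring. rewrite Cmod_0. lra.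
- simpl. replace (Csum a m + a m - Csum a n)%C with ((Csum a m - Csum a n) + a m)%C by ring.
  generalize (Cmod_triangle (Csum a m - Csum a n) (a m)) (H m). lra.
Qed.

Lemma Cmod_Csum_le a b n : (forall k, Cmod (a k) <= b k) -> Cmod (Csum a n) <= Rsum b n.
Proof.
intros H. generalize (Csum_dist_le a b 0 n H ltac:(lia)). simpl.
replace (Csum a n - 0)%C with (Csum a n) by ring. lra.
Qed.

(** * Convergence by domination *)

Definition summable (b : nat -> R) : Prop :=
  (forall k, 0 <= b k) /\ exists B, forall n, Rsum b n <= B.

Lemma summable_tail b : summable b -> forall eps, 0 < eps ->
  exists N, forall m, (N <= m)%nat -> Rsum b m - Rsum b N < eps.
Proof.
intros [Hp [B HB]] eps He.
destruct (completeness (fun x => exists n, x = Rsum b n)) as [l [Hl1 Hl2]].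
- exists B. intros x [n ->]. apply HB.
- exists 0, O. reflexivity.
- destruct (Classical_Prop.classic (exists N, l - eps < Rsum b N)) as [[N HN]|Hn].
  + exists N. intros m Hm. assert (Rsum b m <= l) by (apply Hl1; eauto). lra.
  + exfalso. assert (l <= l - eps); [|lra]. apply Hl2. intros x [n ->].
    destruct (Rle_lt_dec (Rsum b n) (l - eps)); auto. exfalso. eauto.
Qed.

Lemma summable_le a b : (forall k, 0 <= a k <= b k) -> summable b -> summable a.
Proof.
intros H [Hb [B HB]]. split. intros k; apply H. exists B. intros n.
eapply Rle_trans; [|apply HB]. apply Rsum_le. intros; apply H.
Qed.

Lemma summable_scal c b : 0 <= c -> summable b -> summable (fun k => c * b k).
Proof.
intros Hc [Hb [B HB]]. split. intros k; apply Rmult_le_pos; auto.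
exists (c * B). intros n. rewrite Rsum_scal. apply Rmult_le_compat_l; auto.
Qed.

Lemma summable_add a b : summable a -> summable b -> summable (fun k => a k + b k).
Proof.
intros [Ha [A HA]] [Hb [B HB]]. split. intros k; generalize (Ha k) (Hb k); lra.
exists (A + B). intros n. rewrite Rsum_add. generalize (HA n) (HB n); lra.
Qed.

Lemma summable_geom r : 0 <= r < 1 -> summable (fun k => r ^ k).
Proof.
intros Hr. split. intros; apply pow_le; lra.
exists (/ (1 - r)). intros n.
assert (Rsum (fun k => r ^ k) n = (1 - r ^ n) / (1 - r)) as ->.
{ induction n; simpl. field; lra. rewrite IHn. field; lra. }
unfold Rdiv. rewrite <- (Rmult_1_l (/ (1 - r))) at 2. apply Rmult_le_compat_r.
left; apply Rinv_0_lt_compat; lra. generalize (pow_le r n ltac:(lra)). lra.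
Qed.

Lemma summable_inv_sq : summable (fun k => / (INR (S k) * INR (S k))).
Proof.
assert (Hp : forall k, 0 < INR (S k)) by (intros; apply lt_0_INR; lia).
split. intros; left; apply Rinv_0_lt_compat, Rmult_lt_0_compat; auto.
(* The bound telescopes because [/ (x + 1)^2 <= / x - / (x + 1)]. *)
assert (H : forall n, Rsum (fun k => / (INR (S k) * INR (S k))) (S n) <= 2 - / INR (S n)).
{ induction n as [|n IHn]. simpl. lra.
  change (Rsum (fun k => / (INR (S k) * INR (S k))) (S n) + / (INR (S (S n)) * INR (S (S n)))
    <= 2 - / INR (S (S n))).
  assert (Hs := Hp n). rewrite (S_INR (S n)). set (x := INR (S n)) in *.
  assert (0 < / (x * (x+1) * (x + 1))) by (apply Rinv_0_lt_compat; repeat apply Rmult_lt_0_compat; lra).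
  assert (2 - / (x + 1) - (2 - / x + / ((x + 1) * (x + 1))) = / (x * (x+1) * (x + 1)))
    by (field; lra).
  lra. }
exists 2. intros [|n]. simpl; lra. eapply Rle_trans; [apply H|].
generalize (Rinv_0_lt_compat _ (Hp n)). lra.
Qed.

Lemma Cser_cv a b : summable b -> (forall k, Cmod (a k) <= b k) -> exists l, Cser a l.
Proof.
intros Hb Hab. apply Clim_cauchy. intros eps He.
destruct (summable_tail b Hb (eps/2)) as [N HN]; [lra|].
exists N. intros n m Hn Hm.
generalize (Csum_dist_le a b N n Hab Hn) (Csum_dist_le a b N m Hab Hm) (HN n Hn) (HN m Hm).
generalize (Cmod_sub_triangle (Csum a n) (Csum a N) (Csum a m)).
rewrite (Cmod_sub_sym (Csum a N) (Csum a m)). lra.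
Qed.

Lemma Cser_unique a l l' : Cser a l -> Cser a l' -> l = l'.
Proof. apply Clim_unique. Qed.

Lemma Cser_ext a b l : (forall k, a k = b k) -> Cser a l -> Cser b l.
Proof. intros H. apply Clim_ext. intros n. apply Csum_ext. auto. Qed.

Lemma Cser_add a b l m : Cser a l -> Cser b m -> Cser (fun k => a k + b k)%C (l + m)%C.
Proof.
intros H H'. apply Clim_ext with (fun n => Csum a n + Csum b n)%C.
intros; symmetry; apply Csum_add. now apply Clim_add.
Qed.

Lemma Cser_sub a b l m : Cser a l -> Cser b m -> Cser (fun k => a k - b k)%C (l - m)%C.
Proof.
intros H H'. apply Clim_ext with (fun n => Csum a n - Csum b n)%C.
intros; symmetry; apply Csum_sub. now apply Clim_sub.
Qed.

Lemma Cser_scal c a l : Cser a l -> Cser (fun k => c * a k)%C (c * l)%C.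
Proof.
intros H. apply Clim_ext with (fun n => c * Csum a n)%C.
intros; symmetry; apply Csum_scal. now apply Clim_scal.
Qed.

Lemma Cser_shift a l : Cser (fun k => a (S k)) l -> Cser a (a O + l)%C.
Proof.
intros H. apply Clim_ext_eventually with (N0 := 1%nat)
  (u := fun n => (a O + Csum (fun k => a (S k)) (n - 1))%C).
- intros [|n] Hn. lia. rewrite Csum_shift. simpl. now rewrite Nat.sub_0_r.
- apply Clim_add. apply Clim_const.
  intros eps He. destruct (H eps He) as [N HN]. exists (S N). intros n Hn. apply HN. lia.
Qed.

Lemma Cser_unshift a l : Cser a l -> Cser (fun k => a (S k)) (l - a O)%C.
Proof.
intros H. apply Clim_ext with (fun n => Csum a (S n) - a O)%C.
intros n. rewrite Csum_shift. ring.
apply Clim_sub; [|apply Clim_const].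
apply (Clim_subseq (Csum a) l S); auto.
Qed.

Lemma Cser_term_lim a l : Cser a l -> Clim a 0.
Proof.
intros H. apply Clim_ext with (fun n => Csum a (S n) - Csum a n)%C.
intros n. simpl. ring.
replace (RtoC 0) with (l - l)%C by ring. apply Clim_sub; auto.
apply (Clim_subseq (Csum a) l S); auto.
Qed.

Lemma Cser_tail_le a b l N eps : (forall k, Cmod (a k) <= b k) ->
  (forall m, (N <= m)%nat -> Rsum b m - Rsum b N < eps) -> Cser a l ->
  Cmod (l - Csum a N) <= eps.
Proof.
intros Hab HN H. apply Clim_le_dist with (Csum a) N; auto.
intros n Hn. generalize (Csum_dist_le a b N n Hab Hn) (HN n Hn). lra.
Qed.

Lemma Cser_le a b l B : (forall k, Cmod (a k) <= b k) -> (forall n, Rsum b n <= B) ->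
  Cser a l -> Cmod l <= B.
Proof.
intros Hab HB H. apply Clim_le_Cmod with (Csum a); auto.
intros n. eapply Rle_trans. now apply Cmod_Csum_le. apply HB.
Qed.

(** Built exactly like [qpoch], so that [qpoch a p] is [Clim_val (qpoch_part a p)] by conversion. It
    also turns pointwise existence of limits into a function, as needed in [fubini]. *)
Definition Clim_val (u : nat -> C) : C :=
  (real (Lim_seq (fun n => Re (u n))), real (Lim_seq (fun n => Im (u n)))).

Lemma Clim_val_eq u l : Clim u l -> Clim_val u = l.
Proof.
intros H. destruct (Clim_is_lim_seq u l H) as [H1 H2]. unfold Clim_val.
rewrite (is_lim_seq_unique _ _ H1), (is_lim_seq_unique _ _ H2). now destruct l.
Qed.

Lemma Clim_val_correct u : (exists l, Clim u l) -> Clim u (Clim_val u).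
Proof. intros [l H]. now rewrite (Clim_val_eq u l H). Qed.

(** * Dominated convergence and exchange of summations *)

Lemma Clim_Csum (a : nat -> nat -> C) al n :
  (forall i, (i < n)%nat -> Clim (fun k => a k i) (al i)) ->
  Clim (fun k => Csum (a k) n) (Csum al n).
Proof.
induction n; intros H; simpl. apply Clim_const.
apply Clim_add. apply IHn. intros; apply H; lia. apply H. lia.
Qed.

(** Dominated convergence for series: a finite head converges termwise and both tails are small
    uniformly in [k]. It is the device that turns finite identities into infinite ones
    throughout. *)
Lemma tannery (a : nat -> nat -> C) (al : nat -> C) (b : nat -> R) (s : nat -> C) :
  summable b -> (forall k i, Cmod (a k i) <= b i) ->
  (forall i, Clim (fun k => a k i) (al i)) ->
  (forall k, Cser (a k) (s k)) -> exists S, Cser al S /\ Clim s S.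
Proof.
intros Hb Hab Hal Hs.
assert (Hlb : forall i, Cmod (al i) <= b i).
{ intros i. apply Clim_le_Cmod with (fun k => a k i); auto. }
destruct (Cser_cv al b Hb Hlb) as [S HS]. exists S. split; auto.
intros eps He.
destruct (summable_tail b Hb (eps/4)) as [N HN]; [lra|].
destruct (Clim_Csum a al N (fun i _ => Hal i) (eps/4)) as [K HK]; [lra|].
exists K. intros k Hk. specialize (HK k Hk).
generalize (Cser_tail_le _ b _ N _ (Hab k) HN (Hs k)) (Cser_tail_le _ b _ N _ Hlb HN HS).
generalize (Cmod_sub_triangle (s k) (Csum (a k) N) S) (Cmod_sub_triangle (Csum (a k) N) (Csum al N) S).
rewrite (Cmod_sub_sym (Csum al N) S). lra.
Qed.

(** Here the range of summation grows with [k]; terms outside it are replaced by 0, which the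
    majorant also dominates. *)
Lemma tannery_finite (a : nat -> nat -> C) (al : nat -> C) (b : nat -> R) (n : nat -> nat) :
  summable b -> (forall k i, (i < n k)%nat -> Cmod (a k i) <= b i) ->
  (forall i, Clim (fun k => a k i) (al i)) -> (forall i, exists K, forall k, (K <= k)%nat -> (i < n k)%nat) ->
  exists S, Cser al S /\ Clim (fun k => Csum (a k) (n k)) S.
Proof.
intros Hb Hab Hal Hn.
apply (tannery (fun k i => if (i <? n k)%nat then a k i else 0%C) al b); auto.
- intros k i. destruct (Nat.ltb_spec i (n k)); auto. rewrite Cmod_0. apply Hb.
- intros i. destruct (Hn i) as [K HK].
  apply Clim_ext_eventually with (2 := Hal i) (N0 := K). intros k Hk.
  destruct (Nat.ltb_spec i (n k)); auto. specialize (HK k Hk). lia.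
- intros k. apply Clim_ext_eventually with (N0 := n k) (2 := Clim_const (Csum (a k) (n k))).
  intros m Hm. replace m with (n k + (m - n k))%nat by lia. rewrite Csum_split.
  replace (Csum (a k) (n k)) with (Csum (a k) (n k) + RtoC 0 * Csum (a k) (m - n k))%C by ring.
  f_equal.
  + apply Csum_ext. intros i Hi. destruct (Nat.ltb_spec i (n k)); auto. lia.
  + rewrite <- Csum_scal. apply Csum_ext. intros i Hi.
    destruct (Nat.ltb_spec (n k + i) (n k)). lia. ring.
Qed.

Lemma Cser_Csum (a : nat -> nat -> C) c n :
  (forall j, Cser (fun i => a i j) (c j)) -> Cser (fun i => Csum (a i) n) (Csum c n).
Proof.
intros H. induction n; simpl.
- apply Clim_ext with (2 := Clim_const 0%C). intros n. induction n; simpl; auto. rewrite <- IHn. ring.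
- apply Cser_add; auto.
Qed.

(** The first [k] columns together sum to the series of the [k]-th partial row sums, so [tannery]
    with the row bounds [b] as majorant lets [k] tend to infinity. The array [d] bounds the entries
    and [b] bounds the rows of [d]. *)
Lemma fubini (a : nat -> nat -> C) (d : nat -> nat -> R) (b : nat -> R) :
  summable b -> (forall i j, Cmod (a i j) <= d i j) -> (forall i n, Rsum (d i) n <= b i) ->
  exists r c S, (forall i, Cser (a i) (r i)) /\ (forall j, Cser (fun i => a i j) (c j)) /\
    Cser r S /\ Cser c S /\ (forall i, Cmod (r i) <= b i).
Proof.
intros Hb Had Hdb.
assert (Hd0 : forall i j, 0 <= d i j) by (intros; eapply Rle_trans; [apply Cmod_ge_0|apply Had]).
assert (Hdij : forall i j, d i j <= b i).
{ intros i j. eapply Rle_trans; [|apply (Hdb i (S j))]. simpl.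
  generalize (Rsum_nonneg (d i) j (Hd0 i)). lra. }
assert (Hr : forall i, exists r, Cser (a i) r).
{ intros i. apply Cser_cv with (d i); auto. split; auto. exists (b i). auto. }
assert (Hc : forall j, exists c, Cser (fun i => a i j) c).
{ intros j. apply Cser_cv with b; auto. intros i. eapply Rle_trans; eauto. }
set (r := fun i => Clim_val (Csum (a i))). set (c := fun j => Clim_val (Csum (fun i => a i j))).
assert (Hr' : forall i, Cser (a i) (r i)) by (intros i; exact (Clim_val_correct _ (Hr i))).
assert (Hc' : forall j, Cser (fun i => a i j) (c j)) by (intros j; exact (Clim_val_correct _ (Hc j))).
clearbody r c. clear Hr Hc. rename Hr' into Hr. rename Hc' into Hc.
destruct (tannery (fun k i => Csum (a i) k) r b (Csum c)) as [S [HS1 HS2]]; auto.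
- intros k i. eapply Rle_trans; [|apply (Hdb i k)]. now apply Cmod_Csum_le.
- intros k. now apply Cser_Csum.
- exists r, c, S. repeat split; auto. intros i. now apply Cser_le with (a i) (d i).
Qed.

Lemma fubini_eq (a : nat -> nat -> C) (d : nat -> nat -> R) (b : nat -> R) r c s :
  summable b -> (forall i j, Cmod (a i j) <= d i j) -> (forall i n, Rsum (d i) n <= b i) ->
  (forall i, Cser (a i) (r i)) -> (forall j, Cser (fun i => a i j) (c j)) ->
  Cser r s -> Cser c s.
Proof.
intros Hb Had Hdb Hr Hc Hs.
destruct (fubini a d b Hb Had Hdb) as (r' & c' & S & Hr' & Hc' & HS & HS' & _).
assert (s = S) as ->.
{ apply (Cser_unique r); auto. apply Cser_ext with r'; auto. intros i. eapply Cser_unique; eauto. }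
apply Cser_ext with c'; auto. intros i. eapply Cser_unique; eauto. 
Qed.

Lemma Cser_geom x : Cmod x < 1 -> Cser (fun k => x ^ k)%C (/ (1 - x))%C.
Proof.
intros Hx.
assert (Hx1 : (1 - x)%C <> 0).
{ intros E. assert (x = 1) as -> by (replace x with (1 - (1 - x))%C by ring; rewrite E; ring).
  rewrite Cmod_1 in Hx. lra. }
apply Clim_ext with (fun n => / (1 - x) - / (1 - x) * x ^ n)%C.
- induction n; simpl. field; auto. rewrite <- IHn. field; auto.
- replace (/ (1 - x))%C with (/ (1 - x) - / (1 - x) * 0)%C at 1 by ring.
  apply Clim_sub. apply Clim_const. apply Clim_scal.
  apply Clim_squeeze_0 with (fun n => Cmod x ^ n). intros; rewrite Cmod_pow; lra.
  intros eps He. destruct (pow_lt_1_zero (Cmod x)) with (y := eps) as [N HN]; auto.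
  rewrite Rabs_pos_eq; auto using Cmod_ge_0.
  exists N. intros n Hn. specialize (HN n Hn). rewrite Rabs_pos_eq in HN; auto.
  apply pow_le, Cmod_ge_0.
Qed.

(** * Infinite products *)

Fixpoint Cprod (f : nat -> C) (n : nat) : C :=
  match n with O => 1%C | S k => (Cprod f k * f k)%C end.

Lemma Cprod_split f n m : Cprod f (n + m) = (Cprod f n * Cprod (fun k => f (n + k)%nat) m)%C.
Proof.
induction m; simpl. rewrite Nat.add_0_r. ring.
rewrite Nat.add_succ_r. simpl. rewrite IHm. ring.
Qed.

Lemma Cprod_neq_0 (f : nat -> C) n : (forall k, f k <> 0) -> Cprod f n <> 0.
Proof. intros H. induction n; simpl. exact C1_nz. apply Cmult_neq_0; [exact IHn|apply H]. Qed.

Lemma Cprod_sub_1_le (u : nat -> C) (b : nat -> R) n : (forall k, Cmod (u k) <= b k) ->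
  Cmod (Cprod (fun k => 1 + u k)%C n - 1) <= exp (Rsum b n) - 1.
Proof.
intros Hub. set (P := Cprod (fun k => 1 + u k)%C). induction n; unfold P; simpl.
- replace (1 - 1)%C with (RtoC 0) by ring. rewrite Cmod_0, exp_0. lra.
- fold (P n). replace (P n * (1 + u n) - 1)%C with ((P n - 1) + (1 + (P n - 1)) * u n)%C by ring.
  eapply Rle_trans; [apply Cmod_triangle|]. rewrite Cmod_mult, exp_plus.
  generalize (Cmod_triangle 1 (P n - 1)). rewrite Cmod_1. intros H1.
  assert (Cmod (1 + (P n - 1)) * Cmod (u n) <= exp (Rsum b n) * b n).
  { apply Rmult_le_compat; auto using Cmod_ge_0. lra. }
  generalize (exp_ineq1_le (b n)) (exp_pos (Rsum b n)). nra.
Qed.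

(** The second order counterpart of [Cprod_sub_1_le]: it isolates the linear term of a product,
    which is what differentiating an infinite product requires. *)
Lemma Cprod_sub_1_sub_Csum_le (u : nat -> C) (b : nat -> R) n : (forall k, Cmod (u k) <= b k) ->
  Cmod (Cprod (fun k => 1 + u k)%C n - 1 - Csum u n) <= exp (Rsum b n) - 1 - Rsum b n.
Proof.
intros Hub. set (P := Cprod (fun k => 1 + u k)%C). induction n; unfold P; simpl.
- replace (1 - 1 - 0)%C with (RtoC 0) by ring. rewrite Cmod_0, exp_0. lra.
- fold (P n). replace (P n * (1 + u n) - 1 - (Csum u n + u n))%C
    with ((P n - 1 - Csum u n) + (P n - 1) * u n)%C by ring.
  eapply Rle_trans; [apply Cmod_triangle|]. rewrite Cmod_mult, exp_plus.
  assert (Cmod (P n - 1) * Cmod (u n) <= (exp (Rsum b n) - 1) * b n).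
  { apply Rmult_le_compat; auto using Cmod_ge_0. now apply Cprod_sub_1_le. }
  generalize (exp_ineq1_le (b n)) (exp_pos (Rsum b n)). nra.
Qed.

Lemma Cmod_Cprod_le (u : nat -> C) (b : nat -> R) n : (forall k, Cmod (u k) <= b k) ->
  Cmod (Cprod (fun k => 1 + u k)%C n) <= exp (Rsum b n).
Proof.
intros Hub. generalize (Cprod_sub_1_le u b n Hub) (Cmod_triangle_sub (Cprod (fun k => 1 + u k)%C n) 1). rewrite Cmod_1. lra.
Qed.

Lemma Cprod_cv (u : nat -> C) (b : nat -> R) : (forall k, Cmod (u k) <= b k) -> summable b ->
  exists l, Clim (Cprod (fun k => 1 + u k)%C) l.
Proof.
intros Hub [Hb0 [B HB]]. set (P := Cprod (fun k => 1 + u k)%C).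
(* The product is 1 plus the sum of its increments [P (S k) - P k = P k * u k], where [P k] is
   bounded by [exp B]. *)
destruct (Cser_cv (fun k => P k * u k)%C (fun k => exp B * b k)) as [l Hl].
- apply summable_scal. left; apply exp_pos. split; eauto.
- intros k. rewrite Cmod_mult. apply Rmult_le_compat; auto using Cmod_ge_0.
  eapply Rle_trans; [now apply (Cmod_Cprod_le u b)|]. apply exp_le_exp, HB.
- exists (1 + l)%C. apply Clim_ext with (fun n => 1 + Csum (fun k => P k * u k) n)%C.
  + intros n. induction n; simpl. unfold P; simpl. ring.
    rewrite Cplus_assoc, IHn. unfold P; simpl. ring.
  + apply Clim_add; auto using Clim_const.
Qed.

Lemma Cprod_lim_neq_0 (u : nat -> C) (b : nat -> R) l : (forall k, Cmod (u k) <= b k) -> summable b ->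
  (forall k, (1 + u k)%C <> 0) -> Clim (Cprod (fun k => 1 + u k)%C) l -> l <> 0.
Proof.
intros Hub Hb Hu Hl E. subst l. set (P := Cprod (fun k => 1 + u k)%C) in *.
(* Beyond [N] the product of any further factors differs from 1 by less than [3/2 - 1 = 1/2], so the
   partial products never fall below half of [Cmod (P N)]. *)
destruct (summable_tail b Hb (ln (3/2))) as [N HN].
{ rewrite <- ln_1. apply ln_increasing; lra. }
assert (HP : P N <> 0%C) by now apply Cprod_neq_0.
apply Cmod_gt_0 in HP.
destruct (Hl (Cmod (P N) / 2)) as [M HM]; [lra|].
specialize (HM (N + M)%nat ltac:(lia)). specialize (HN (N + M)%nat ltac:(lia)).
replace (P (N + M)%nat - 0)%C with (P (N+M)%nat) in HM by ring.
unfold P in HM. rewrite Cprod_split, Cmod_mult in HM. fold (P N) in HM.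
assert (forall m, Cmod (Cprod (fun k => 1 + u (N + k)%nat)%C m - 1)
   <= exp (Rsum b (N + m) - Rsum b N) - 1) as H.
{ induction m; simpl.
  - replace (1 - 1)%C with (RtoC 0) by ring. rewrite Nat.add_0_r, Rminus_diag, Cmod_0, exp_0. lra.
  - set (p := Cprod _ m) in *. rewrite Nat.add_succ_r. simpl.
    replace (p * (1 + u (N + m)%nat) - 1)%C with ((p - 1) + (1 + (p - 1)) * u (N+m)%nat)%C by ring.
    replace (Rsum b (N + m) + b (N + m)%nat - Rsum b N) with
      ((Rsum b (N + m) - Rsum b N) + b (N + m)%nat) by ring.
    eapply Rle_trans; [apply Cmod_triangle|]. rewrite Cmod_mult, exp_plus.
    generalize (Cmod_triangle 1 (p - 1)). rewrite Cmod_1. intros H1.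
    set (e := exp (Rsum b (N + m) - Rsum b N)) in *.
    assert (Cmod (1 + (p - 1)) * Cmod (u (N+m)%nat) <= e * b (N+m)%nat).
    { apply Rmult_le_compat; auto using Cmod_ge_0. lra. }
    generalize (exp_ineq1_le (b (N+m)%nat)) (exp_pos (Rsum b (N+m) - Rsum b N)).
    fold e. nra. }
specialize (H M). apply exp_increasing in HN. rewrite exp_ln in HN by lra.
set (p := Cprod _ M) in *.
generalize (Cmod_triangle_sub 1 p). rewrite Cmod_1, Cmod_sub_sym. nra.
Qed.

(** * The q-Pochhammer symbol *)

Lemma qpoch_part_Cprod a p n : qpoch_part a p n = Cprod (fun k => 1 + - (a * p ^ k))%C n.
Proof. induction n; simpl; auto. rewrite IHn. reflexivity. Qed.

Lemma qpoch_eq a p l : Clim (qpoch_part a p) l -> qpoch a p = l.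
Proof. apply Clim_val_eq. Qed.

Lemma summable_qpoch a p : Cmod p < 1 -> summable (fun k => Cmod a * Cmod p ^ k).
Proof. intros H. apply summable_scal. apply Cmod_ge_0. apply summable_geom. split; auto using Cmod_ge_0. Qed.

Lemma qpoch_lim a p : Cmod p < 1 -> Clim (qpoch_part a p) (qpoch a p).
Proof.
intros H. destruct (Cprod_cv (fun k => - (a * p ^ k))%C (fun k => Cmod a * Cmod p ^ k)) as [l Hl].
- intros k. rewrite Cmod_opp, Cmod_mult, Cmod_pow. lra.
- now apply summable_qpoch.
- assert (Clim (qpoch_part a p) l) as H'.
  { apply Clim_ext with (2 := Hl). intros n. now rewrite qpoch_part_Cprod. }
  now rewrite (qpoch_eq a p l H').
Qed.

Lemma qpoch_neq_0 a p : Cmod p < 1 -> (forall k, (1 - a * p ^ k)%C <> 0) -> qpoch a p <> 0.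
Proof.
intros H H0. eapply (Cprod_lim_neq_0 (fun k => - (a * p ^ k))%C (fun k => Cmod a * Cmod p ^ k)).
- intros k. rewrite Cmod_opp, Cmod_mult, Cmod_pow. lra.
- now apply summable_qpoch.
- exact H0.
- apply Clim_ext with (2 := qpoch_lim a p H). intros n. now rewrite qpoch_part_Cprod.
Qed.

Lemma Cmod_pow_lt_1 x n : Cmod x < 1 -> (0 < n)%nat -> Cmod (x ^ n)%C < 1.
Proof.
intros Hx Hn. rewrite Cmod_pow. destruct n as [|n]; [lia|]. simpl.
assert (Cmod x ^ n <= 1). { rewrite <- (pow1 n). apply pow_incr. split; auto using Cmod_ge_0. lra. }
generalize (Cmod_ge_0 x) (pow_le (Cmod x) n (Cmod_ge_0 x)). nra.
Qed.

Lemma one_sub_neq_0 x : Cmod x < 1 -> (1 - x)%C <> 0.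
Proof.
intros Hx E. assert (x = 1) as -> by (replace x with (1 - (1 - x))%C by ring; rewrite E; ring).
rewrite Cmod_1 in Hx. lra.
Qed.

Lemma qpoch_neq_0_lt a p : Cmod p < 1 -> Cmod a < 1 -> qpoch a p <> 0.
Proof.
intros Hp Ha. apply qpoch_neq_0; auto. intros k. apply one_sub_neq_0.
rewrite Cmod_mult, Cmod_pow.
assert (Cmod p ^ k <= 1). { rewrite <- (pow1 k). apply pow_incr. split; auto using Cmod_ge_0. lra. }
generalize (Cmod_ge_0 a) (pow_le (Cmod p) k (Cmod_ge_0 p)). nra.
Qed.

Lemma qpoch_mul_opp a p : Cmod p < 1 -> (qpoch a p * qpoch (- a) p)%C = qpoch (a ^ 2) (p ^ 2).
Proof.
intros H. symmetry. apply qpoch_eq.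
apply Clim_ext with (fun n => qpoch_part a p n * qpoch_part (- a) p n)%C.
2: apply Clim_mul; auto using qpoch_lim.
induction n. simpl. ring. cbn [qpoch_part]. rewrite <- IHn, <- Cpow_mult_r, (Nat.mul_comm 2), Cpow_mult_r.
ring.
Qed.

Lemma qpoch_dissect_5 a p : Cmod p < 1 ->
  qpoch a p = (qpoch a (p^5) * qpoch (a * p) (p^5) * qpoch (a * p^2) (p^5) *
               qpoch (a * p^3) (p^5) * qpoch (a * p^4) (p^5))%C.
Proof.
intros H. assert (H5 : Cmod (p^5)%C < 1) by (apply Cmod_pow_lt_1; auto; lia).
apply Clim_unique with (fun n => qpoch_part a p (5 * n)).
- apply (Clim_subseq (qpoch_part a p) _ (fun n => 5 * n)%nat); auto using qpoch_lim. intros; lia.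
- apply Clim_ext with (fun n => qpoch_part a (p^5) n * qpoch_part (a * p) (p^5) n *
    qpoch_part (a * p^2) (p^5) n * qpoch_part (a * p^3) (p^5) n * qpoch_part (a * p^4) (p^5) n)%C.
  2: repeat apply Clim_mul; auto using qpoch_lim.
  induction n. simpl. ring.
  replace (5 * S n)%nat with (S (S (S (S (S (5 * n))))))%nat by lia. cbn [qpoch_part].
  rewrite <- IHn. rewrite (Cpow_S p (S (S (S (5 * n))))), !(Cpow_S _ (S (S (5 * n)))),
    (Cpow_S _ (S (5 * n))), (Cpow_S _ (5 * n)), Cpow_mult_r.
  set (r := ((p ^ 5) ^ n)%C). ring.
Qed.

(** * Integer powers and absolutely convergent sums over the integers *)

Definition Czpow (x : C) (n : Z) : C :=
  match n with
  | Z0 => 1%C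
  | Zpos k => (x ^ Pos.to_nat k)%C
  | Zneg k => (/ (x ^ Pos.to_nat k))%C
  end.

Lemma Czpow_of_nat x n : Czpow x (Z.of_nat n) = (x ^ n)%C.
Proof. destruct n; auto. simpl. now rewrite SuccNat2Pos.id_succ. Qed.

Lemma Czpow_opp_nat x n : Czpow x (- Z.of_nat n) = (/ (x ^ n))%C.
Proof. destruct n; simpl. field; exact C1_nz. now rewrite SuccNat2Pos.id_succ. Qed.

Lemma Czpow_succ (x : C) n : x <> 0 -> Czpow x (n + 1) = (x * Czpow x n)%C.
Proof.
intros Hx. destruct (Z_le_gt_dec 0 n) as [h|h].
- rewrite <- (Z2Nat.id n h). replace (Z.of_nat (Z.to_nat n) + 1)%Z with (Z.of_nat (S (Z.to_nat n))) by lia.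
  now rewrite !Czpow_of_nat.
- replace n with (- Z.of_nat (S (Z.to_nat (- n - 1))))%Z by lia. set (m := Z.to_nat _).
  replace (- Z.of_nat (S m) + 1)%Z with (- Z.of_nat m)%Z by lia.
  rewrite !Czpow_opp_nat, Cpow_S. pose proof (Cpow_nz x m Hx). field. auto.
Qed.

Lemma Z_ind_succ_pred (P : Z -> Prop) : P 0%Z -> (forall n, P n <-> P (n + 1)%Z) -> forall n, P n.
Proof.
intros H0 HS n. destruct (Z_le_gt_dec 0 n) as [h|h].
- rewrite <- (Z2Nat.id n h). induction (Z.to_nat n) as [|m IH]; auto.
  replace (Z.of_nat (S m)) with (Z.of_nat m + 1)%Z by lia. now apply (proj1 (HS _)).
- replace n with (- Z.of_nat (Z.to_nat (- n)))%Z by lia. induction (Z.to_nat (- n)) as [|m IH]; auto.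
  apply (proj2 (HS _)). now replace (- Z.of_nat (S m) + 1)%Z with (- Z.of_nat m)%Z by lia.
Qed.

Lemma Czpow_neq_0 (x : C) n : x <> 0 -> Czpow x n <> 0.
Proof.
intros Hx. destruct n; simpl. exact C1_nz. now apply Cpow_nz.
intros E. apply C1_nz. rewrite <- (Cinv_r (x ^ Pos.to_nat p)%C), E. ring. now apply Cpow_nz.
Qed.

Lemma Czpow_add (x : C) n m : x <> 0 -> Czpow x (n + m) = (Czpow x n * Czpow x m)%C.
Proof.
intros Hx. revert n. apply Z_ind_succ_pred. simpl. ring.
intros n. replace (n + 1 + m)%Z with (n + m + 1)%Z by lia. rewrite !Czpow_succ by auto.
split; intros H. rewrite H. ring.
replace (Czpow x (n + m)) with (/ x * (x * Czpow x (n + m)))%C by (field; auto).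
rewrite H. field. auto.
Qed.

Lemma Czpow_opp (x : C) n : x <> 0 -> Czpow x (- n) = (/ Czpow x n)%C.
Proof.
intros Hx. pose proof (Czpow_neq_0 x n Hx).
assert (Czpow x (- n) * Czpow x n = 1)%C as E.
{ rewrite <- Czpow_add by auto. now replace (- n + n)%Z with 0%Z by lia. }
replace (Czpow x (-n)) with (Czpow x (- n) * Czpow x n * / Czpow x n)%C by (field; auto).
rewrite E. ring.
Qed.

Lemma Czpow_mul_l (x y : C) n : x <> 0 -> y <> 0 -> Czpow (x * y) n = (Czpow x n * Czpow y n)%C.
Proof.
intros Hx Hy. destruct n; simpl. ring. apply Cpow_mult_l.
rewrite Cpow_mult_l. field. split; now apply Cpow_nz.
Qed.

Lemma Czpow_mul_r (x : C) n m : x <> 0 -> Czpow x (n * m) = Czpow (Czpow x n) m.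
Proof.
intros Hx. revert m. apply Z_ind_succ_pred. now rewrite Z.mul_0_r.
intros m. replace (n * (m + 1))%Z with (n * m + n)%Z by lia.
rewrite Czpow_add, Czpow_succ by auto using Czpow_neq_0.
pose proof (Czpow_neq_0 x n Hx) as Hn.
split; intros H. rewrite H. ring.
replace (Czpow x (n * m)) with (/ Czpow x n * (Czpow x (n * m) * Czpow x n))%C by (field; auto).
rewrite H. field. auto.
Qed.

(** The index [n] is paired with [-1 - n]: every integer occurs exactly once, no central term is
    left alone, and the reflection [n -> -1 - n] preserves each pair. *)
Definition Zser (a : Z -> C) (l : C) : Prop :=
  Cser (fun k => a (Z.of_nat k) + a (-1 - Z.of_nat k)%Z)%C l.

Definition Zsummable (b : Z -> R) : Prop :=
  (forall n, 0 <= b n) /\ summable (fun k => b (Z.of_nat k) + b (-1 - Z.of_nat k)%Z).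

Definition Zabs (a : Z -> C) : Prop := Zsummable (fun n => Cmod (a n)).

Lemma Zser_ext a b l : (forall n, a n = b n) -> Zser a l -> Zser b l.
Proof. intros H. apply Cser_ext. intros k. now rewrite !H. Qed.

Lemma Zser_scal c a l : Zser a l -> Zser (fun n => c * a n)%C (c * l)%C.
Proof. intros H. eapply Cser_ext; [|apply (Cser_scal c _ _ H)]. intros k. simpl. ring. Qed.

Lemma Zser_add a b l m : Zser a l -> Zser b m -> Zser (fun n => a n + b n)%C (l + m)%C.
Proof. intros H H'. eapply Cser_ext; [|apply (Cser_add _ _ _ _ H H')]. intros k. simpl. ring. Qed.

Lemma Zabs_le a b : Zsummable b -> (forall n, Cmod (a n) <= b n) -> Zabs a.
Proof.
intros [Hb H] Hab. split. intros; apply Cmod_ge_0.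
apply summable_le with (2 := H). intros k. split.
generalize (Cmod_ge_0 (a (Z.of_nat k))) (Cmod_ge_0 (a (-1 - Z.of_nat k)%Z)). lra.
generalize (Hab (Z.of_nat k)) (Hab (-1 - Z.of_nat k)%Z). lra.
Qed.

Lemma Zsummable_scal c b : 0 <= c -> Zsummable b -> Zsummable (fun n => c * b n).
Proof.
intros Hc [Hb H]. split. intros; now apply Rmult_le_pos.
eapply summable_le; [|apply (summable_scal c _ Hc H)]. intros k. cbv beta.
generalize (Rmult_le_pos _ _ Hc (Hb (Z.of_nat k))) (Rmult_le_pos _ _ Hc (Hb (-1 - Z.of_nat k)%Z)). intros; split; lra.
Qed.

Lemma Zabs_scal c a : Zabs a -> Zabs (fun n => c * a n)%C.
Proof.
intros H. eapply Zabs_le; [apply (Zsummable_scal (Cmod c) _ (Cmod_ge_0 c) H)|].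
intros n. simpl. rewrite Cmod_mult. lra.
Qed.

Lemma summable_lim_0 b : summable b -> forall eps, 0 < eps -> exists N, forall n, (N <= n)%nat -> b n < eps.
Proof.
intros Hb eps He. destruct (summable_tail b Hb eps He) as [N HN]. exists N. intros n Hn.
specialize (HN (S n) ltac:(lia)). simpl in HN.
generalize (Rsum_mono b N n (proj1 Hb) Hn). lra.
Qed.

Lemma Zabs_lim_0 a : Zabs a ->
  Clim (fun k => a (Z.of_nat k)) 0 /\ Clim (fun k => a (-1 - Z.of_nat k)%Z) 0.
Proof.
intros [H0 H]. split; eapply Clim_squeeze_0; try apply (summable_lim_0 _ H); intros k; cbv beta.
- generalize (H0 (-1 - Z.of_nat k)%Z). cbv beta. lra.
- generalize (H0 (Z.of_nat k)). cbv beta. lra.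
Qed.

Lemma Zser_succ a l : Zabs a -> Zser a l -> Zser (fun n => a (n + 1)%Z) l.
Proof.
intros Ha H. destruct (Zabs_lim_0 a Ha) as [H1 H2].
replace l with (l + (0 - 0))%C by ring.
(* Moving the window [-n .. n-1] one place to the right gains [a n] and loses [a (-n)]; both tend to
   0. *)
apply Clim_ext with (fun n => Csum (fun k => a (Z.of_nat k) + a (-1 - Z.of_nat k)%Z)%C n +
   (a (Z.of_nat n) - a (- Z.of_nat n)%Z))%C.
- induction n; [simpl; ring|]. cbn [Csum]. rewrite <- IHn.
  replace (Z.of_nat n + 1)%Z with (Z.of_nat (S n)) by lia.
  replace (-1 - Z.of_nat n + 1)%Z with (- Z.of_nat n)%Z by lia.
  replace (- Z.of_nat (S n))%Z with (-1 - Z.of_nat n)%Z by lia. ring.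
- apply Clim_add; auto. apply Clim_sub; auto.
  intros eps He. destruct (H2 eps He) as [N HN]. exists (S N). intros n Hn.
  specialize (HN (n - 1)%nat ltac:(lia)). now replace (- Z.of_nat n)%Z with (-1 - Z.of_nat (n-1))%Z by lia.
Qed.

(** Absolute summability with a named bound. The bound survives every shift unchanged, so the rows
    [n -> b (n - m)] of a product of two series are bounded uniformly in [m], as [Zfubini]
    requires. *)
Definition Zbound (a : Z -> C) (B : R) : Prop :=
  forall n, Rsum (fun k => Cmod (a (Z.of_nat k)) + Cmod (a (-1 - Z.of_nat k)%Z)) n <= B.

Lemma Zabs_Zbound a B : Zbound a B -> Zabs a.
Proof.
intros H. split. intros; apply Cmod_ge_0. split.
{ intros k. apply Rplus_le_le_0_compat; apply Cmod_ge_0. }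
now exists B.
Qed.

Lemma Zbound_ext a b B : (forall n, a n = b n) -> Zbound a B -> Zbound b B.
Proof. intros E H n. rewrite (Rsum_ext _ (fun k => Cmod (a (Z.of_nat k)) + Cmod (a (-1 - Z.of_nat k)%Z))).
apply H. intros; now rewrite !E. Qed.

Lemma Zbound_succ a B : Zbound a B -> Zbound (fun n => a (n + 1)%Z) B.
Proof.
intros HB n. eapply Rle_trans; [|apply (HB (S n))].
assert (E : Rsum (fun k => Cmod (a (Z.of_nat k + 1)%Z) + Cmod (a (-1 - Z.of_nat k + 1)%Z)) n =
  Rsum (fun k => Cmod (a (Z.of_nat k)) + Cmod (a (-1 - Z.of_nat k)%Z)) n
  + Cmod (a (Z.of_nat n)) - Cmod (a (- Z.of_nat n)%Z)).
{ clear. induction n; [simpl; ring|]. cbn [Rsum]. rewrite IHn.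
  replace (Z.of_nat n + 1)%Z with (Z.of_nat (S n)) by lia.
  replace (-1 - Z.of_nat n + 1)%Z with (- Z.of_nat n)%Z by lia.
  replace (- Z.of_nat (S n))%Z with (-1 - Z.of_nat n)%Z by lia. ring. }
rewrite E. cbn [Rsum].
generalize (Cmod_ge_0 (a (- Z.of_nat n)%Z)) (Cmod_ge_0 (a (-1 - Z.of_nat n)%Z)). lra.
Qed.

Lemma Zbound_refl a B : Zbound a B -> Zbound (fun n => a (-1 - n)%Z) B.
Proof.
intros H n. eapply Rle_trans; [|apply (H n)]. apply Rsum_le. intros k _.
replace (-1 - (-1 - Z.of_nat k))%Z with (Z.of_nat k) by lia. lra.
Qed.

Lemma Zbound_shift a B m : Zbound a B -> Zbound (fun n => a (n + m)%Z) B.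
Proof.
intros H. revert m. apply Z_ind_succ_pred.
- apply Zbound_ext with (2 := H). intros; f_equal; lia.
- intros m. split; intros H1.
  + apply Zbound_ext with (2 := Zbound_succ _ _ H1). intros; f_equal; lia.
  + apply Zbound_ext with (2 := Zbound_refl _ _ (Zbound_succ _ _ (Zbound_refl _ _ H1))). intros; f_equal; lia.
Qed.

Lemma Zabs_shift a m : Zabs a -> Zabs (fun n => a (n + m)%Z).
Proof. intros [_ [_ [B HB]]]. apply Zabs_Zbound with B. now apply Zbound_shift. Qed.

Lemma Zser_refl a l : Zser a l -> Zser (fun n => a (-1 - n)%Z) l.
Proof.
intros H. eapply Cser_ext; [|apply H]. intros k. cbv beta.
replace (-1 - (-1 - Z.of_nat k))%Z with (Z.of_nat k) by lia. ring.
Qed.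

Lemma Zser_shift a l m : Zabs a -> Zser a l -> Zser (fun n => a (n + m)%Z) l.
Proof.
intros Ha H. revert m. apply Z_ind_succ_pred.
- apply Zser_ext with (2 := H). intros; f_equal; lia.
- intros m. split; intros H2.
  + apply Zser_ext with (2 := Zser_succ _ _ (Zabs_shift _ m Ha) H2). intros; f_equal; lia.
  + assert (Zabs (fun n => a (-1 - n + (m + 1))%Z)) as H3.
    { destruct Ha as [_ [_ [B HB]]]. apply Zabs_Zbound with B.
      apply (Zbound_refl (fun n => a (n + (m + 1))%Z)). now apply Zbound_shift. }
    apply Zser_ext with (2 := Zser_refl _ _ (Zser_succ _ _ H3 (Zser_refl _ _ H2))). intros; f_equal; lia.
Qed.

(** The window [-2n .. 2n-1] consists exactly of the even and the odd numbers built from the window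
    [-n .. n-1], so the partial sums agree without a boundary term. *)
Lemma Zser_parity a l l0 l1 : Zser a l -> Zser (fun n => a (2 * n)%Z) l0 ->
  Zser (fun n => a (2 * n + 1)%Z) l1 -> l = (l0 + l1)%C.
Proof.
intros H H0 H1.
apply (Clim_unique (fun n => Csum (fun k => a (Z.of_nat k) + a (-1 - Z.of_nat k)%Z)%C (2 * n))).
- apply (Clim_subseq _ _ (fun n => 2 * n)%nat); auto. intros; lia.
- eapply Clim_ext; [|apply (Clim_add _ _ _ _ H0 H1)].
  induction n; [simpl; ring|].
  replace (2 * S n)%nat with (S (S (2 * n))) by lia. cbn [Csum]. rewrite <- IHn.
  replace (Z.of_nat (2 * n)) with (2 * Z.of_nat n)%Z by lia.
  replace (Z.of_nat (S (2 * n))) with (2 * Z.of_nat n + 1)%Z by lia.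
  replace (-1 - (2 * Z.of_nat n + 1))%Z with (2 * (-1 - Z.of_nat n))%Z by lia.
  replace (-1 - 2 * Z.of_nat n)%Z with (2 * (-1 - Z.of_nat n) + 1)%Z by lia. ring.
Qed.

(** The four quadrants are folded onto one, which reduces the exchange to [fubini_eq] over the
    natural numbers. *)
Lemma Zfubini (a : Z -> Z -> C) (b : Z -> R) r c s : Zsummable b ->
  (forall m, Zbound (a m) (b m)) ->
  (forall m, Zser (a m) (r m)) -> (forall k, Zser (fun m => a m k) (c k)) -> Zser r s -> Zser c s.
Proof.
intros [Hb0 Hb] Hab Hr Hc Hs.
apply (fubini_eq
  (fun i j => (a (Z.of_nat i) (Z.of_nat j) + a (Z.of_nat i) (-1 - Z.of_nat j)%Z) +
              (a (-1 - Z.of_nat i)%Z (Z.of_nat j) + a (-1 - Z.of_nat i)%Z (-1 - Z.of_nat j)%Z))%C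
  (fun i j => (Cmod (a (Z.of_nat i) (Z.of_nat j)) + Cmod (a (Z.of_nat i) (-1 - Z.of_nat j)%Z)) +
              (Cmod (a (-1 - Z.of_nat i)%Z (Z.of_nat j)) + Cmod (a (-1 - Z.of_nat i)%Z (-1 - Z.of_nat j)%Z)))
  (fun i => b (Z.of_nat i) + b (-1 - Z.of_nat i)%Z)
  (fun i => r (Z.of_nat i) + r (-1 - Z.of_nat i)%Z)%C); auto.
- intros i j. eapply Rle_trans; [apply Cmod_triangle|]. apply Rplus_le_compat; apply Cmod_triangle.
- intros i n. rewrite Rsum_add. apply Rplus_le_compat; apply Hab.
- intros i. apply Cser_add; apply Hr.
- intros j. eapply Cser_ext; [|apply (Cser_add _ _ _ _ (Hc (Z.of_nat j)) (Hc (-1 - Z.of_nat j)%Z))].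
  intros i. cbv beta. ring.
Qed.

(** * The Jacobi triple product *)

Definition tri (n : Z) : Z := (n * (n - 1) / 2)%Z.

Lemma tri_double n : (2 * tri n = n * (n - 1))%Z.
Proof.
unfold tri. assert (exists k, n * (n - 1) = k * 2)%Z as [k ->].
{ destruct (Z.Even_or_Odd n) as [[m ->]|[m ->]].
  exists (m * (2 * m - 1))%Z. lia. exists ((2 * m + 1) * m)%Z. lia. }
rewrite Z.div_mul; lia.
Qed.

Lemma tri_succ n : tri (n + 1) = (tri n + n)%Z.
Proof. generalize (tri_double n) (tri_double (n + 1)). lia. Qed.

Definition theta_term (x p : C) (n : Z) : C := (Czpow (- x) n * Czpow p (tri n))%C.

Definition theta (x p : C) : C := (qpoch x p * qpoch (p / x) p * qpoch p p)%C.

Lemma Copp_neq_0 (x : C) : x <> 0 -> (- x)%C <> 0.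
Proof. intros H E. apply H. replace x with (- - x)%C by ring. rewrite E. ring. Qed.

Lemma theta_term_succ (x p : C) n : x <> 0 -> p <> 0 ->
  theta_term x p (n + 1) = (- x * Czpow p n * theta_term x p n)%C.
Proof.
intros Hx Hp. unfold theta_term. rewrite tri_succ, Czpow_succ, Czpow_add by auto using Copp_neq_0. ring.
Qed.

Lemma theta_term_opp (x p : C) n : x <> 0 -> p <> 0 -> theta_term x p (- n) = theta_term (p / x) p n.
Proof.
intros Hx Hp. unfold theta_term. rewrite Czpow_opp by auto using Copp_neq_0.
replace (- (p / x))%C with (p * / (- x))%C by (field; auto).
assert (/ (- x) <> 0)%C. { intros E. apply C1_nz. rewrite <- (Cinv_l (- x)%C), E. ring. now apply Copp_neq_0. }
rewrite Czpow_mul_l by auto.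
replace (tri (- n)) with (tri n + n)%Z by (generalize (tri_double n) (tri_double (- n)); lia).
rewrite Czpow_add by auto.
replace (Czpow (/ - x) n) with (/ Czpow (- x) n)%C. ring.
revert n. apply Z_ind_succ_pred. simpl. field; exact C1_nz.
intros n. rewrite !Czpow_succ by auto using Copp_neq_0.
pose proof (Czpow_neq_0 (- x) n (Copp_neq_0 x Hx)). pose proof (Copp_neq_0 x Hx).
split; intros E. rewrite <- E. field. auto.
replace (Czpow (/ - x) n) with (- x * (/ - x * Czpow (/ - x) n))%C by (field; auto).
rewrite <- E. field. auto.
Qed.

(** The number [X^n r^(n(n-1)/2)], the modulus of [theta_term] at index [n >= 0]. *)
Fixpoint theta_bound (X r : R) (n : nat) : R :=
  match n with O => 1 | S k => theta_bound X r k * (X * r ^ k) end.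

Lemma summable_theta_bound X r : 0 <= X -> 0 <= r < 1 -> summable (theta_bound X r).
Proof.
intros HX Hr.
assert (H0 : forall k, 0 <= theta_bound X r k).
{ induction k; simpl. lra. repeat apply Rmult_le_pos; auto. apply pow_le; lra. }
split; auto. destruct (summable_geom r Hr) as [_ [B HB]].
exists (exp (X * B)). intros n.
eapply Rle_trans with (exp (Rsum (fun k => X * r ^ k) n)).
(* The last term is at most the whole sum, so adding the next term multiplies the sum by at most
   [1 + X * r^n <= exp (X * r^n)]. *)
- assert (Rsum (theta_bound X r) (S n) <= exp (Rsum (fun k => X * r ^ k) n)) as H.
  { induction n. simpl. rewrite exp_0. lra.
    change (Rsum (theta_bound X r) (S n) + theta_bound X r n * (X * r ^ n) <=
      exp (Rsum (fun k => X * r ^ k) n + X * r ^ n)).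
    rewrite exp_plus. set (e := exp _) in *.
    assert (0 <= X * r ^ n) by (apply Rmult_le_pos; auto; apply pow_le; lra).
    generalize (exp_ineq1_le (X * r ^ n)) (Rsum_nonneg _ n H0) (H0 n). simpl in IHn.
    intros. simpl. assert (0 < e) by apply exp_pos. nra. }
  simpl in H. generalize (H0 n). lra.
- rewrite Rsum_scal. apply exp_le_exp, Rmult_le_compat_l; auto.
Qed.

Lemma Cmod_theta_term_nat (x p : C) k : x <> 0 -> p <> 0 ->
  Cmod (theta_term x p (Z.of_nat k)) = theta_bound (Cmod x) (Cmod p) k.
Proof.
intros Hx Hp. induction k.
- unfold theta_term, tri. simpl. rewrite Cmult_1_r. apply Cmod_1.
- replace (Z.of_nat (S k)) with (Z.of_nat k + 1)%Z by lia.
  rewrite theta_term_succ, Czpow_of_nat by auto. rewrite !Cmod_mult, Cmod_opp, Cmod_pow, IHk. simpl. ring.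
Qed.

Lemma Cdiv_neq_0 (x y : C) : x <> 0 -> y <> 0 -> (x / y)%C <> 0.
Proof.
intros Hx Hy E. apply Hx. replace x with (x / y * y)%C by (field; auto). rewrite E. ring.
Qed.

Lemma Zabs_theta_term (x p : C) : x <> 0 -> p <> 0 -> Cmod p < 1 -> Zabs (theta_term x p).
Proof.
intros Hx Hp Hp1. split. intros; apply Cmod_ge_0.
apply summable_add.
- apply summable_le with (2 := summable_theta_bound _ _ (Cmod_ge_0 x) (conj (Cmod_ge_0 p) Hp1)).
  intros k. rewrite Cmod_theta_term_nat by auto. split; [|lra].
  rewrite <- Cmod_theta_term_nat by auto. apply Cmod_ge_0.
- assert (Hpx : (p / x)%C <> 0) by now apply Cdiv_neq_0.
  destruct (summable_theta_bound (Cmod (p / x)) (Cmod p)) as [H0 [B HB]]; auto using Cmod_ge_0.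
  split; auto using Cmod_ge_0.
  eapply summable_le with (b := fun k => theta_bound (Cmod (p / x)) (Cmod p) (S k)).
  + intros k. replace (-1 - Z.of_nat k)%Z with (- Z.of_nat (S k))%Z by lia.
    rewrite theta_term_opp, Cmod_theta_term_nat by auto. split; [|lra]. apply H0.
  + split. intros; apply H0. exists B. intros n. eapply Rle_trans; [|apply (HB (S n))].
    clear HB. induction n.
    * simpl. lra.
    * change (Rsum (fun k => theta_bound (Cmod (p / x)) (Cmod p) (S k)) n + theta_bound (Cmod (p / x)) (Cmod p) (S n)
        <= Rsum (theta_bound (Cmod (p / x)) (Cmod p)) (S n) + theta_bound (Cmod (p / x)) (Cmod p) (S n)). lra.
Qed.

(** The reciprocal of the q-factorial, set to 0 at negative indices. With this convention the
    recurrence [inv_qfact_pred] holds for every integer, the factor [1 - p^0] producing the zero at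
    index -1, and Gaussian binomials vanish by themselves outside their range. *)
Definition inv_qfact (p : C) (k : Z) : C :=
  if (k <? 0)%Z then 0%C else (/ qpoch_part p p (Z.to_nat k))%C.

Lemma qpoch_part_neq_0 (p : C) k : Cmod p < 1 -> qpoch_part p p k <> 0.
Proof.
intros Hp. induction k; simpl. exact C1_nz. apply Cmult_neq_0; auto.
apply one_sub_neq_0. rewrite <- Cpow_S. apply Cmod_pow_lt_1; auto. lia.
Qed.

Lemma inv_qfact_pred (p : C) k : p <> 0 -> Cmod p < 1 ->
  inv_qfact p (k - 1) = ((1 - Czpow p k) * inv_qfact p k)%C.
Proof.
intros Hp Hp1. unfold inv_qfact.
destruct (Z.ltb_spec k 0); destruct (Z.ltb_spec (k - 1) 0); try lia; try ring.
- replace k with 0%Z by lia. simpl. ring.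
- rewrite <- (Z2Nat.id (k - 1)) by lia. set (m := Z.to_nat (k - 1)).
  replace k with (Z.of_nat (S m)) by lia. rewrite Czpow_of_nat, !Nat2Z.id.
  pose proof (qpoch_part_neq_0 p m Hp1). pose proof (qpoch_part_neq_0 p (S m) Hp1) as H2.
  simpl in H2 |- *. field. split; auto. intros E. apply H2. rewrite E. ring.
Qed.

(** The Gaussian binomial coefficient [2N; N+n], zero when [|n| > N]. *)
Definition gauss_binom (p : C) (N : nat) (n : Z) : C :=
  (qpoch_part p p (2 * N) * (inv_qfact p (Z.of_nat N - n) * inv_qfact p (Z.of_nat N + n)))%C.

(** Two applications of the q-Pascal rule. The three coefficients are those of [1], [x] and [/ x] in
    [(1 - x p^N) (1 - p^(N+1) / x)], up to the powers contributed by [theta_term]. *)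
Lemma gauss_binom_succ (p : C) N n : p <> 0 -> Cmod p < 1 ->
  gauss_binom p (S N) n =
   ((1 + p ^ (2 * N + 1)) * gauss_binom p N n
    + Czpow p (Z.of_nat N + 1 - n) * gauss_binom p N (n - 1)
    + Czpow p (Z.of_nat N + 1 + n) * gauss_binom p N (n + 1))%C.
Proof.
intros Hp Hp1. unfold gauss_binom.
replace (2 * S N)%nat with (S (S (2 * N))) by lia. cbn [qpoch_part].
replace (Z.of_nat (S N) - n)%Z with (Z.of_nat N + 1 - n)%Z by lia.
replace (Z.of_nat (S N) + n)%Z with (Z.of_nat N + 1 + n)%Z by lia.
set (k := (Z.of_nat N + 1 - n)%Z). set (l := (Z.of_nat N + 1 + n)%Z).
replace (Z.of_nat N - n)%Z with (k - 1)%Z by lia.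
replace (Z.of_nat N + n)%Z with (l - 1)%Z by lia.
replace (Z.of_nat N - (n - 1))%Z with k by lia.
replace (Z.of_nat N + (n - 1))%Z with (l - 1 - 1)%Z by lia.
replace (Z.of_nat N - (n + 1))%Z with (k - 1 - 1)%Z by lia.
replace (Z.of_nat N + (n + 1))%Z with l by lia.
(* Everything is now a multiple of [inv_qfact p k * inv_qfact p l]; since [(k - 1) + (l - 1) = 2N],
   the rest is a polynomial identity in [p] and two independent powers of [p]. *)
rewrite !inv_qfact_pred by auto.
assert (Hk : Czpow p k = (p * Czpow p (k - 1))%C).
{ rewrite <- Czpow_succ by auto. f_equal; lia. }
assert (Hl : Czpow p l = (p * Czpow p (l - 1))%C).
{ rewrite <- Czpow_succ by auto. f_equal; lia. }
assert (Hkl : (p ^ (2 * N) = Czpow p (k - 1) * Czpow p (l - 1))%C).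
{ rewrite <- Czpow_of_nat, <- Czpow_add by auto. f_equal. lia. }
rewrite Nat.add_1_r, !Cpow_S, Hkl, Hk, Hl. ring.
Qed.

Lemma gauss_binom_0 p n : gauss_binom p 0 n = if (n =? 0)%Z then 1%C else 0%C.
Proof.
unfold gauss_binom, inv_qfact.
destruct (Z.eqb_spec n 0) as [->|h]. simpl. field; exact C1_nz.
destruct (Z.ltb_spec (Z.of_nat 0 - n) 0); destruct (Z.ltb_spec (Z.of_nat 0 + n) 0); try lia; ring.
Qed.

Lemma Clim_inv_qpoch_part p : Cmod p < 1 -> Clim (fun n => / qpoch_part p p n)%C (/ qpoch p p)%C.
Proof.
intros Hp. apply Clim_inv; auto using qpoch_lim, qpoch_neq_0_lt, qpoch_part_neq_0.
Qed.

Lemma gauss_binom_bounded p : Cmod p < 1 -> exists M, 0 <= M /\ forall N n, Cmod (gauss_binom p N n) <= M.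
Proof.
intros Hp. destruct (Clim_bounded _ _ (qpoch_lim p p Hp)) as [M [HM0 HM]].
destruct (Clim_bounded _ _ (Clim_inv_qpoch_part p Hp)) as [M' [HM0' HM']].
assert (H : forall k, Cmod (inv_qfact p k) <= M').
{ intros k. unfold inv_qfact. destruct (k <? 0)%Z; auto. rewrite Cmod_0. lra. }
exists (M * (M' * M')). split. repeat apply Rmult_le_pos; lra.
intros N n. unfold gauss_binom. rewrite !Cmod_mult.
repeat apply Rmult_le_compat; auto using Cmod_ge_0, Rmult_le_pos.
Qed.

Lemma Clim_inv_qfact p (m : Z) (f : nat -> Z) : Cmod p < 1 -> (forall N, f N = (Z.of_nat N + m)%Z) ->
  Clim (fun N => inv_qfact p (f N)) (/ qpoch p p)%C.
Proof.
intros Hp Hf eps He. destruct (Clim_inv_qpoch_part p Hp eps He) as [K HK].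
exists (K + Z.to_nat (Z.abs m))%nat. intros n Hn. rewrite Hf. unfold inv_qfact.
destruct (Z.ltb_spec (Z.of_nat n + m) 0). lia. apply HK. lia.
Qed.

Lemma Clim_gauss_binom p n : Cmod p < 1 -> Clim (fun N => gauss_binom p N n) (/ qpoch p p)%C.
Proof.
intros Hp. pose proof (qpoch_neq_0_lt p p Hp Hp).
replace (/ qpoch p p)%C with (qpoch p p * (/ qpoch p p * / qpoch p p))%C by (field; auto).
apply Clim_mul. apply (Clim_subseq _ _ (fun N => 2 * N)%nat); auto using qpoch_lim. intros; lia.
apply Clim_mul. apply Clim_inv_qfact with (- n)%Z; auto. apply Clim_inv_qfact with n; auto.
Qed.

(** Passing from [N] to [N + 1] multiplies the product by [(1 - x p^N) (1 - p^(N+1) / x)]. On the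
    series side the terms with [x] and [/ x] shift the index by one in either direction, and
    [gauss_binom_succ] collects the coefficients. *)
Lemma finite_triple_product (x p : C) N : x <> 0 -> p <> 0 -> Cmod p < 1 ->
  Zser (fun n => gauss_binom p N n * theta_term x p n)%C (qpoch_part x p N * qpoch_part (p / x) p N)%C.
Proof.
intros Hx Hp Hp1. destruct (gauss_binom_bounded p Hp1) as [M [HM0 HM]].
assert (Habs : forall K, Zabs (fun n => gauss_binom p K n * theta_term x p n)%C).
{ intros K. eapply Zabs_le; [apply (Zsummable_scal M _ HM0 (Zabs_theta_term x p Hx Hp Hp1))|].
  intros n. rewrite Cmod_mult. apply Rmult_le_compat_r; auto using Cmod_ge_0. }
induction N.
- apply Zser_ext with (fun n => if (n =? 0)%Z then 1%C else 0%C).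
  { intros n. rewrite gauss_binom_0. destruct (Z.eqb_spec n 0) as [->|]; try ring.
    unfold theta_term, tri. simpl. ring. }
  apply Clim_ext_eventually with (N0 := 1%nat) (2 := Clim_const (1 * 1)%C).
  intros n Hn. induction Hn as [|n Hn IH]. simpl. ring.
  cbn [Csum]. rewrite <- IH.
  destruct (Z.eqb_spec (Z.of_nat n) 0); try lia. destruct (Z.eqb_spec (-1 - Z.of_nat n) 0); try lia. ring.
- pose proof (Zser_shift _ _ 1 (Habs N) IHN) as H1.
  pose proof (Zser_shift _ _ (-1) (Habs N) IHN) as H2.
  set (B := (qpoch_part x p N * qpoch_part (p / x) p N)%C) in *.
  replace (qpoch_part x p (S N) * qpoch_part (p / x) p (S N))%C with
    ((1 + p ^ (2 * N + 1)) * B + (- x * p ^ N) * B + (- (p ^ (N + 1) / x)) * B)%C.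
  2: { unfold B. cbn [qpoch_part]. rewrite !Nat.add_1_r, !Cpow_S.
       replace (2 * N)%nat with (N + N)%nat by lia. rewrite Cpow_add_r. field. auto. }
  eapply Zser_ext; [|apply (Zser_add _ _ _ _ (Zser_add _ _ _ _ (Zser_scal _ _ _ IHN)
     (Zser_scal _ _ _ H2)) (Zser_scal _ _ _ H1))].
  intros n. cbv beta. rewrite gauss_binom_succ by auto.
  rewrite (theta_term_succ x p n) by auto.
  pose proof (theta_term_succ x p (n - 1) Hx Hp) as E.
  replace (n - 1 + 1)%Z with n in E by lia. rewrite E.
  replace (n + -1)%Z with (n - 1)%Z by lia.
  replace (Z.of_nat N + 1 - n)%Z with (Z.of_nat N + (- (n - 1)))%Z by lia.
  replace (Z.of_nat N + 1 + n)%Z with (Z.of_nat N + (1 + (1 + (n - 1))))%Z by lia.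
  replace (Czpow p n) with (Czpow p (1 + (n - 1))) by (f_equal; lia).
  rewrite !(Czpow_add p _ _ Hp), Czpow_opp, Czpow_of_nat by auto.
  pose proof (Czpow_neq_0 p (n - 1) Hp). rewrite !Nat.add_1_r, !Cpow_S. change (Czpow p 1) with (p ^ 1)%C.
  generalize dependent (Czpow p (n - 1)). intros P _ HP. generalize (p ^ (2 * N))%C (p ^ N)%C (gauss_binom p N n)
    (gauss_binom p N (n-1)) (gauss_binom p N (n+1)) (theta_term x p (n - 1)). intros. simpl. field. auto.
Qed.

(** The limit of the finite version: for fixed [n] the Gaussian binomial tends to [/ qpoch p p], and
    a bound uniform in [N] and [n] makes the theta series itself the majorant. *)
Theorem triple_product (x p : C) : x <> 0 -> p <> 0 -> Cmod p < 1 -> Zser (theta_term x p) (theta x p).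
Proof.
intros Hx Hp Hp1. destruct (gauss_binom_bounded p Hp1) as [M [HM0 HM]].
pose proof (qpoch_neq_0_lt p p Hp1 Hp1) as Hq.
destruct (tannery (fun N i => gauss_binom p N (Z.of_nat i) * theta_term x p (Z.of_nat i) +
    gauss_binom p N (-1 - Z.of_nat i) * theta_term x p (-1 - Z.of_nat i))%C
   (fun i => / qpoch p p * theta_term x p (Z.of_nat i) + / qpoch p p * theta_term x p (-1 - Z.of_nat i))%C
   (fun i => M * Cmod (theta_term x p (Z.of_nat i)) + M * Cmod (theta_term x p (-1 - Z.of_nat i)))
   (fun N => qpoch_part x p N * qpoch_part (p / x) p N)%C) as [S [HS1 HS2]].
- apply (Zsummable_scal M _ HM0 (Zabs_theta_term x p Hx Hp Hp1)).
- intros k i. eapply Rle_trans; [apply Cmod_triangle|]. rewrite !Cmod_mult.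
  apply Rplus_le_compat; apply Rmult_le_compat_r; auto using Cmod_ge_0.
- intros i. apply Clim_add; apply Clim_mul; auto using Clim_const, Clim_gauss_binom.
- intros N. now apply finite_triple_product.
- assert (S = qpoch x p * qpoch (p / x) p)%C as ->.
  { eapply Clim_unique; [apply HS2|]. apply Clim_mul; auto using qpoch_lim. }
  unfold theta. rewrite Cmult_comm.
  eapply Cser_ext; [|apply (Cser_scal (qpoch p p) _ _ HS1)]. intros i. cbv beta. field. auto.
Qed.

Lemma theta_term_scal (a z p : C) n : a <> 0 -> z <> 0 ->
  theta_term (a * z) p n = (Czpow a n * theta_term z p n)%C.
Proof.
intros Ha Hz. unfold theta_term. replace (- (a * z))%C with (a * - z)%C by ring.
rewrite Czpow_mul_l by auto using Copp_neq_0. ring.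
Qed.

Lemma Czpow_inv_l (x : C) n : x <> 0 -> Czpow (/ x) n = (/ Czpow x n)%C.
Proof.
intros Hx. assert (/ x <> 0)%C.
{ intros E. apply C1_nz. rewrite <- (Cinv_l x), E by auto. ring. }
apply Z_ind_succ_pred with (n := n). simpl. field; exact C1_nz.
intros m. rewrite !Czpow_succ by auto. pose proof (Czpow_neq_0 x m Hx).
split; intros E. rewrite E. field. auto.
replace (Czpow (/ x) m) with (x * (/ x * Czpow (/ x) m))%C by (field; auto).
rewrite E. field. auto.
Qed.

(** The substitution [m = r + s], [k = r - s] diagonalizes the quadratic form: [tri (r + s) + tri (r
    - s) = 2 tri r + 2 tri s + s]. Doubling squares the base, and the surplus [s] puts a factor [p]
    into the second argument. *)
Lemma theta_term_mul_even (x y p : C) r s : x <> 0 -> y <> 0 -> p <> 0 ->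
  (theta_term x p (r + s) * theta_term y p (r - s) =
   theta_term (- (x * y)) (p ^ 2) r * theta_term (- (p * x / y)) (p ^ 2) s)%C.
Proof.
intros Hx Hy Hp. unfold theta_term.
replace (- - (x * y))%C with (- x * - y)%C by ring.
replace (- - (p * x / y))%C with (p * (- x * / - y))%C by (field; auto using Copp_neq_0).
assert (/ - y <> 0)%C.
{ intros E. apply C1_nz. rewrite <- (Cinv_l (- y)%C), E by auto using Copp_neq_0. ring. }
rewrite !Czpow_mul_l by auto using Copp_neq_0, Cmult_neq_0.
rewrite Czpow_inv_l by auto using Copp_neq_0.
replace (r - s)%Z with (r + (- s))%Z by lia.
rewrite !(Czpow_add (- x)), !(Czpow_add (- y)), (Czpow_opp (- y)) by auto using Copp_neq_0.
change (p ^ 2)%C with (Czpow p 2). rewrite <- !Czpow_mul_r, !tri_double by auto.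
assert (E : (Czpow p (tri (r + s)) * Czpow p (tri (r + - s)) =
  Czpow p (r * (r - 1)) * Czpow p s * Czpow p (s * (s - 1)))%C).
{ rewrite <- !Czpow_add by auto. f_equal.
  generalize (tri_double (r + s)) (tri_double (r + - s)). lia. }
pose proof (Czpow_neq_0 (- y) s (Copp_neq_0 y Hy)).
transitivity (Czpow (- x) r * Czpow (- x) s * Czpow (- y) r * / Czpow (- y) s *
  (Czpow p (tri (r + s)) * Czpow p (tri (r + - s))))%C. ring. rewrite E. ring.
Qed.

Lemma theta_term_mul_odd (x y p : C) r s : x <> 0 -> y <> 0 -> p <> 0 ->
  (theta_term x p (r + s + 1) * theta_term y p (r - s) =
   - x * theta_term (- (p * (x * y))) (p ^ 2) r * theta_term (- (p ^ 2 * x / y)) (p ^ 2) s)%C.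
Proof.
intros Hx Hy Hp. rewrite theta_term_succ by auto.
replace (- (p * (x * y)))%C with (p * - (x * y))%C by ring.
replace (- (p ^ 2 * x / y))%C with (p * - (p * x / y))%C by (simpl; field; auto).
rewrite !(theta_term_scal p) by auto using Copp_neq_0, Cmult_neq_0, Cdiv_neq_0.
rewrite Czpow_add by auto.
transitivity (- x * Czpow p r * Czpow p s * (theta_term x p (r + s) * theta_term y p (r - s)))%C. ring.
rewrite theta_term_mul_even by auto. ring.
Qed.

(** Multiply the two series and collect the terms whose indices have an even, resp. odd, sum. *)
Theorem theta_mul (x y p : C) : x <> 0 -> y <> 0 -> p <> 0 -> Cmod p < 1 ->
  (theta x p * theta y p =
   theta (- (x * y)) (p ^ 2) * theta (- (p * x / y)) (p ^ 2)
   - x * (theta (- (p * (x * y))) (p ^ 2) * theta (- (p ^ 2 * x / y)) (p ^ 2)))%C.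
Proof.
intros Hx Hy Hp Hp1.
assert (Hpp : (p ^ 2)%C <> 0) by now apply Cpow_nz.
assert (Hpp1 : Cmod (p ^ 2)%C < 1) by (apply Cmod_pow_lt_1; auto; lia).
set (E := theta (- (p * x / y)) (p ^ 2)). set (O := theta (- (p ^ 2 * x / y)) (p ^ 2)).
assert (nz1 : (- (x * y))%C <> 0) by auto using Copp_neq_0, Cmult_neq_0.
assert (nz2 : (- (p * x / y))%C <> 0) by auto using Copp_neq_0, Cmult_neq_0, Cdiv_neq_0.
assert (nz3 : (- (p * (x * y)))%C <> 0) by auto using Copp_neq_0, Cmult_neq_0.
assert (nz4 : (- (p ^ 2 * x / y))%C <> 0) by auto using Copp_neq_0, Cmult_neq_0, Cdiv_neq_0.
(* [c k] is the sum over [m] of term [m] of the first series times term [k - m] of the second. For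
   [k = 2r] or [k = 2r + 1] the factor depending on [r] comes out, and the remaining sum over
   [s = m - r], respectively [s = m - r - 1], is [E] or [O]. *)
set (c := fun k => if Z.even k then (E * theta_term (- (x * y)) (p ^ 2) (k / 2))%C
  else (- x * O * theta_term (- (p * (x * y))) (p ^ 2) (k / 2))%C).
assert (Hc0 : forall r, c (2 * r)%Z = (E * theta_term (- (x * y)) (p ^ 2) r)%C).
{ intros r. unfold c. rewrite Z.even_mul, (Z.mul_comm 2 r), Z.div_mul by lia. reflexivity. }
assert (Hc1 : forall r, c (2 * r + 1)%Z = (- x * O * theta_term (- (p * (x * y))) (p ^ 2) r)%C).
{ intros r. unfold c. rewrite (Z.add_comm (2 * r)), Z.even_add_mul_2. simpl Z.even. cbv iota.
  rewrite (Z.mul_comm 2), Z.div_add by lia. now replace (1 / 2 + r)%Z with r by (cbn; lia). }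
pose proof (triple_product x p Hx Hp Hp1) as Jx. pose proof (Zabs_theta_term x p Hx Hp Hp1) as Ax.
pose proof (triple_product y p Hy Hp Hp1) as Jy. pose proof (Zabs_theta_term y p Hy Hp Hp1) as Ay.
assert (Hs : Zser c (theta x p * theta y p)%C).
{ destruct Ay as [Ay0 [Ay1 [B HB]]].
  assert (HB0 : 0 <= B) by (exact (HB 0%nat)).
  apply (Zfubini (fun m k => theta_term x p m * theta_term y p (k - m))%C
    (fun m => B * Cmod (theta_term x p m)) (fun m => theta_term x p m * theta y p)%C).
  - now apply Zsummable_scal.
  - intros m n.
    rewrite (Rsum_ext _ (fun k => Cmod (theta_term x p m) *
     (Cmod (theta_term y p (Z.of_nat k + (- m))) + Cmod (theta_term y p (-1 - Z.of_nat k + (- m)))))).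
    2: { intros k _. rewrite !Cmod_mult. unfold Z.sub. ring. }
    rewrite Rsum_scal, Rmult_comm. apply Rmult_le_compat_r. apply Cmod_ge_0.
    apply (Zbound_shift _ _ (- m) HB).
  - intros m. apply Zser_scal.
    pose proof (Zser_shift _ _ (- m) (Zabs_Zbound _ _ HB) Jy) as H.
    apply Zser_ext with (2 := H). intros; f_equal; lia.
  - intros k. destruct (Z.Even_or_Odd k) as [[r ->]|[r ->]].
    + rewrite Hc0. pose proof (triple_product _ _ nz2 Hpp Hpp1) as J.
      pose proof (Zabs_theta_term _ _ nz2 Hpp Hpp1) as A.
      pose proof (Zser_shift _ _ (- r) (Zabs_scal (theta_term (- (x * y)) (p ^ 2) r) _ A)
        (Zser_scal (theta_term (- (x * y)) (p ^ 2) r) _ _ J)) as H.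
      rewrite Cmult_comm. apply Zser_ext with (2 := H). intros m.
      rewrite <- theta_term_mul_even by auto. f_equal; f_equal; lia.
    + rewrite Hc1. pose proof (triple_product _ _ nz4 Hpp Hpp1) as J.
      pose proof (Zabs_theta_term _ _ nz4 Hpp Hpp1) as A.
      set (z := (- x * theta_term (- (p * (x * y))) (p ^ 2) r)%C).
      pose proof (Zser_shift _ _ (- r - 1) (Zabs_scal z _ A) (Zser_scal z _ _ J)) as H.
      replace (- x * O * theta_term (- (p * (x * y))) (p ^ 2) r)%C with (z * O)%C by (unfold z; ring).
      apply Zser_ext with (2 := H). intros m. unfold z.
      rewrite <- theta_term_mul_odd by auto. f_equal; f_equal; lia.
  - apply Zser_ext with (fun m => theta y p * theta_term x p m)%C. intros; ring.
    rewrite Cmult_comm. now apply Zser_scal. }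
rewrite (Zser_parity c _ (E * theta (- (x * y)) (p ^ 2))%C (- x * O * theta (- (p * (x * y))) (p ^ 2))%C Hs).
- ring.
- apply Zser_ext with (1 := fun r => eq_sym (Hc0 r)). apply Zser_scal, triple_product; auto.
- apply Zser_ext with (1 := fun r => eq_sym (Hc1 r)). apply Zser_scal, triple_product; auto.
Qed.

(** * The identity *)

Lemma theta_inversion (x p : C) : x <> 0 -> p <> 0 -> theta (p / x) p = theta x p.
Proof. intros Hx Hp. unfold theta. replace (p / (p / x))%C with x by (field; auto). ring. Qed.

(** Each bracket factors: with [E], [O] as in the proof, [(u s)^2 - (v t)^2 = 2 q E O u s] and
    [(u t)^2 - (s v)^2 = 2 q E O v t]. *)
Lemma theta_quotient_relation (q : C) : q <> 0 -> Cmod q < 1 ->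
  let u := theta (- q) (q ^ 5) in let v := theta q (q ^ 5) in
  let s := theta (- q ^ 2) (q ^ 5) in let t := theta (q ^ 2) (q ^ 5) in
  ((u ^ 2 * s ^ 2 - v ^ 2 * t ^ 2) * (v * t) = (u ^ 2 * t ^ 2 - s ^ 2 * v ^ 2) * (u * s))%C.
Proof.
intros Hq Hq1 u v s t.
assert (Hp : (q ^ 5)%C <> 0) by now apply Cpow_nz.
assert (Hp1 : Cmod (q ^ 5)%C < 1) by (apply Cmod_pow_lt_1; auto; lia).
assert (Hq2 : (q ^ 2)%C <> 0) by now apply Cpow_nz.
assert (HP : ((q ^ 5) ^ 2)%C <> 0) by now apply Cpow_nz.
set (P := ((q ^ 5) ^ 2)%C) in *.
set (E := theta (- q ^ 5) P). set (O := theta (- P) P).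
set (a1 := theta (- q ^ 2) P). set (b1 := theta (- q ^ 7) P).
set (a2 := theta (- q ^ 4) P). set (b2 := theta (- q ^ 9) P).
(* Inversion [x -> P / x] with [P = q^10] folds the exponent 8 onto 2 and 3 onto 7, so that the six
   products below share the values [a1], [b1], [a2], [b2], [E], [O]. *)
assert (Ha1 : theta (- q ^ 8) P = a1).
{ unfold a1. rewrite <- (theta_inversion (- q ^ 2) P) by auto using Copp_neq_0.
  f_equal. unfold P. simpl. field. auto. }
assert (Hb1 : theta (- q ^ 3) P = b1).
{ unfold b1. rewrite <- (theta_inversion (- q ^ 3) P) by auto using Copp_neq_0, Cpow_nz.
  f_equal. unfold P. simpl. field. auto. }
assert (Hu : (u * u = a1 * E + q * (b1 * O))%C).
{ unfold u. rewrite theta_mul by auto using Copp_neq_0. fold P.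
  replace (- (- q * - q))%C with (- q ^ 2)%C by ring.
  replace (- (q ^ 5 * - q / - q))%C with (- q ^ 5)%C by (field; auto using Copp_neq_0).
  replace (- (q ^ 5 * (- q * - q)))%C with (- q ^ 7)%C by ring.
  replace (- (P * - q / - q))%C with (- P)%C by (field; auto using Copp_neq_0).
  fold a1 E b1 O. ring. }
assert (Hv : (v * v = a1 * E - q * (b1 * O))%C).
{ unfold v. rewrite theta_mul by auto. fold P.
  replace (- (q * q))%C with (- q ^ 2)%C by ring.
  replace (- (q ^ 5 * q / q))%C with (- q ^ 5)%C by (field; auto).
  replace (- (q ^ 5 * (q * q)))%C with (- q ^ 7)%C by ring.
  replace (- (P * q / q))%C with (- P)%C by (field; auto).
  reflexivity. }
assert (Hs : (s * s = a2 * E + q ^ 2 * (b2 * O))%C).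
{ unfold s. rewrite theta_mul by auto using Copp_neq_0. fold P.
  replace (- (- q ^ 2 * - q ^ 2))%C with (- q ^ 4)%C by ring.
  replace (- (q ^ 5 * - q ^ 2 / - q ^ 2))%C with (- q ^ 5)%C by (field; auto using Copp_neq_0).
  replace (- (q ^ 5 * (- q ^ 2 * - q ^ 2)))%C with (- q ^ 9)%C by ring.
  replace (- (P * - q ^ 2 / - q ^ 2))%C with (- P)%C by (field; auto using Copp_neq_0).
  fold a2 E b2 O. ring. }
assert (Ht : (t * t = a2 * E - q ^ 2 * (b2 * O))%C).
{ unfold t. rewrite theta_mul by auto. fold P.
  replace (- (q ^ 2 * q ^ 2))%C with (- q ^ 4)%C by ring.
  replace (- (q ^ 5 * q ^ 2 / q ^ 2))%C with (- q ^ 5)%C by (field; auto).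
  replace (- (q ^ 5 * (q ^ 2 * q ^ 2)))%C with (- q ^ 9)%C by ring.
  replace (- (P * q ^ 2 / q ^ 2))%C with (- P)%C by (field; auto).
  reflexivity. }
assert (Hvt : (v * t = b1 * a2 - q * (a1 * b2))%C).
{ unfold v, t. rewrite theta_mul by auto. fold P.
  replace (- (q * q ^ 2))%C with (- q ^ 3)%C by ring.
  replace (- (q ^ 5 * q / q ^ 2))%C with (- q ^ 4)%C by (simpl; field; auto).
  replace (- (q ^ 5 * (q * q ^ 2)))%C with (- q ^ 8)%C by ring.
  replace (- (P * q / q ^ 2))%C with (- q ^ 9)%C by (unfold P; simpl; field; auto).
  rewrite Ha1, Hb1. reflexivity. }
assert (Hus : (u * s = b1 * a2 + q * (a1 * b2))%C).
{ unfold u, s. rewrite theta_mul by auto using Copp_neq_0. fold P.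
  replace (- (- q * - q ^ 2))%C with (- q ^ 3)%C by ring.
  replace (- (q ^ 5 * - q / - q ^ 2))%C with (- q ^ 4)%C by (simpl; field; auto using Copp_neq_0).
  replace (- (q ^ 5 * (- q * - q ^ 2)))%C with (- q ^ 8)%C by ring.
  replace (- (P * - q / - q ^ 2))%C with (- q ^ 9)%C by (unfold P; simpl; field; auto using Copp_neq_0).
  rewrite Ha1, Hb1. fold a2 b2. ring. }
rewrite Hvt, Hus.
replace (u ^ 2)%C with (u * u)%C by ring. replace (v ^ 2)%C with (v * v)%C by ring.
replace (s ^ 2)%C with (s * s)%C by ring. replace (t ^ 2)%C with (t * t)%C by ring.
rewrite Hu, Hv, Hs, Ht. ring.
Qed.

(** * The complex exponential and the nome *)

Lemma Cexp_add z w : Cexp (z + w) = (Cexp z * Cexp w)%C.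
Proof.
unfold Cexp, Cmult. destruct z as [a b]. destruct w as [c d]. simpl.
rewrite exp_plus, cos_plus, sin_plus. f_equal; ring.
Qed.

Lemma Cexp_0 : Cexp 0 = 1%C.
Proof. unfold Cexp. simpl. rewrite exp_0, cos_0, sin_0. unfold RtoC. f_equal; ring. Qed.

Lemma Cmod_Cexp z : Cmod (Cexp z) = exp (Re z).
Proof.
unfold Cmod, Cexp. cbn [fst snd].
replace ((exp (Re z) * cos (Im z)) ^ 2 + (exp (Re z) * sin (Im z)) ^ 2)
  with (exp (Re z) * exp (Re z) * (Rsqr (sin (Im z)) + Rsqr (cos (Im z)))) by (unfold Rsqr; ring).
rewrite sin2_cos2, Rmult_1_r. apply sqrt_square. left; apply exp_pos.
Qed.

Lemma Cexp_neq_0 z : Cexp z <> 0.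
Proof. apply Cmod_gt_0. rewrite Cmod_Cexp. apply exp_pos. Qed.

Lemma Cexp_pow z n : Cexp (INR n * z) = (Cexp z ^ n)%C.
Proof.
induction n; simpl Cpow. rewrite Cmult_0_l. apply Cexp_0.
rewrite S_INR, RtoC_plus, <- IHn, <- Cexp_add. f_equal. ring.
Qed.

Lemma qq_neq_0 tau : qq tau <> 0.
Proof. apply Cexp_neq_0. Qed.

Lemma Cmod_qq tau : Cmod (qq tau) = exp (- (2 * PI * Im tau)).
Proof. unfold qq. rewrite Cmod_Cexp. f_equal. destruct tau. simpl. ring. Qed.

Lemma Cmod_qq_lt_1 tau : 0 < Im tau -> Cmod (qq tau) < 1.
Proof.
intros H. rewrite Cmod_qq, <- exp_0. apply exp_increasing.
assert (0 < 2 * PI * Im tau); [|lra]. apply Rmult_lt_0_compat; auto. generalize PI_RGT_0; lra.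
Qed.

Lemma qq_scal n tau : qq (INR n * tau) = (qq tau ^ n)%C.
Proof. unfold qq. rewrite <- Cexp_pow. f_equal. ring. Qed.

Lemma qpoch_double (q : C) : Cmod q < 1 -> qpoch (q ^ 2) (q ^ 2) = (qpoch q q * qpoch (- q) q)%C.
Proof. intros H. symmetry. now apply qpoch_mul_opp. Qed.

(** The exponents of [q] in the four eta functions cancel: [2*2 + 4*5 = 4*1 + 2*10]. *)
Lemma g_qpoch tau : 0 < Im tau -> let q := qq tau in
  g tau = ((qpoch (q ^ 2) (q ^ 2) ^ 2 * qpoch (q ^ 5) (q ^ 5) ^ 4) /
    (qpoch q q ^ 4 * qpoch (q ^ 10) (q ^ 10) ^ 2))%C.
Proof.
intros H q. pose proof (Cmod_qq_lt_1 tau H) as Hq. fold q in Hq.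
unfold g, eta. replace (RtoC 2) with (RtoC (INR 2)) by (f_equal; simpl; ring).
replace (RtoC 5) with (RtoC (INR 5)) by (f_equal; simpl; ring).
replace (RtoC 10) with (RtoC (INR 10)) by (f_equal; simpl; ring).
rewrite !qq_scal. fold q. set (w := Cexp (RtoC (2 * PI / 24) * (Ci * tau))%C).
assert (Hw : forall n, Cexp (RtoC (2 * PI / 24) * (Ci * (INR n * tau)))%C = (w ^ n)%C).
{ intros n. unfold w. rewrite <- Cexp_pow. f_equal. ring. }
rewrite !Hw. assert (Hw0 : w <> 0) by apply Cexp_neq_0.
assert (forall n, (0 < n)%nat -> qpoch (q ^ n) (q ^ n) <> 0) as Hn.
{ intros n Hn. apply qpoch_neq_0_lt; apply Cmod_pow_lt_1; auto. }
pose proof (Hn 10%nat ltac:(lia)) as H10.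
assert (H1 : qpoch q q <> 0) by now apply qpoch_neq_0_lt.
generalize dependent (qpoch (q ^ 10) (q ^ 10)). generalize dependent (qpoch q q).
generalize (qpoch (q ^ 2) (q ^ 2)) (qpoch (q ^ 5) (q ^ 5)). intros A B D D0 F F0.
field. auto.
Qed.

Lemma g1_g2_neq_0 tau : 0 < Im tau -> g1 tau <> 0 /\ g2 tau <> 0.
Proof.
intros H. pose proof (Cmod_qq_lt_1 tau H) as Hq. unfold g1, g2. set (q := qq tau) in *.
assert (H5 : Cmod (q ^ 5)%C < 1) by (apply Cmod_pow_lt_1; auto; lia).
split; apply Cdiv_neq_0; apply Cmult_neq_0; apply qpoch_neq_0_lt; rewrite ?Cmod_opp; auto;
  apply Cmod_pow_lt_1; auto; lia.
Qed.

(** Doubling gives [(q^2;q^2) = (q;q)(-q;q)], and likewise for base [q^5], so [g] is the square of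
    [(-q;q)(q^5;q^5) / ((q;q)(-q^5;q^5))]. After the dissection modulo 5 the residue class 0 cancels
    and the classes 1, 4 and 2, 3 remain. *)
Lemma g_eq_g1_g2 tau : 0 < Im tau -> g tau = ((g1 tau * g2 tau) ^ 2)%C.
Proof.
intros H. rewrite g_qpoch by auto. pose proof (Cmod_qq_lt_1 tau H) as Hq. unfold g1, g2.
set (q := qq tau) in *. cbv zeta.
assert (H5 : Cmod (q ^ 5)%C < 1) by (apply Cmod_pow_lt_1; auto; lia).
replace (q ^ 10)%C with ((q ^ 5) ^ 2)%C by ring.
rewrite !qpoch_double by auto.
pose proof (qpoch_dissect_5 q q Hq) as E1. pose proof (qpoch_dissect_5 (- q) q Hq) as E2.
replace (q * q)%C with (q ^ 2)%C in E1 by ring. replace (q * q ^ 2)%C with (q ^ 3)%C in E1 by ring.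
replace (q * q ^ 3)%C with (q ^ 4)%C in E1 by ring. replace (q * q ^ 4)%C with (q ^ 5)%C in E1 by ring.
replace (- q * q)%C with (- q ^ 2)%C in E2 by ring. replace (- q * q ^ 2)%C with (- q ^ 3)%C in E2 by ring.
replace (- q * q ^ 3)%C with (- q ^ 4)%C in E2 by ring. replace (- q * q ^ 4)%C with (- q ^ 5)%C in E2 by ring.
rewrite E1, E2. clear E1 E2.
assert (N : forall a, Cmod a < 1 -> qpoch a (q ^ 5) <> 0) by (intros; now apply qpoch_neq_0_lt).
assert (M : forall n, (0 < n)%nat -> Cmod (q ^ n)%C < 1) by (intros; now apply Cmod_pow_lt_1).
pose proof (N q Hq). pose proof (N (q^2)%C (M 2%nat ltac:(lia))). pose proof (N (q^3)%C (M 3%nat ltac:(lia))).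
pose proof (N (q^4)%C (M 4%nat ltac:(lia))). pose proof (N (q^5)%C H5).
assert (qpoch (- q ^ 5) (q ^ 5) <> 0) by (apply N; now rewrite Cmod_opp).
clear N M.
generalize dependent (qpoch q (q ^ 5)). generalize dependent (qpoch (q ^ 2) (q ^ 5)).
generalize dependent (qpoch (q ^ 3) (q ^ 5)). generalize dependent (qpoch (q ^ 4) (q ^ 5)).
generalize dependent (qpoch (q ^ 5) (q ^ 5)). generalize dependent (qpoch (- q ^ 5) (q ^ 5)).
intros. field. auto 10.
Qed.

Lemma g1_g2_relation tau : 0 < Im tau ->
  let a := g1 tau in let b := g2 tau in (a ^ 2 * b ^ 2 - 1 = a * b * (a ^ 2 - b ^ 2))%C.
Proof.
intros H a b. pose proof (Cmod_qq_lt_1 tau H) as Hq. pose proof (qq_neq_0 tau) as Hq0.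
unfold a, b, g1, g2. set (q := qq tau) in *. cbv zeta.
assert (H5 : Cmod (q ^ 5)%C < 1) by (apply Cmod_pow_lt_1; auto; lia).
pose proof (theta_quotient_relation q Hq0 Hq) as R. cbv zeta in R. unfold theta in R.
assert (Hq2 : (q ^ 2)%C <> 0) by now apply Cpow_nz.
replace (q ^ 5 / - q)%C with (- q ^ 4)%C in R by (field; auto using Copp_neq_0).
replace (q ^ 5 / q)%C with (q ^ 4)%C in R by (field; auto).
replace (q ^ 5 / - q ^ 2)%C with (- q ^ 3)%C in R by (field; auto using Copp_neq_0).
replace (q ^ 5 / q ^ 2)%C with (q ^ 3)%C in R by (field; auto).
assert (N : forall a, Cmod a < 1 -> qpoch a (q ^ 5) <> 0) by (intros; now apply qpoch_neq_0_lt).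
assert (M : forall n, (0 < n)%nat -> Cmod (q ^ n)%C < 1) by (intros; now apply Cmod_pow_lt_1).
pose proof (N q Hq). pose proof (N (q^2)%C (M 2%nat ltac:(lia))). pose proof (N (q^3)%C (M 3%nat ltac:(lia))).
pose proof (N (q^4)%C (M 4%nat ltac:(lia))). pose proof (N (q^5)%C H5).
assert (qpoch (- q) (q ^ 5) <> 0) by (apply N; now rewrite Cmod_opp).
assert (qpoch (- q ^ 2) (q ^ 5) <> 0) by (apply N; rewrite Cmod_opp; apply M; lia).
assert (qpoch (- q ^ 3) (q ^ 5) <> 0) by (apply N; rewrite Cmod_opp; apply M; lia).
assert (qpoch (- q ^ 4) (q ^ 5) <> 0) by (apply N; rewrite Cmod_opp; apply M; lia).
clear N M a b.
generalize dependent (qpoch q (q ^ 5)). generalize dependent (qpoch (q ^ 2) (q ^ 5)).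
generalize dependent (qpoch (q ^ 3) (q ^ 5)). generalize dependent (qpoch (q ^ 4) (q ^ 5)).
generalize dependent (qpoch (- q) (q ^ 5)). generalize dependent (qpoch (- q ^ 2) (q ^ 5)).
generalize dependent (qpoch (- q ^ 3) (q ^ 5)). generalize dependent (qpoch (- q ^ 4) (q ^ 5)).
generalize dependent (qpoch (q ^ 5) (q ^ 5)).
intros e He s2 Hs2 s1 Hs1 s0 Hs0 u Hu v2 Hv2 t2 Ht2 t Ht v R Hv.
set (U := (u * s2)%C) in *. set (V := (v * v2)%C) in *. set (S := (s0 * s1)%C) in *. set (T := (t * t2)%C) in *.
assert (nzU : U <> 0) by now apply Cmult_neq_0. assert (nzV : V <> 0) by now apply Cmult_neq_0.
assert (nzS : S <> 0) by now apply Cmult_neq_0. assert (nzT : T <> 0) by now apply Cmult_neq_0.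
(* Each theta value is a pair of q-Pochhammer symbols times the common factor [e], and the relation
   is homogeneous of degree six, so [e^6] cancels. *)
assert (R' : ((U ^ 2 * S ^ 2 - V ^ 2 * T ^ 2) * (V * T) = (U ^ 2 * T ^ 2 - S ^ 2 * V ^ 2) * (U * S))%C).
{ clearbody U V S T.
  replace ((U ^ 2 * S ^ 2 - V ^ 2 * T ^ 2) * (V * T))%C with (/ e ^ 6 * ((((U * e) ^ 2 * (S * e) ^ 2 -
   (V * e) ^ 2 * (T * e) ^ 2) * (V * e * (T * e)))))%C by (field; auto).
  rewrite R. field. auto. }
clearbody U V S T.
replace ((U / V) ^ 2 * (S / T) ^ 2 - 1)%C with (((U ^ 2 * S ^ 2 - V ^ 2 * T ^ 2) * (V * T)) / (V * T) ^ 3)%C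
  by (field; auto).
rewrite R'. field. auto.
Qed.

Theorem g1_g2_identity tau : 0 < Im tau ->
  (g1 tau ^ 4 + g2 tau ^ 4 = / g tau - 2 + 3 * g tau)%C.
Proof.
intros H. rewrite g_eq_g1_g2 by auto. destruct (g1_g2_neq_0 tau H) as [Ha Hb].
pose proof (g1_g2_relation tau H) as R. cbv zeta in R.
set (a := g1 tau) in *. set (b := g2 tau) in *.
assert (E : ((a * b) ^ 2 * (a ^ 4 + b ^ 4) = 1 - 2 * (a * b) ^ 2 + 3 * (a * b) ^ 4)%C).
(* From [a^4 + b^4 = (a^2 - b^2)^2 + 2 (a b)^2]; the coefficient 3 is 1 from the square of the
   relation plus this 2. *)
{ transitivity ((a * b * (a ^ 2 - b ^ 2)) ^ 2 + 2 * (a * b) ^ 4)%C. ring. rewrite <- R. ring. }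
replace (a ^ 4 + b ^ 4)%C with (/ ((a * b) ^ 2) * ((a * b) ^ 2 * (a ^ 4 + b ^ 4)))%C by (field; auto).
rewrite E. field. auto.
Qed.

(** * Partial fractions of the cotangent *)

Lemma exp_sub_1_sub_le x : Rabs x <= 1 / 2 -> Rabs (exp x - 1 - x) <= 2 * x ^ 2.
Proof.
intros Hx. apply Rabs_le_between in Hx.
generalize (exp_ineq1_le x) (exp_ineq1_le (- x)). intros H1 H2.
assert (H3 : exp x * exp (- x) = 1) by (rewrite <- exp_plus, Rplus_opp_r; apply exp_0).
pose proof (exp_pos x). rewrite Rabs_pos_eq by lra. nra.
Qed.

Lemma sin_sub_id_le y : Rabs y <= 1 / 2 -> Rabs (sin y - y) <= y ^ 2.
Proof.
assert (H : forall y, 0 <= y <= 1/2 -> Rabs (sin y - y) <= y ^ 2).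
{ intros z Hz. destruct (pre_sin_bound z 0) as [H1 _]; try lra.
  unfold sin_approx, sin_term in H1. simpl in H1.
  assert (sin z <= z). { destruct (Req_dec z 0) as [->|]. rewrite sin_0; lra. left; apply sin_lt_x; lra. }
  rewrite Rabs_left1 by lra. nra. }
intros Hy. apply Rabs_le_between in Hy. destruct (Rle_dec 0 y). apply H; lra.
specialize (H (- y)). rewrite sin_neg in H. replace (- sin y - - y) with (- (sin y - y)) in H by ring.
rewrite Rabs_Ropp in H. replace (y ^ 2) with ((- y) ^ 2) by ring. apply H. lra.
Qed.

Lemma Rabs_sin_le y : Rabs (sin y) <= Rabs y.
Proof.
assert (H : forall y, 0 <= y -> Rabs (sin y) <= y).
{ intros z Hz. destruct (Rle_dec z 1).
  - assert (0 <= sin z) by (apply sin_ge_0; generalize PI2_1; lra).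
    rewrite Rabs_pos_eq by auto.
    destruct (Req_dec z 0) as [->|]. rewrite sin_0; lra. left; apply sin_lt_x; lra.
  - apply Rle_trans with 1; [|lra]. apply Rabs_le, SIN_bound. }
destruct (Rle_dec 0 y). rewrite (Rabs_pos_eq y) by auto. auto.
rewrite <- Rabs_Ropp, <- sin_neg, (Rabs_left y) by lra. apply H. lra.
Qed.

Lemma one_sub_cos_le y : Rabs (cos y - 1) <= y ^ 2 / 2.
Proof.
replace (cos y) with (cos (2 * (y / 2))) by (f_equal; lra). rewrite cos_2a_sin.
replace (1 - 2 * sin (y / 2) * sin (y / 2) - 1) with (- (2 * (sin (y/2)) ^ 2)) by ring.
rewrite Rabs_Ropp, Rabs_mult, <- RPow_abs, (Rabs_pos_eq 2) by lra.
generalize (Rabs_sin_le (y / 2)) (Rabs_pos (sin (y/2))). intros H1 H2.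
assert (Rabs (sin (y/2)) ^ 2 <= Rabs (y / 2) ^ 2) by (apply pow_incr; lra).
rewrite !pow2_abs in *. replace ((y / 2) ^ 2) with (y ^ 2 / 4) in H by field. lra.
Qed.

Lemma Cexp_taylor_small (z : C) : Cmod z <= 1 / 2 -> Cmod (Cexp z - 1 - z) <= 3 * Cmod z ^ 2.
Proof.
intros Hz. pose proof (Rabs_Re_le z) as Hx. pose proof (Rabs_Im_le z) as Hy.
assert (E : Cmod z ^ 2 = Re z ^ 2 + Im z ^ 2) by apply Cmod2_alt.
rewrite E. clear E. set (x := Re z) in *. set (y := Im z) in *.
eapply Rle_trans; [apply Cmod_le_Re_Im|].
replace (Re (Cexp z - 1 - z)) with ((exp x - 1 - x) + exp x * (cos y - 1)).
2: { unfold Cexp. simpl. fold x y. unfold x, Re. ring. }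
replace (Im (Cexp z - 1 - z)) with ((exp x - 1) * sin y + (sin y - y)).
2: { unfold Cexp. simpl. fold x y. unfold y, Im. ring. }
assert (H1 := exp_sub_1_sub_le x ltac:(lra)). assert (H2 := sin_sub_id_le y ltac:(lra)).
assert (H3 := Rabs_sin_le y). assert (H4 := one_sub_cos_le y).
assert (Hx2 : Rabs x ^ 2 = x ^ 2) by apply pow2_abs. assert (Hy2 : Rabs y ^ 2 = y ^ 2) by apply pow2_abs.
pose proof (Rabs_pos x). pose proof (Rabs_pos y).
assert (He : Rabs (exp x - 1) <= 2 * Rabs x).
{ replace (exp x - 1) with ((exp x - 1 - x) + x) by ring. eapply Rle_trans; [apply Rabs_triang|].
  rewrite <- Hx2 in H1. nra. }
assert (He2 : exp x <= 2).
{ generalize (Rle_abs (exp x - 1)). lra. }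
assert (A1 : Rabs (exp x - 1 - x + exp x * (cos y - 1)) <= 2 * x ^ 2 + y ^ 2).
{ eapply Rle_trans; [apply Rabs_triang|]. rewrite Rabs_mult, (Rabs_pos_eq (exp x)) by (left; apply exp_pos).
  generalize (Rabs_pos (cos y - 1)). nra. }
assert (A2 : Rabs ((exp x - 1) * sin y + (sin y - y)) <= 2 * (Rabs x * Rabs y) + y ^ 2).
{ eapply Rle_trans; [apply Rabs_triang|]. rewrite Rabs_mult.
  generalize (Rabs_pos (sin y)) (Rabs_pos (exp x - 1)). intros.
  assert (Rabs (exp x - 1) * Rabs (sin y) <= 2 * Rabs x * Rabs y) by (apply Rmult_le_compat; auto). lra. }
generalize (pow2_ge_0 (Rabs x - Rabs y)). intros. lra.
Qed.

Lemma Cmod_Cexp_le (z : C) : Cmod (Cexp z) <= exp (Cmod z).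
Proof.
rewrite Cmod_Cexp. apply exp_le_exp.
eapply Rle_trans; [apply Rle_abs|apply Rabs_Re_le].
Qed.

(** No restriction on the size of [z]: in the derivative of the eta product the exponent is the
    increment multiplied by every positive integer. *)
Lemma Cexp_taylor (z : C) : Cmod (Cexp z - 1 - z) <= 12 * Cmod z ^ 2 * exp (Cmod z).
Proof.
pose proof (Cmod_ge_0 z) as H0. pose proof (exp_ineq1_le (Cmod z)) as H1.
destruct (Rle_dec (Cmod z) (1/2)) as [h|h].
- eapply Rle_trans; [now apply Cexp_taylor_small|]. generalize (pow2_ge_0 (Cmod z)). nra.
- eapply Rle_trans; [apply Cmod_triangle_minus|].
  generalize (Cmod_triangle_minus (Cexp z) 1) (Cmod_Cexp_le z). rewrite Cmod_1. intros.
  assert (1 / 4 <= Cmod z ^ 2) by nra.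
  assert (1 / 4 * exp (Cmod z) <= Cmod z ^ 2 * exp (Cmod z)) by (apply Rmult_le_compat_r; lra). lra.
Qed.

(** The cubic lower bound [a - a^3 / 6], whose factor [1 - a^2 / 6] equals [1 / 25] at the endpoint
    [12 / 5 = 4 * (3 / 5)]. With [PI <= 4] this covers [PI * x] for [x <= 3 / 5]. *)
Lemma sin_ge a : 0 <= a <= 12 / 5 -> a / 25 <= sin a.
Proof.
intros H. destruct (pre_sin_bound a 0) as [H1 _]; try lra.
unfold sin_approx, sin_term in H1. simpl in H1. nra.
Qed.

Lemma exp_sub_1_ge t : -8 <= t <= 8 -> Rabs t / 10 <= Rabs (exp t - 1).
Proof.
intros Ht. destruct (Rle_dec 0 t) as [h|h].
- generalize (exp_ineq1_le t). intros. rewrite !Rabs_pos_eq by lra. lra.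
- assert (H3 : exp t * exp (- t) = 1) by (rewrite <- exp_plus, Rplus_opp_r; apply exp_0).
  generalize (exp_ineq1_le (- t)) (exp_pos t). intros.
  assert (exp t < 1) by (rewrite <- exp_0; apply exp_increasing; lra).
  rewrite !Rabs_left by lra. nra.
Qed.

(** The numerical constants only matter for being positive. *)
Lemma qq_sub_1_ge (h : C) : Rabs (Re h) <= 3 / 5 -> Rabs (Im h) <= 1 -> Cmod h / 100000 <= Cmod (qq h - 1).
Proof.
intros Hx Hy. set (x := Re h) in *. set (y := Im h) in *.
assert (HPI : 2 < PI <= 4) by (split; [generalize PI2_1; lra|apply PI_4]).
set (t := - (2 * PI * y)).
(* A radial and an angular part, both nonnegative: the first controls [y], the second controls
   [x]. *)
assert (E : Cmod (qq h - 1) ^ 2 = (exp t - 1) ^ 2 + 4 * exp t * sin (PI * x) ^ 2).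
{ rewrite Cmod2_alt. unfold qq, Cexp.
  assert (ER : Re (RtoC (2 * PI) * (Ci * h)) = t).
  { unfold t, y. destruct h. simpl. ring. }
  assert (EI : Im (RtoC (2 * PI) * (Ci * h)) = 2 * (PI * x)).
  { unfold x. destruct h. simpl. ring. }
  rewrite ER, EI. simpl. rewrite sin_2a, cos_2a. set (s := sin (PI * x)). set (c := cos (PI * x)).
  assert (E1 : c * c = 1 - s * s). { generalize (sin2_cos2 (PI * x)). unfold Rsqr. fold s c. lra. }
  transitivity (exp t * exp t * ((c * c + s * s) ^ 2) - 2 * exp t * (c * c - s * s) + 1). ring.
  rewrite E1. ring. }
assert (Ht : -8 <= t <= 8). { unfold t. apply Rabs_le_between in Hy. nra. }
assert (Hs : Rabs x / 25 <= Rabs (sin (PI * x))).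
{ assert (H : forall a, 0 <= a <= 3/5 -> a / 25 <= Rabs (sin (PI * a))).
  { intros a Ha. eapply Rle_trans; [|apply Rle_abs]. eapply Rle_trans; [|apply sin_ge; nra]. nra. }
  destruct (Rle_dec 0 x) as [p|p].
  - rewrite Rabs_pos_eq in * by auto. apply H. lra.
  - rewrite (Rabs_left x) in * by lra. rewrite <- Rabs_Ropp, <- sin_neg.
    replace (- (PI * x)) with (PI * - x) by ring. apply H. lra. }
(* [6561 = 3^8] bounds [exp 8], and [t >= -8] because [PI <= 4] and [Rabs y <= 1]. *)
assert (Hexp : / 6561 <= exp t).
{ assert (H3 : exp t * exp (- t) = 1) by (rewrite <- exp_plus, Rplus_opp_r; apply exp_0).
  assert (exp (- t) <= 6561).
  { apply Rle_trans with (exp 8). apply exp_le_exp. lra.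
    assert (H8 : forall n, exp (INR n) <= 3 ^ n).
    { induction n. simpl. rewrite exp_0; lra. rewrite S_INR, exp_plus. simpl. rewrite Rmult_comm.
      apply Rmult_le_compat; auto using exp_le_3; left; apply exp_pos. }
    generalize (H8 8%nat). simpl. replace (1 + 1 + 1 + 1 + 1 + 1 + 1 + 1) with 8 by ring. lra. }
  generalize (exp_pos (- t)) (exp_pos t). intros. apply Rmult_le_reg_r with (exp (- t)); auto. nra. }
pose proof (Cmod_ge_0 (qq h - 1)) as HD. set (D := Cmod (qq h - 1)) in *.
generalize (exp_sub_1_ge t Ht). intros Het.
assert (HDy : Rabs y / 10 <= D).
{ apply Rle_trans with (Rabs (exp t - 1)).
  - eapply Rle_trans; [|apply Het]. unfold t. rewrite Rabs_Ropp, !Rabs_mult, (Rabs_pos_eq 2), (Rabs_pos_eq PI) by lra.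
    generalize (Rabs_pos y). nra.
  - apply Rsqr_incr_0_var; auto. unfold Rsqr.
    replace (Rabs (exp t - 1) * Rabs (exp t - 1)) with ((exp t - 1) ^ 2) by (rewrite <- pow2_abs; ring).
    generalize (exp_pos t) (pow2_ge_0 (sin (PI * x))). nra. }
assert (HDx : Rabs x / 2500 <= D).
{ apply Rsqr_incr_0_var; auto. unfold Rsqr.
  assert (Rabs x / 25 * (Rabs x / 25) <= sin (PI * x) ^ 2).
  { rewrite <- (pow2_abs (sin _)). simpl. rewrite Rmult_1_r.
    apply Rmult_le_compat; auto; generalize (Rabs_pos x); lra. }
  generalize (exp_pos t) (pow2_ge_0 (exp t - 1)) (Rabs_pos x). nra. }
generalize (Cmod_le_Re_Im h) (Rabs_pos x) (Rabs_pos y). fold x y. lra.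
Qed.

(** [cotpi z] is [pi * cot (pi * z)]. *)
Definition cotpi (z : C) : C := (PI * Ci * (qq z + 1) / (qq z - 1))%C.

Lemma qq_add z w : qq (z + w) = (qq z * qq w)%C.
Proof. unfold qq. rewrite <- Cexp_add. f_equal. ring. Qed.

Lemma qq_1 : qq 1 = 1%C.
Proof.
unfold qq, Cexp. simpl.
replace (2 * PI * (0 * 1 - 1 * 0) - 0 * (0 * 0 + 1 * 1)) with 0 by ring.
replace (2 * PI * (0 * 0 + 1 * 1) + 0 * (0 * 1 - 1 * 0)) with (2 * PI) by ring.
rewrite exp_0, cos_2PI, sin_2PI. unfold RtoC. f_equal; ring.
Qed.

Lemma qq_half : qq (RtoC (1 / 2)) = (- (1))%C.
Proof.
unfold qq, Cexp. simpl.
replace (2 * PI * (0 * (1 / 2) - 1 * 0) - 0 * (0 * 0 + 1 * (1 / 2))) with 0 by field.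
replace (2 * PI * (0 * 0 + 1 * (1 / 2)) + 0 * (0 * (1 / 2) - 1 * 0)) with PI by field.
rewrite exp_0, cos_PI, sin_PI. unfold RtoC, Copp. simpl. f_equal; ring.
Qed.

Lemma qq_INR n : qq (INR n) = 1%C.
Proof.
replace (RtoC (INR n)) with (INR n * 1)%C by ring. rewrite qq_scal, qq_1. apply Cpow_1_l.
Qed.

Lemma qq_0 : qq 0 = 1%C.
Proof. exact (qq_INR 0). Qed.

Lemma qq_opp z : qq (- z) = (/ qq z)%C.
Proof.
assert (E : (qq (- z) * qq z = 1)%C) by (rewrite <- qq_add, Cplus_comm, Cplus_opp_r; apply qq_0).
replace (qq (- z)) with (qq (- z) * qq z * / qq z)%C by (field; apply qq_neq_0). rewrite E. ring.
Qed.

Lemma Cminus_neq_0 (x y : C) : x <> y -> (x - y)%C <> 0.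
Proof. intros H E. apply H. replace x with (x - y + y)%C by ring. rewrite E. ring. Qed.

Lemma RtoC_neq_0 (x : R) : x <> 0 -> RtoC x <> 0.
Proof. intros H E. apply H. now apply RtoC_inj. Qed.

Lemma Cinv_0 : Cinv 0 = 0%C.
Proof. unfold Cinv. simpl. unfold RtoC. f_equal; unfold Rdiv; ring. Qed.

Lemma Cinv_mul (x y : C) : (/ (x * y) = / x * / y)%C.
Proof.
destruct (Ceq_dec x 0) as [->|Hx]. rewrite Cmult_0_l, Cinv_0. ring.
destruct (Ceq_dec y 0) as [->|Hy]. rewrite Cmult_0_r, Cinv_0. ring.
field. auto.
Qed.

Lemma C2_neq_0 : RtoC 2 <> 0.
Proof. apply RtoC_neq_0. lra. Qed.

Lemma cotpi_double z : qq z <> 1 -> cotpi z = (/ 2 * (cotpi (z / 2) + cotpi ((z + 1) / 2)))%C.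
Proof.
intros Hz. unfold cotpi. set (w := qq (z / 2)).
assert (E1 : qq z = (w * w)%C). { unfold w. rewrite <- qq_add. f_equal. field. }
assert (E2 : qq ((z + 1) / 2) = (- w)%C).
{ replace ((z + 1) / 2)%C with (z / 2 + RtoC (1 / 2))%C. rewrite qq_add, qq_half. fold w. ring.
  unfold Rdiv. rewrite RtoC_mult, RtoC_inv by lra. field. }
rewrite E2, E1 in *.
assert (w - 1 <> 0)%C. { apply Cminus_neq_0. intros ->. apply Hz. ring. }
assert (- w - 1 <> 0)%C. { apply Cminus_neq_0. intros E. apply Hz. replace (w * w)%C with (- w * - w)%C by ring. rewrite E. ring. }
assert (w * w - 1 <> 0)%C by now apply Cminus_neq_0.
field. repeat split; auto using C2_neq_0.
Qed.

Lemma INR_neq_0_C n : (0 < n)%nat -> RtoC (INR n) <> 0.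
Proof. intros H. apply RtoC_neq_0. apply not_0_INR. lia. Qed.

Lemma two_pow_pos k : (0 < 2 ^ k)%nat.
Proof. induction k; simpl; lia. Qed.

(** The duplication formula iterated [k] times. As [k] grows, the term with fixed index [j] tends to
    [/ (z + j)], so this is a finite form of the partial fraction expansion. *)
Lemma cotpi_sum z k : qq z <> 1 ->
  cotpi z = (/ INR (2 ^ k) * Csum (fun j => cotpi ((z + INR j) / INR (2 ^ k))) (2 ^ k))%C.
Proof.
intros Hz. induction k.
- simpl. unfold Cdiv. replace (/ 1)%C with (RtoC 1) by field. rewrite !Cmult_1_l, Cplus_0_l, Cmult_1_r, Cplus_0_r.
  reflexivity.
- rewrite IHk. set (N := (2 ^ k)%nat). pose proof (INR_neq_0_C N (two_pow_pos k)) as HN.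
  replace (2 ^ S k)%nat with (N + N)%nat by (unfold N; simpl; lia).
  rewrite Csum_split, <- Csum_add.
  replace (/ INR (N + N))%C with (/ INR N * / 2)%C.
  2: { rewrite plus_INR, RtoC_plus. replace (INR N + INR N)%C with (2 * INR N)%C by ring.
       field. auto using C2_neq_0. }
  rewrite <- Cmult_assoc. f_equal. rewrite <- Csum_scal. apply Csum_ext. intros j _.
  rewrite cotpi_double.
  + rewrite !plus_INR, !RtoC_plus. replace (INR N + INR N)%C with (2 * INR N)%C by ring.
    f_equal. f_equal; f_equal; field; auto using C2_neq_0.
  + intros E. apply Hz. 
    replace (qq z) with (qq (z + INR j)) by (rewrite qq_add, qq_INR; ring).
    replace (z + INR j)%C with (INR N * ((z + INR j) / INR N))%C by (field; auto).
    rewrite qq_scal, E. apply Cpow_1_l.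
Qed.

Lemma cotpi_sub_1 z : cotpi (z - 1) = cotpi z.
Proof.
unfold cotpi. replace (qq (z - 1)) with (qq z); auto.
transitivity (qq (z - 1 + 1)). f_equal; ring. rewrite qq_add, qq_1. ring.
Qed.

Lemma Csum_symmetrize F m : Csum F (2 * S m) =
  (F O + F (S m) + Csum (fun i => F (S i) + F (2 * S m - S i)%nat) m)%C.
Proof.
replace (2 * S m)%nat with (S m + S m)%nat by lia.
rewrite Csum_split, Csum_shift, (Csum_shift (fun k => F (S m + k)%nat)), Nat.add_0_r.
rewrite Csum_add, (Csum_rev (fun k => F (S m + S k)%nat)).
rewrite (Csum_ext (fun k => F (S m + S (m - 1 - k))%nat) (fun i => F (S m + S m - S i)%nat)).
ring. intros i Hi. f_equal. lia.
Qed.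

(** By periodicity the index [N - i] acts as [-i], which pairs the terms around 0. Two indices stay
    alone: 0, whose limit is [/ z], and [N / 2], whose limit is 0. *)
Lemma cotpi_symmetric_sum z m k : qq z <> 1 -> (2 ^ k = 2 * S m)%nat ->
  let N := INR (2 ^ k) in
  cotpi z = (/ N * cotpi (z / N) + / N * cotpi (z / N + RtoC (1 / 2)) +
    Csum (fun i => / N * (cotpi ((z + INR (S i)) / N) + cotpi ((z - INR (S i)) / N))) m)%C.
Proof.
intros Hz Hm N. assert (HN : RtoC N <> 0) by (apply INR_neq_0_C, two_pow_pos).
rewrite (cotpi_sum z k Hz). fold N. rewrite Hm, Csum_symmetrize, Csum_scal.
assert (E : N = 2 * INR (S m)) by (unfold N; rewrite Hm, mult_INR; reflexivity).
rewrite !Cmult_plus_distr_l. f_equal; [f_equal|]; f_equal.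
- f_equal. f_equal. change (INR 0) with 0. ring.
- f_equal. unfold Cdiv. rewrite Cmult_plus_distr_r. f_equal. rewrite <- RtoC_inv, <- RtoC_mult.
  2: intros E0; apply HN; now rewrite E0.
  f_equal. rewrite E. field. apply not_0_INR. lia.
- apply Csum_ext. intros i Hi. f_equal. rewrite minus_INR by lia. rewrite mult_INR.
  replace (INR 2 * INR (S m)) with N by (rewrite E; reflexivity).
  rewrite <- (cotpi_sub_1 ((z + _) / _)). f_equal. rewrite RtoC_minus. field. auto.
Qed.

Lemma Clim_div_nat (w : C) (N : nat -> nat) : (forall k, (k < N k)%nat) -> Clim (fun k => w / INR (N k))%C 0.
Proof.
intros HN eps He. pose proof (Cmod_ge_0 w) as Hw. 
destruct (archimed (Cmod w / eps)) as [H1 _]. set (A := up _) in *.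
exists (Z.to_nat A). intros n Hn. specialize (HN n).
assert (Hp : 0 < INR (N n)) by (apply lt_0_INR; lia).
replace (w / INR (N n) - 0)%C with (w / INR (N n))%C by ring.
rewrite Cmod_div by (apply INR_neq_0_C; lia). rewrite Cmod_R, Rabs_pos_eq by lra.
apply Rlt_div_l; auto. apply Rmult_lt_reg_r with (/ eps). now apply Rinv_0_lt_compat.
replace (eps * INR (N n) * / eps) with (INR (N n)) by (field; lra).
apply Rlt_le_trans with (IZR A); [exact H1|].
apply Rle_trans with (INR (Z.to_nat A)).
- destruct (Z_le_gt_dec 0 A). rewrite INR_IZR_INZ, Z2Nat.id by auto. lra.
  apply Rle_trans with 0. apply IZR_le; lia. apply pos_INR.
- apply le_INR. lia.
Qed.

Lemma qq_taylor (h : C) : Cmod h <= 1 / 16 -> Cmod (qq h - 1 - 2 * PI * Ci * h) <= 200 * Cmod h ^ 2.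
Proof.
intros Hh. unfold qq. set (z := (RtoC (2 * PI) * (Ci * h))%C).
replace (2 * PI * Ci * h)%C with z by (unfold z; rewrite RtoC_mult; ring).
assert (Hz : Cmod z <= 8 * Cmod h).
{ unfold z. rewrite !Cmod_mult, Cmod_Ci, Cmod_R, Rabs_pos_eq by (generalize PI_RGT_0; lra).
  generalize PI_4 (Cmod_ge_0 h). nra. }
eapply Rle_trans; [apply Cexp_taylor_small; lra|].
generalize (Cmod_ge_0 z). nra.
Qed.

Lemma qq_sub_1_le (h : C) : Cmod h <= 1 / 16 -> Cmod (qq h - 1) <= 24 * Cmod h.
Proof.
intros Hh. replace (qq h - 1)%C with ((qq h - 1 - 2 * PI * Ci * h) + 2 * PI * Ci * h)%C by ring.
eapply Rle_trans; [apply Cmod_triangle|].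
assert (Cmod (2 * PI * Ci * h) <= 8 * Cmod h).
{ rewrite !Cmod_mult, Cmod_Ci, !Cmod_R, (Rabs_pos_eq PI) by (generalize PI_RGT_0; lra).
  rewrite Rabs_pos_eq by lra. generalize PI_4 (Cmod_ge_0 h). nra. }
generalize (qq_taylor h Hh) (Cmod_ge_0 h). nra.
Qed.

Lemma Clim_qq_0 (h : nat -> C) : Clim h 0 -> Clim (fun k => qq (h k)) 1.
Proof.
intros H eps He. destruct (H (Rmin (1 / 16) (eps / 24))) as [K HK].
{ apply Rmin_glb_lt; lra. }
exists K. intros n Hn. specialize (HK n Hn). replace (h n - 0)%C with (h n) in HK by ring.
generalize (Rmin_l (1/16) (eps / 24)) (Rmin_r (1/16) (eps / 24)). intros.
generalize (qq_sub_1_le (h n)). lra.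
Qed.

Lemma Ci_neq_0 : Ci <> 0.
Proof. apply Cmod_gt_0. rewrite Cmod_Ci. lra. Qed.

Lemma CPI_neq_0 : RtoC PI <> 0.
Proof. apply RtoC_neq_0, PI_neq0. Qed.

Lemma Clim_qq_sub_1_mul (w : C) (N : nat -> nat) : w <> 0 -> (forall k, (k < N k)%nat) ->
  Clim (fun k => INR (N k) * (qq (w / INR (N k)) - 1))%C (2 * PI * Ci * w)%C.
Proof.
intros Hw HN. pose proof (Clim_div_nat w N HN) as Hh. set (h := fun k => (w / INR (N k))%C) in *.
assert (H3 : Clim (fun k => INR (N k) * (qq (h k) - 1 - 2 * PI * Ci * h k))%C 0).
{ apply Clim_ext with (fun k => w * ((qq (h k) - 1 - 2 * PI * Ci * h k) / h k))%C.
  { intros k. assert (RtoC (INR (N k)) <> 0) by (apply INR_neq_0_C; specialize (HN k); lia).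
    unfold h. field. auto. }
  replace (RtoC 0) with (w * 0)%C by ring. apply Clim_scal.
  intros eps He. destruct (Hh (Rmin (1 / 16) (eps / 200))) as [K HK]. { apply Rmin_glb_lt; lra. }
  exists K. intros n Hn. specialize (HK n Hn). replace (h n - 0)%C with (h n) in HK by ring.
  generalize (Rmin_l (1/16) (eps / 200)) (Rmin_r (1/16) (eps / 200)). intros.
  assert (Hhn : h n <> 0). { apply Cdiv_neq_0; auto. apply INR_neq_0_C. specialize (HN n). lia. }
  replace ((qq (h n) - 1 - 2 * PI * Ci * h n) / h n - 0)%C with ((qq (h n) - 1 - 2 * PI * Ci * h n) / h n)%C by ring.
  rewrite Cmod_div by auto. apply Cmod_gt_0 in Hhn. apply Rlt_div_l; auto.
  eapply Rle_lt_trans; [apply qq_taylor; lra|]. nra. }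
replace (2 * PI * Ci * w)%C with (0 + 2 * PI * Ci * w)%C by ring.
eapply Clim_ext; [|apply (Clim_add _ _ _ _ H3 (Clim_const (2 * PI * Ci * w)%C))].
intros k. assert (RtoC (INR (N k)) <> 0) by (apply INR_neq_0_C; specialize (HN k); lia).
unfold h. cbv beta. field. auto.
Qed.

Lemma Clim_cotpi_div (w : C) (N : nat -> nat) : w <> 0 -> (forall k, (k < N k)%nat) ->
  Clim (fun k => / INR (N k) * cotpi (w / INR (N k)))%C (/ w)%C.
Proof.
intros Hw HN. pose proof (Clim_div_nat w N HN) as Hh. pose proof CPI_neq_0. pose proof Ci_neq_0.
replace (/ w)%C with (PI * Ci * (1 + 1) * / (2 * PI * Ci * w))%C.
2: { field. auto using C2_neq_0. }
apply Clim_ext with (fun k => PI * Ci * (qq (w / INR (N k)) + 1) * / (INR (N k) * (qq (w / INR (N k)) - 1)))%C.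
- intros k. unfold cotpi, Cdiv. rewrite Cinv_mul. ring.
- apply Clim_mul. apply Clim_scal. apply Clim_add; auto using Clim_const, Clim_qq_0.
  apply Clim_inv; auto using Clim_qq_sub_1_mul. repeat apply Cmult_neq_0; auto using C2_neq_0.
Qed.

(** A quantitative form of [z] not being an integer: the distance to [-n] grows linearly in [n].
    This yields quadratic majorants with explicit constants and is stable under small
    perturbations. *)
Definition off_integers (kap : R) (z : C) : Prop :=
  0 < kap /\ forall n : Z, kap * (1 + Rabs (IZR n)) <= Cmod (z + IZR n).

Lemma off_integers_qq kap z : off_integers kap z -> qq z <> 1.
Proof.
intros [Hk H] E.
assert (Hy : Im z = 0).
{ pose proof (Cmod_qq z) as Hm. rewrite E, Cmod_1 in Hm. symmetry in Hm. rewrite <- exp_0 in Hm.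
  apply exp_inv in Hm. assert (2 * PI * Im z = 0) as H0 by lra.
  apply Rmult_integral in H0. generalize PI_RGT_0. destruct H0; lra. }
(* [n] is an integer nearest to [Re z], so that [z - n] lies in the strip where [qq_sub_1_ge]
   applies. *)
destruct (archimed (Re z - 1 / 2)) as [H1 H2]. set (n := up _) in *.
assert (Hq : qq (z - IZR n) = 1%C).
{ assert (HZ : qq (IZR n) = 1%C).
  { destruct (Z_le_gt_dec 0 n) as [h|h].
    - rewrite <- (Z2Nat.id n h), <- INR_IZR_INZ. apply qq_INR.
    - replace (RtoC (IZR n)) with (- INR (Z.to_nat (- n)))%C.
      rewrite qq_opp, qq_INR. field; exact C1_nz.
      rewrite <- RtoC_opp. f_equal. rewrite INR_IZR_INZ, Z2Nat.id, opp_IZR by lia. ring. }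
  unfold Cminus. rewrite qq_add, E, qq_opp, HZ. field; exact C1_nz. }
assert (HR : Re (z - IZR n) = Re z - IZR n) by (destruct z; reflexivity).
assert (HI : Im (z - IZR n) = 0). { destruct z. simpl in *. rewrite Hy. ring. }
assert (Hb := qq_sub_1_ge (z - IZR n)). rewrite HR, HI, Hq, Rabs_R0 in Hb.
replace (1 - 1)%C with (RtoC 0) in Hb by ring. rewrite Cmod_0 in Hb.
specialize (Hb ltac:(apply Rabs_le; lra) ltac:(lra)).
specialize (H (- n)%Z). rewrite opp_IZR, RtoC_opp in H. fold (z - IZR n)%C in H.
rewrite Rabs_Ropp in H. generalize (Rabs_pos (IZR n)). nra.
Qed.

Lemma off_integers_nat kap z n : off_integers kap z ->
  kap * INR n <= Cmod (z + INR n) /\ kap * INR n <= Cmod (z - INR n).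
Proof.
intros [Hk H]. pose proof (H (Z.of_nat n)) as H1. pose proof (H (- Z.of_nat n)%Z) as H2.
rewrite opp_IZR, Rabs_Ropp, RtoC_opp in H2. rewrite <- INR_IZR_INZ in *.
rewrite Rabs_pos_eq in * by apply pos_INR. fold (z - INR n)%C in H2. split; nra.
Qed.

Lemma off_integers_0 kap z : off_integers kap z -> kap <= Cmod z.
Proof.
intros [Hk H]. specialize (H 0%Z). rewrite Rabs_R0 in H. replace (z + IZR 0)%C with z in H by (simpl; ring). lra.
Qed.

Lemma off_integers_neq kap z n : off_integers kap z ->
  z <> 0 /\ (z + INR (S n))%C <> 0 /\ (z - INR (S n))%C <> 0.
Proof.
intros H. destruct (off_integers_nat kap z (S n) H) as [H1 H2]. pose proof (off_integers_0 _ _ H).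
destruct H as [Hk _]. assert (0 < kap * INR (S n)) by (apply Rmult_lt_0_compat; auto; apply lt_0_INR; lia).
repeat split; apply Cmod_gt_0; lra.
Qed.

Lemma lt_pow2 k : (k < 2 ^ k)%nat.
Proof. apply Nat.pow_gt_lin_r. lia. Qed.

Theorem cotpi_partial_fractions kap z : off_integers kap z ->
  Cser (fun i => / (z + INR (S i)) + / (z - INR (S i)))%C (cotpi z - / z)%C.
Proof.
intros Hz. pose proof (off_integers_qq kap z Hz) as Hq. destruct (off_integers_neq kap z 0 Hz) as [Hz0 _].
pose proof (Cmod_ge_0 z) as Hzpos.
(* Starting at [K0] makes [Cmod (z / N) <= 1 / 100]; together with the shift of at most [1 / 2] the
   real part stays below the [3 / 5] allowed by [qq_sub_1_ge]. *)
destruct (archimed (100 * Cmod z)) as [HA _]. set (K0 := Z.to_nat (up (100 * Cmod z))).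
assert (HK0 : 100 * Cmod z <= INR (2 ^ K0)).
{ apply Rle_trans with (INR K0). 2: apply le_INR; generalize (lt_pow2 K0); lia.
  unfold K0. rewrite INR_IZR_INZ, Z2Nat.id. lra. apply le_IZR. lra. }
set (N := fun k => (2 ^ (k + K0 + 1))%nat). set (m := fun k => (2 ^ (k + K0) - 1)%nat).
assert (HNm : forall k, (2 ^ (k + K0 + 1) = 2 * S (m k))%nat).
{ intros k. unfold m. rewrite Nat.pow_add_r. generalize (two_pow_pos (k + K0)). change (2 ^ 1)%nat with 2%nat.
  generalize (2 ^ (k + K0))%nat. clear. lia. }
assert (HN : forall k, (k < N k)%nat).
{ intros k. unfold N. generalize (lt_pow2 (k + K0 + 1)). lia. }
assert (HNz : forall k, 100 * Cmod z <= INR (N k)).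
{ intros k. eapply Rle_trans; [exact HK0|]. apply le_INR. unfold N. apply Nat.pow_le_mono_r; lia. }
assert (HN0 : forall k, 0 < INR (N k)). { intros k. apply lt_0_INR. specialize (HN k). lia. }
assert (HNC : forall k, RtoC (INR (N k)) <> 0). { intros k. apply RtoC_neq_0. specialize (HN0 k). lra. }
destruct (tannery_finite
  (fun k i => / INR (N k) * (cotpi ((z + INR (S i)) / INR (N k)) + cotpi ((z - INR (S i)) / INR (N k))))%C
  (fun i => / (z + INR (S i)) + / (z - INR (S i)))%C
  (* [384 = 8 * 48] comes from [2 * PI <= 8] and [Hxy]; the other constant is the square of the
     [100000] in [qq_sub_1_ge]. *)
  (fun i => (384 * 10000000000 * Cmod z / (kap * kap)) * / (INR (S i) * INR (S i))) m) as [S [HS1 HS2]].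
- apply summable_scal; [|apply summable_inv_sq]. destruct Hz as [Hk _].
  apply Rdiv_le_0_compat; nra.
- intros k i Hi. destruct (off_integers_nat kap z (S i) Hz) as [Hp Hm]. destruct Hz as [Hk _].
  specialize (HNz k). specialize (HN0 k). specialize (HNC k). specialize (HNm k). fold (N k) in HNm.
  set (n := INR (N k)) in *. set (d := INR (S i)) in *.
  assert (Hd : 0 < d) by (apply lt_0_INR; lia).
  assert (Hdn : d <= n / 2).
  { apply Rle_div_r; [lra|]. unfold d, n. rewrite HNm, mult_INR, (Rmult_comm (INR 2)). simpl (INR 2).
    apply Rmult_le_compat_r; [lra|]. apply le_INR. lia. }
  assert (Hzn : Cmod (z / n) <= 1 / 100).
  { rewrite Cmod_div, Cmod_R, Rabs_pos_eq by (auto; lra). apply Rle_div_l; auto. lra. }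
  assert (Hlow : forall (w : C), w = d \/ w = (- d)%C -> kap * d <= Cmod (z + w) ->
     kap * d / (100000 * n) <= Cmod (qq ((z + w) / n) - 1)).
  { intros w Hw Hkw. eapply Rle_trans; [|apply qq_sub_1_ge].
    - rewrite Cmod_div, Cmod_R, Rabs_pos_eq by (auto; lra).
      replace (kap * d / (100000 * n)) with (kap * d * / n / 100000) by (field; lra).
      apply Rmult_le_compat_r; [lra|]. apply Rmult_le_compat_r; auto. left; now apply Rinv_0_lt_compat.
    - replace ((z + w) / n)%C with (z / n + w / n)%C by (field; auto).
      rewrite re_plus. eapply Rle_trans; [apply Rabs_triang|].
      assert (Rabs (Re (w / n)) <= 1 / 2).
      { eapply Rle_trans; [apply Rabs_Re_le|]. rewrite Cmod_div, Cmod_R, (Rabs_pos_eq n) by (auto; lra).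
        replace (Cmod w) with d. apply Rle_div_l; auto. lra.
        destruct Hw as [-> | ->]; rewrite ?Cmod_opp, Cmod_R, Rabs_pos_eq; lra. }
      generalize (Rabs_Re_le (z / n)). lra.
    - replace ((z + w) / n)%C with (z / n + w / n)%C by (field; auto).
      rewrite im_plus. replace (Im (w / n)) with 0.
      rewrite Rplus_0_r. generalize (Rabs_Im_le (z / n)). lra.
      assert (n <> 0) by lra.
      destruct Hw as [-> | ->]; [|rewrite <- RtoC_opp]; rewrite <- RtoC_div; auto. }
  pose proof (Hlow d (or_introl eq_refl) Hp) as L1.
  pose proof (Hlow (- d)%C (or_intror eq_refl) Hm) as L2. fold (z - d)%C in L2. clear Hlow.
  set (x := qq ((z + d) / n)) in *. set (y := qq ((z - d) / n)) in *.
  assert (Hxy : Cmod (x * y - 1) <= 48 * Cmod z / n).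
  { unfold x, y. rewrite <- qq_add. replace ((z + d) / n + (z - d) / n)%C with (2 * (z / n))%C by (field; auto).
    assert (Cmod (2 * (z / n)) = 2 * Cmod z / n) as E.
    { rewrite Cmod_mult, Cmod_div, !Cmod_R, !Rabs_pos_eq by (auto; lra). field. lra. }
    eapply Rle_trans; [apply qq_sub_1_le|]. rewrite Cmod_mult, Cmod_R, Rabs_pos_eq by lra. lra.
    rewrite E. right. field. lra. }
  assert (Hpos : 0 < kap * d / (100000 * n)) by (apply Rdiv_lt_0_compat; nra).
  assert (x - 1 <> 0)%C by (apply Cmod_gt_0; lra). assert (y - 1 <> 0)%C by (apply Cmod_gt_0; lra).
  (* The gain from pairing: the common numerator contains [x * y - 1], and [x * y = qq (2 * z / n)]
     no longer involves [d] and is within [O(Cmod z / n)] of 1. Hence the pair is [O(1 / d^2)]. *)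
  replace (/ n * (cotpi ((z + d) / n) + cotpi ((z - d) / n)))%C with
   (2 * PI * Ci * (x * y - 1) / (n * ((x - 1) * (y - 1))))%C by (unfold cotpi; fold x y; field; auto).
  rewrite Cmod_div by (repeat apply Cmult_neq_0; auto).
  rewrite !Cmod_mult, Cmod_Ci, !Cmod_R, (Rabs_pos_eq 2), (Rabs_pos_eq PI), (Rabs_pos_eq n)
    by (generalize PI_RGT_0; lra).
  set (X := Cmod (x - 1)) in *. set (Y := Cmod (y - 1)) in *. set (W := Cmod (x * y - 1)) in *.
  set (t := kap * d / (100000 * n)) in *.
  apply Rle_trans with (8 * (48 * Cmod z / n) / (n * (t * t))).
  + apply Rmult_le_compat.
    * generalize PI_RGT_0 (Cmod_ge_0 (x * y - 1)). fold W. intros. apply Rmult_le_pos; [apply Rmult_le_pos; [apply Rmult_le_pos|]|]; lra.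
    * left. apply Rinv_0_lt_compat. apply Rmult_lt_0_compat; auto. apply Rmult_lt_0_compat; lra.
    * rewrite Rmult_1_r. apply Rmult_le_compat; auto; try apply Cmod_ge_0. generalize PI_RGT_0; lra.
      generalize PI_4; lra.
    * apply Rinv_le_contravar. apply Rmult_lt_0_compat; auto. now apply Rmult_lt_0_compat.
      apply Rmult_le_compat_l. lra. apply Rmult_le_compat; lra.
  + right. unfold t. field. repeat split; lra.
- intros i. destruct (off_integers_neq kap z i Hz) as (_ & H1 & H2).
  eapply Clim_ext; [|apply (Clim_add _ _ _ _ (Clim_cotpi_div _ N H1 HN) (Clim_cotpi_div _ N H2 HN))].
  intros k. cbv beta. ring.
- intros i. exists (S i). intros k Hk. unfold m. generalize (lt_pow2 (k + K0)). lia.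
- replace (cotpi z - / z)%C with S; auto. 
  apply (Clim_unique _ _ _ HS2).
  apply Clim_ext with (fun k => cotpi z - / INR (N k) * cotpi (z / INR (N k)) -
    / INR (N k) * cotpi (z / INR (N k) + RtoC (1 / 2)))%C.
  { intros k. rewrite (cotpi_symmetric_sum z (m k) (k + K0 + 1) Hq (HNm k)) at 1. fold (N k). ring. }
  (* The middle term is [/ N] times a cotangent tending to [PI * cot (PI / 2) = 0]. *)
  replace (cotpi z - / z)%C with (cotpi z - / z - 0 * (PI * Ci * (1 - 1) / (- (1) - 1)))%C by (unfold Cdiv; ring).
  apply Clim_sub. apply Clim_sub. apply Clim_const. now apply Clim_cotpi_div.
  apply Clim_mul.
  { apply Clim_ext with (fun k => 1 / INR (N k))%C. intros; unfold Cdiv; ring. now apply Clim_div_nat. }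
  apply Clim_ext with (fun k => PI * Ci * (1 - qq (z / INR (N k))) * / (- qq (z / INR (N k)) - 1))%C.
  { intros k. unfold cotpi. rewrite qq_add, qq_half.
    replace (qq (z / INR (N k)) * - (1))%C with (- qq (z / INR (N k)))%C by ring. unfold Cdiv. ring. }
  pose proof (Clim_qq_0 _ (Clim_div_nat z N HN)) as Hq1.
  apply Clim_mul. apply Clim_scal. apply Clim_sub; auto using Clim_const.
  apply Clim_inv. 
  { replace (- (1) - 1)%C with (- RtoC 2)%C by ring. apply Copp_neq_0, C2_neq_0. }
  apply Clim_sub; auto using Clim_const, Clim_opp.
Qed.

Lemma off_integers_perturb kap z h : off_integers kap z -> Cmod h <= kap / 2 -> off_integers (kap / 2) (z + h).
Proof.
intros [Hk H] Hh. split. lra. intros n. specialize (H n).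
replace (z + h + IZR n)%C with (z + IZR n - (- h))%C by ring.
generalize (Cmod_triangle_sub (z + IZR n) (- h)) (Rabs_pos (IZR n)). rewrite Cmod_opp. nra.
Qed.

(** Difference quotients of the partial fraction expansion of the cotangent. *)
Theorem inv_sin_sq_partial_fractions kap z : off_integers kap z ->
  Cser (fun i => / (z + INR (S i)) ^ 2 + / (z - INR (S i)) ^ 2)%C
    (- (4 * PI ^ 2 * qq z / (1 - qq z) ^ 2) - / z ^ 2)%C.
Proof.
intros Hz. pose proof (off_integers_qq kap z Hz) as Hq. destruct (off_integers_neq kap z 0 Hz) as [Hz0 _].
pose proof (proj1 Hz) as Hk.
(* With [N k >= 2 / kap] the increment [h k] stays within [kap / 2], as [off_integers_perturb]
   demands. *)
destruct (archimed (2 / kap)) as [HA _]. set (K0 := Z.to_nat (up (2 / kap))).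
set (N := fun k => (k + K0 + 1)%nat).
assert (HN : forall k, (k < N k)%nat) by (intros; unfold N; lia).
assert (HN0 : forall k, 0 < INR (N k)). { intros k. apply lt_0_INR. specialize (HN k). lia. }
assert (HNC : forall k, RtoC (INR (N k)) <> 0). { intros k. apply RtoC_neq_0. specialize (HN0 k). lra. }
set (h := fun k => (1 / INR (N k))%C).
assert (Hh : forall k, Cmod (h k) <= kap / 2).
{ intros k. unfold h. rewrite Cmod_div, Cmod_1, Cmod_R, Rabs_pos_eq by (auto; specialize (HN0 k); lra).
  apply Rle_div_l; [apply HN0|]. apply Rmult_le_reg_l with (2 / kap). apply Rdiv_lt_0_compat; lra.
  replace (2 / kap * (kap / 2 * INR (N k))) with (INR (N k)) by (field; lra). rewrite Rmult_1_r.
  assert (0 < 2 / kap) by (apply Rdiv_lt_0_compat; lra).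
  apply Rle_trans with (INR K0). 2: apply le_INR; unfold N; lia.
  unfold K0. rewrite INR_IZR_INZ, Z2Nat.id. lra. apply le_IZR. lra. }
assert (Hzh : forall k, off_integers (kap / 2) (z + h k)) by (intros; now apply off_integers_perturb).
assert (Hh0 : forall k, h k <> 0). { intros k. apply Cdiv_neq_0; auto. exact C1_nz. }
assert (Hlim : Clim h 0) by now apply Clim_div_nat.
assert (Hw : forall w, Clim (fun k => / (w * (w + h k)))%C (/ w ^ 2)%C).
(* Since [/ 0 = 0], the limit also holds at [w = 0], where the sequence is constant. *)
{ intros w. destruct (Ceq_dec w 0) as [->|Hw].
  - apply Clim_ext with (fun _ => / (0 * 0))%C. intros; f_equal; ring.
    replace (0 ^ 2)%C with (0 * 0)%C by ring. apply Clim_const.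
  - apply Clim_inv. now apply Cpow_nz. replace (w ^ 2)%C with (w * (w + 0))%C by ring.
    apply Clim_scal, Clim_add; auto using Clim_const. }
(* The difference quotient of [/ w] is, up to sign, exactly [/ (w * (w + h))], which is dominated by
   a multiple of [/ n^2] uniformly in [h]. *)
destruct (tannery (fun k i => / ((z + INR (S i)) * (z + INR (S i) + h k)) + / ((z - INR (S i)) * (z - INR (S i) + h k)))%C
  (fun i => / (z + INR (S i)) ^ 2 + / (z - INR (S i)) ^ 2)%C
  (fun i => (4 / (kap * kap)) * / (INR (S i) * INR (S i)))
  (fun k => (cotpi z - cotpi (z + h k)) / h k - / (z * (z + h k)))%C) as [S [HS1 HS2]].
- apply summable_scal; [|apply summable_inv_sq]. apply Rdiv_le_0_compat; nra.
- intros k i. destruct (off_integers_nat _ _ (S i) Hz) as [H1 H2].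
  destruct (off_integers_nat _ _ (S i) (Hzh k)) as [H3 H4].
  set (d := INR (S i)) in *. assert (Hd : 0 < d) by (apply lt_0_INR; lia).
  assert (Hb : forall a b : C, kap * d <= Cmod a -> kap / 2 * d <= Cmod b ->
     Cmod (/ (a * b)) <= 2 / (kap * kap) * / (d * d)).
  { intros a b Ha Hb. assert (0 < kap * d) by nra.
    assert (Ha0 : a <> 0) by (apply Cmod_gt_0; lra). assert (Hb0 : b <> 0) by (apply Cmod_gt_0; lra).
    rewrite Cmod_inv by now apply Cmult_neq_0. rewrite Cmod_mult.
    replace (2 / (kap * kap) * / (d * d)) with (/ (kap * d * (kap / 2 * d))) by (field; lra).
    apply Rinv_le_contravar. apply Rmult_lt_0_compat; lra. apply Rmult_le_compat; lra. }
  eapply Rle_trans; [apply Cmod_triangle|].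
  replace (4 / (kap * kap) * / (d * d)) with (2 / (kap * kap) * / (d * d) + 2 / (kap * kap) * / (d * d)) by (field; lra).
  apply Rplus_le_compat; apply Hb; auto.
  replace (z + d + h k)%C with (z + h k + d)%C by ring. auto.
  replace (z - d + h k)%C with (z + h k - d)%C by ring. auto.
- intros i. apply Clim_add; auto.
- intros k. pose proof (off_integers_neq _ _ O (Hzh k)) as [Hzh0 _].
  replace ((cotpi z - cotpi (z + h k)) / h k - / (z * (z + h k)))%C with
    (/ h k * ((cotpi z - / z) - (cotpi (z + h k) - / (z + h k))))%C by (field; auto).
  eapply Cser_ext; [|apply Cser_scal; apply Cser_sub; [apply (cotpi_partial_fractions kap z Hz)|
    apply (cotpi_partial_fractions _ _ (Hzh k))]].
  intros i. cbv beta. destruct (off_integers_neq _ _ i Hz) as (_ & H1 & H2).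
  destruct (off_integers_neq _ _ i (Hzh k)) as (_ & H3 & H4).
  replace (z + INR (S i) + h k)%C with (z + h k + INR (S i))%C by ring.
  replace (z - INR (S i) + h k)%C with (z + h k - INR (S i))%C by ring.
  field. auto.
- replace (- (4 * PI ^ 2 * qq z / (1 - qq z) ^ 2) - / z ^ 2)%C with S; auto.
  apply (Clim_unique _ _ _ HS2). apply Clim_sub; auto.
  set (a := qq z) in *.
  assert (Ha : (a - 1)%C <> 0) by now apply Cminus_neq_0.
  assert (Hqh : Clim (fun k => qq (h k)) 1) by now apply Clim_qq_0.
  apply Clim_ext with (fun k => 2 * PI * Ci * a * (INR (N k) * (qq (h k) - 1)) * / ((a * qq (h k) - 1) * (a - 1)))%C.
  { intros k. unfold cotpi. rewrite qq_add. fold a.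
    assert (a * qq (h k) - 1 <> 0)%C.
    { apply Cminus_neq_0. unfold a. rewrite <- qq_add. now apply off_integers_qq with (kap / 2). }
    replace (RtoC (INR (N k))) with (/ h k)%C. field. auto.
    unfold h. field. auto. }
  replace (- (4 * PI ^ 2 * a / (1 - a) ^ 2))%C with
    (2 * PI * Ci * a * (2 * PI * Ci * 1) * / ((a * 1 - 1) * (a - 1)))%C.
  2: { assert (HCi : (Ci * Ci = - (1))%C) by (unfold Ci, Cmult, Copp, RtoC; simpl; f_equal; ring).
       assert (1 - a <> 0)%C. { apply Cminus_neq_0. auto. }
       replace (2 * PI * Ci * a * (2 * PI * Ci * 1))%C with (4 * PI * PI * a * (Ci * Ci))%C by ring.
       rewrite HCi. field. auto. }
  apply Clim_mul. apply Clim_mul. apply Clim_const.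
  apply Clim_qq_sub_1_mul; auto. exact C1_nz.
  apply Clim_inv. apply Cmult_neq_0; auto. now rewrite Cmult_1_r.
  apply Clim_mul; auto using Clim_const. apply Clim_sub; auto using Clim_const. apply Clim_mul; auto using Clim_const.
Qed.

Lemma off_integers_half : off_integers (1 / 4) (RtoC (1 / 2)).
Proof.
split. lra. intros n. rewrite <- RtoC_plus, Cmod_R.
destruct (Z_le_gt_dec 0 n) as [h|h].
- apply IZR_le in h. rewrite !Rabs_pos_eq by lra. lra.
- assert (IZR n <= -1) by (apply IZR_le; lia). rewrite !Rabs_left by lra. lra.
Qed.

(** The sum over odd integers is the case [z = 1/2] of the previous expansion. *)
Theorem zeta_2 : Cser (fun i => / (INR (S i)) ^ 2)%C (PI ^ 2 / 6)%C.
Proof.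
assert (Hb : forall i, Cmod (/ (INR (S i)) ^ 2)%C <= / (INR (S i) * INR (S i))).
{ intros i. assert (0 < INR (S i)) by (apply lt_0_INR; lia).
  rewrite <- RtoC_pow, <- RtoC_inv, Cmod_R by (apply pow_nonzero; lra).
  replace (INR (S i) ^ 2) with (INR (S i) * INR (S i)) by ring. rewrite Rabs_pos_eq. lra. left. apply Rinv_0_lt_compat. nra. }
destruct (Cser_cv _ _ summable_inv_sq Hb) as [Z HZ].
replace (PI ^ 2 / 6)%C with Z; auto.
pose proof (inv_sin_sq_partial_fractions _ _ off_integers_half) as H. rewrite qq_half in H.
assert (HS : forall i, RtoC (INR (S i)) <> 0) by (intros; apply INR_neq_0_C; lia).
assert (Hodd : forall i, (2 * INR i + 1)%C <> 0).
{ intros i. rewrite <- RtoC_mult, <- RtoC_plus. apply RtoC_neq_0. generalize (pos_INR i). lra. }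
assert (Hob : forall i, Cmod (/ (2 * INR i + 1) ^ 2)%C <= / (INR (S i) * INR (S i))).
{ intros i. rewrite Cmod_inv by (now apply Cpow_nz). rewrite Cmod_pow, <- RtoC_mult, <- RtoC_plus, Cmod_R.
  assert (0 < INR (S i)) by (apply lt_0_INR; lia). apply Rinv_le_contravar. nra.
  generalize (pos_INR i). rewrite S_INR in *. intros. rewrite Rabs_pos_eq by lra. nra. }
destruct (Cser_cv _ _ summable_inv_sq Hob) as [O HO].
(* At [z = 1/2] the terms are [4 / (2i + 3)^2] and [4 / (2i + 1)^2]: the odd sum [O] without and
   with its first term. *)
assert (E1 : (4 * (O - 1) + 4 * O = PI ^ 2 - 4)%C).
{ apply (Cser_unique (fun i => 4 * / (2 * INR (S i) + 1) ^ 2 + 4 * / (2 * INR i + 1) ^ 2)%C).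
  - apply Cser_add; apply Cser_scal; auto.
    replace (O - 1)%C with (O - / (2 * INR 0 + 1) ^ 2)%C.
    apply (Cser_unshift (fun i => / (2 * INR i + 1) ^ 2)%C); auto.
    simpl (INR 0). f_equal. f_equal. field. auto.
  - replace (PI ^ 2 - 4)%C with (- (4 * PI ^ 2 * - (1) / (1 - - (1)) ^ 2) - / RtoC (1 / 2) ^ 2)%C.
    + apply Cser_ext with (2 := H). intros i. pose proof (Hodd i). pose proof (Hodd (S i)).
      rewrite !S_INR, !RtoC_plus, RtoC_div in * by lra.
      assert (1 - (INR i + 1) * 2 <> 0)%C.
      { replace (1 - (INR i + 1) * 2)%C with (- (2 * INR i + 1))%C by ring. now apply Copp_neq_0. }
      f_equal; [f_equal|]; field; auto using C2_neq_0.
    + rewrite RtoC_div by lra. field. }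
(* The even integers contribute a quarter of the whole sum. *)
assert (E2 : (O + / 4 * Z = Z)%C).
{ apply (Clim_unique (fun n => Csum (fun i => / (INR (S i)) ^ 2)%C (2 * n))).
  - apply Clim_ext with (Csum (fun i => / (2 * INR i + 1) ^ 2 + / 4 * / (INR (S i)) ^ 2)%C).
    2: apply Cser_add; auto; now apply Cser_scal.
    induction n; [simpl; ring|]. replace (2 * S n)%nat with (S (S (2 * n))) by lia. cbn [Csum].
    rewrite IHn. rewrite <- Cplus_assoc. f_equal. f_equal.
    + f_equal. f_equal. rewrite S_INR, mult_INR, RtoC_plus, RtoC_mult. simpl (INR 2). reflexivity.
    + replace (RtoC (INR (S (S (2 * n))))) with (2 * INR (S n))%C. field; auto.
      rewrite <- RtoC_mult. f_equal. rewrite !S_INR, mult_INR. simpl. ring.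
  - apply (Clim_subseq _ _ (fun n => 2 * n)%nat); auto. intros; lia. }
assert (EO : O = (PI ^ 2 / 8)%C).
{ replace O with ((4 * (O - 1) + 4 * O + 4) / 8)%C. rewrite E1. field. field. }
replace Z with ((Z - / 4 * Z) * 4 / 3)%C. rewrite <- E2 at 1. rewrite EO. field. field.
Qed.

(** * The weight two Eisenstein series *)

(** The modulus of [x tau + y] is a norm on pairs of reals. The imaginary part bounds [x] by
    [D / t], then [y] is bounded by [D] plus [Cmod tau] times that. *)
Lemma lattice_bound tau : 0 < Im tau ->
  exists kap, 0 < kap /\ forall x y : R, kap * (Rabs x + Rabs y) <= Cmod (x * tau + y).
Proof.
intros H. set (t := Im tau) in *. pose proof (Cmod_ge_0 tau) as H0.
exists (/ (/ t + 1 + Cmod tau / t)).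
assert (Hc : 0 < / t + 1 + Cmod tau / t).
{ generalize (Rinv_0_lt_compat _ H) (Rdiv_le_0_compat _ _ H0 H). lra. }
split. now apply Rinv_0_lt_compat.
intros x y. set (D := Cmod (x * tau + y)).
assert (H1 : Rabs x * t <= D).
{ rewrite <- (Rabs_pos_eq t) by lra. rewrite <- Rabs_mult.
  replace (x * t) with (Im (x * tau + y)%C) by (unfold t; destruct tau; simpl; ring). apply Rabs_Im_le. }
assert (H2 : Rabs y <= D + Rabs x * Cmod tau).
{ rewrite <- (Cmod_R y). replace (RtoC y) with ((x * tau + y) - x * tau)%C by ring.
  eapply Rle_trans; [apply Cmod_triangle_minus|]. rewrite Cmod_mult, Cmod_R. fold D. lra. }
apply Rmult_le_reg_l with (/ t + 1 + Cmod tau / t); auto.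
rewrite <- Rmult_assoc, Rinv_r, Rmult_1_l by lra.
assert (H3 : Rabs x <= D / t) by (apply Rle_div_r; auto).
assert (Rabs x * Cmod tau <= D / t * Cmod tau) by (apply Rmult_le_compat_r; auto).
replace ((/ t + 1 + Cmod tau / t) * D) with (D / t + (D + D / t * Cmod tau)) by (field; lra). lra.
Qed.

Lemma Clim_dominated_0 u v : (forall n, Cmod (u n) <= Cmod (v n)) -> Clim v 0 -> Clim u 0.
Proof.
intros H Hv. apply Clim_squeeze_0 with (1 := H). intros eps He. destruct (Hv eps He) as [N HN].
exists N. intros n Hn. specialize (HN n Hn). now replace (v n - 0)%C with (v n) in HN by ring.
Qed.

Lemma off_integers_lattice tau kap x : 0 < kap ->
  (forall x y : R, kap * (Rabs x + Rabs y) <= Cmod (x * tau + y)) -> 1 / 2 <= x ->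
  off_integers (kap / 2) (x * tau).
Proof.
intros Hk H Hx. split. lra. intros n. specialize (H x (IZR n)).
rewrite (Rabs_pos_eq x) in H by lra. generalize (Rabs_pos (IZR n)). nra.
Qed.

Lemma Im_opp_inv tau : 0 < Im tau -> 0 < Im (- / tau).
Proof.
intros H. destruct tau as [x y]. unfold Im in *. simpl in *.
replace (- (- y / (x * (x * 1) + y * (y * 1)))) with (y / (x * x + y * y)) by (field; nra).
apply Rdiv_lt_0_compat; nra.
Qed.

Lemma Im_pos_neq_0 tau : 0 < Im tau -> tau <> 0.
Proof. intros H ->. simpl in H. lra. Qed.

(** [1/((w+n)^2 - 1/4)] telescopes and approximates [1/(w+n)^2] to fourth order. *)
Definition tele (w : C) (n : R) : C := (/ (w + n - / 2) - / (w + n + / 2))%C.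

Lemma Csum_tele w N : (forall n, (w + RtoC (INR n) + / 2)%C <> 0) -> (forall n, (w - RtoC (INR n) - / 2)%C <> 0) ->
  Csum (fun j => tele w (INR (S j)) + tele w (- INR (S j)))%C N =
  (- / (w - / 2) + / (w + / 2) + (/ (w - INR N - / 2) - / (w + INR N + / 2)))%C.
Proof.
intros H1 H2. induction N.
- simpl. replace (w - 0)%C with w by ring. replace (w + 0)%C with w by ring. ring.
- cbn [Csum]. rewrite IHN. unfold tele. rewrite !S_INR, RtoC_opp, !RtoC_plus.
  replace (w + (INR N + 1) - / 2)%C with (w + INR N + / 2)%C by field.
  replace (w + - (INR N + 1) + / 2)%C with (w - INR N - / 2)%C by field.
  replace (w + (INR N + 1) + / 2)%C with (w + (INR N + 1) + / 2)%C by field.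
  replace (w + - (INR N + 1) - / 2)%C with (w - (INR N + 1) - / 2)%C by field. ring.
Qed.

(** Both sides are the sum of [1/(m tau + n)^2] over nonzero lattice points, in the two orders of
    summation. The difference with [tele] sums absolutely, so the orders differ by what the telescoping
    part contributes, namely a limit of cotangents. *)
Theorem lambert_transform tau L L' : 0 < Im tau ->
  Cser (fun i => qq tau ^ S i / (1 - qq tau ^ S i) ^ 2)%C L ->
  Cser (fun i => qq (- / tau) ^ S i / (1 - qq (- / tau) ^ S i) ^ 2)%C L' ->
  (- (4 * PI ^ 2) * L' / tau ^ 2 - PI ^ 2 / 6 =
   - (4 * PI ^ 2) * L - PI ^ 2 / 6 / tau ^ 2 - PI * Ci / tau)%C.
Proof.
intros Ht HL HL'. set (t' := (- / tau)%C) in *.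
assert (Ht' : 0 < Im t') by now apply Im_opp_inv.
pose proof (Im_pos_neq_0 tau Ht) as Ht0. pose proof (Im_pos_neq_0 t' Ht') as Ht0'.
destruct (lattice_bound tau Ht) as [kap [Hk HK]]. destruct (lattice_bound t' Ht') as [kap' [Hk' HK']].
assert (HS : forall n, 1 <= INR (S n)) by (intros n; rewrite S_INR; generalize (pos_INR n); lra).
assert (HSC : forall n, RtoC (INR (S n)) <> 0) by (intros; apply INR_neq_0_C; lia).
(* The lattice points off both axes, one from each pair of opposites. Rows and columns are instances
   of [inv_sin_sq_partial_fractions], at multiples of [tau] and, after scaling by [/ tau^2], of
   [t']; the terms on the axes are what [zeta_2] evaluates. *)
set (T := fun i j => (/ (INR (S i) * tau + INR (S j)) ^ 2 + / (INR (S i) * tau - INR (S j)) ^ 2)%C).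
set (b := fun i j => (tele (INR (S i) * tau) (INR (S j)) + tele (INR (S i) * tau) (- INR (S j)))%C).
set (rT := fun i => (- (4 * PI ^ 2) * (qq tau ^ S i / (1 - qq tau ^ S i) ^ 2) + - / tau ^ 2 * / INR (S i) ^ 2)%C).
set (cT := fun j => (/ tau ^ 2 * (- (4 * PI ^ 2)) * (qq t' ^ S j / (1 - qq t' ^ S j) ^ 2) - / INR (S j) ^ 2)%C).
assert (HrT : forall i, Cser (T i) (rT i)).
{ intros i. pose proof (inv_sin_sq_partial_fractions _ _ (off_integers_lattice tau kap (INR (S i)) Hk HK ltac:(generalize (HS i); lra))) as H.
  rewrite qq_scal in H. unfold T, rT.
  replace (- (4 * PI ^ 2) * (qq tau ^ S i / (1 - qq tau ^ S i) ^ 2) + - / tau ^ 2 * / INR (S i) ^ 2)%C with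
   (- (4 * PI ^ 2 * qq tau ^ S i / (1 - qq tau ^ S i) ^ 2) - / (INR (S i) * tau) ^ 2)%C; auto.
  unfold Cdiv. rewrite Cpow_mult_l, !Cinv_mul. ring. }
assert (HcT : forall j, Cser (fun i => T i j) (cT j)).
{ intros j. pose proof (inv_sin_sq_partial_fractions _ _ (off_integers_lattice t' kap' (INR (S j)) Hk' HK' ltac:(generalize (HS j); lra))) as H.
  rewrite qq_scal in H. apply (Cser_scal (/ tau ^ 2)%C) in H. unfold T, cT.
  replace (/ tau ^ 2 * (- (4 * PI ^ 2)) * (qq t' ^ S j / (1 - qq t' ^ S j) ^ 2) - / INR (S j) ^ 2)%C with
   (/ tau ^ 2 * (- (4 * PI ^ 2 * qq t' ^ S j / (1 - qq t' ^ S j) ^ 2) - / (INR (S j) * t') ^ 2))%C.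
  - apply Cser_ext with (2 := H). intros i. cbv beta. unfold t'.
    rewrite Cmult_plus_distr_l, <- !Cinv_mul, <- !Cpow_mult_l.
    replace (tau * (INR (S j) * - / tau + INR (S i)))%C with (INR (S i) * tau - INR (S j))%C by (field; auto).
    replace (tau * (INR (S j) * - / tau - INR (S i)))%C with (- (INR (S i) * tau + INR (S j)))%C by (field; auto).
    replace ((- (INR (S i) * tau + INR (S j))) ^ 2)%C with ((INR (S i) * tau + INR (S j)) ^ 2)%C by ring. ring.
  - unfold Cminus at 1 3. rewrite Cmult_plus_distr_l. f_equal.
    + unfold Cdiv. rewrite ?Cinv_mul. ring.
    + replace (/ tau ^ 2 * - / (INR (S j) * t') ^ 2)%C with (- (/ tau ^ 2 * / (INR (S j) * t') ^ 2))%C by ring.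
      rewrite <- Cinv_mul, <- Cpow_mult_l. do 2 f_equal. unfold t'.
      replace (tau * (INR (S j) * - / tau))%C with (- INR (S j))%C by (field; auto). ring. }
set (A := (- (4 * PI ^ 2) * L + - / tau ^ 2 * (PI ^ 2 / 6))%C).
assert (HA : Cser rT A) by (apply Cser_add; apply Cser_scal; auto using zeta_2).
set (B := (/ tau ^ 2 * (- (4 * PI ^ 2)) * L' - PI ^ 2 / 6)%C).
assert (HB : Cser cT B) by (apply Cser_sub; [apply Cser_scal|]; auto using zeta_2).
assert (Hlow : forall i (y : R), kap * (INR (S i) + Rabs y) <= Cmod (INR (S i) * tau + y)).
{ intros i y. rewrite <- (Rabs_pos_eq (INR (S i))) at 1 by (generalize (HS i); lra). apply HK. }
assert (Hnz : forall i (y : R), (INR (S i) * tau + y)%C <> 0).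
{ intros i y. apply Cmod_gt_0. eapply Rlt_le_trans; [|apply Hlow]. generalize (HS i) (Rabs_pos y). nra. }
assert (H2C : (/ 2 = RtoC (/ 2))%C) by (rewrite RtoC_inv by lra; reflexivity).
assert (nz1 : forall i n, (INR (S i) * tau + RtoC (INR n) + / 2)%C <> 0).
{ intros i n. rewrite H2C, <- Cplus_assoc, <- RtoC_plus. apply Hnz. }
assert (nz2 : forall i n, (INR (S i) * tau - RtoC (INR n) - / 2)%C <> 0).
{ intros i n. replace (INR (S i) * tau - INR n - / 2)%C with (INR (S i) * tau + RtoC (- INR n - / 2))%C.
  apply Hnz. rewrite H2C, RtoC_minus, RtoC_opp. ring. }
assert (Hpiece : forall i j (y : R), Rabs y = INR (S j) ->
  Cmod (/ (INR (S i) * tau + y) ^ 2 - tele (INR (S i) * tau) y) <=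
    / kap ^ 4 * (/ (INR (S i) * INR (S i)) * / (INR (S j) * INR (S j)))).
{ intros i j y Hy. set (w := (INR (S i) * tau)%C). unfold tele.
  assert (La : kap * (INR (S i) + INR (S j)) <= Cmod (w + y)) by (rewrite <- Hy; apply Hlow).
  assert (Lb : kap * ((INR (S i) + INR (S j)) / 2) <= Cmod (w + y - / 2)).
  { replace (w + y - / 2)%C with (w + RtoC (y - / 2))%C by (rewrite RtoC_minus, H2C; ring).
    eapply Rle_trans; [|apply Hlow]. apply Rmult_le_compat_l; [lra|].
    generalize (Rabs_triang_inv y (/ 2)). rewrite (Rabs_pos_eq (/ 2)), Hy by lra. generalize (HS i) (HS j). lra. }
  assert (Lc : kap * ((INR (S i) + INR (S j)) / 2) <= Cmod (w + y + / 2)).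
  { replace (w + y + / 2)%C with (w + RtoC (y - (- / 2)))%C by (rewrite RtoC_minus, RtoC_opp, H2C; ring).
    eapply Rle_trans; [|apply Hlow]. apply Rmult_le_compat_l; [lra|].
    generalize (Rabs_triang_inv y (- / 2)). rewrite Rabs_Ropp, (Rabs_pos_eq (/ 2)), Hy by lra.
    generalize (HS i) (HS j). lra. }
  set (m := INR (S i)) in *. set (n := INR (S j)) in *.
  assert (Hm : 1 <= m) by apply HS. assert (Hn : 1 <= n) by apply HS.
  assert (a0 : (w + y)%C <> 0) by (apply Cmod_gt_0; nra).
  assert (b0 : (w + y - / 2)%C <> 0) by (apply Cmod_gt_0; nra).
  assert (c0 : (w + y + / 2)%C <> 0) by (apply Cmod_gt_0; nra).
  replace (/ (w + y) ^ 2 - (/ (w + y - / 2) - / (w + y + / 2)))%C with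
    (- / 4 * / ((w + y) ^ 2 * ((w + y - / 2) * (w + y + / 2))))%C.
  2: { set (a := (w + y)%C) in *. set (a1 := (a - / 2)%C) in *. set (a2 := (a + / 2)%C) in *.
       replace (/ a1 - / a2)%C with ((a2 - a1) / (a1 * a2))%C by (field; auto).
       replace (/ a ^ 2 - (a2 - a1) / (a1 * a2))%C with ((a1 * a2 - a ^ 2 * (a2 - a1)) / (a ^ 2 * (a1 * a2)))%C by (field; auto).
       replace (a1 * a2 - a ^ 2 * (a2 - a1))%C with (- / 4)%C by (unfold a1, a2; field). reflexivity. }
  rewrite Cmod_mult, Cmod_inv by (apply Cmult_neq_0; [now apply Cpow_nz|now apply Cmult_neq_0]).
  replace (Cmod (- / 4)) with (/ 4).
  2: { rewrite Cmod_opp, <- RtoC_inv, Cmod_R, Rabs_pos_eq by lra. reflexivity. }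
  rewrite !Cmod_mult, Cmod_pow.
  set (s := kap * (m + n)) in *.
  apply Rle_trans with (/ 4 * / (s ^ 2 * (s / 2 * (s / 2)))).
  - apply Rmult_le_compat_l. lra. assert (0 < s) by (unfold s; nra).
    replace (kap * ((m + n) / 2)) with (s / 2) in * by (unfold s; field).
    apply Rinv_le_contravar. repeat apply Rmult_lt_0_compat; lra.
    apply Rmult_le_compat. apply pow_le; lra. nra. apply pow_incr; lra. apply Rmult_le_compat; lra.
  - replace (/ 4 * / (s ^ 2 * (s / 2 * (s / 2)))) with (/ kap ^ 4 * / ((m + n) ^ 4)) by (unfold s; field; nra).
    apply Rmult_le_compat_l. left; apply Rinv_0_lt_compat, pow_lt; auto.
    rewrite <- Rinv_mult. apply Rinv_le_contravar. apply Rmult_lt_0_compat; nra.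
    (* This turns decay of order four in [m + n] into a product of two summable factors. *)
    assert (m * n <= (m + n) ^ 2) by nra. assert (0 <= m * n) by nra.
    replace (m * m * (n * n)) with ((m * n) * (m * n)) by ring.
    replace ((m + n) ^ 4) with ((m + n) ^ 2 * (m + n) ^ 2) by ring. apply Rmult_le_compat; auto. }
destruct summable_inv_sq as [Hsq0 [Bs HBs]].
destruct (fubini (fun i j => T i j - b i j)%C
  (fun i j => (2 * / kap ^ 4 * / (INR (S i) * INR (S i))) * / (INR (S j) * INR (S j)))
  (fun i => (2 * / kap ^ 4 * Bs) * / (INR (S i) * INR (S i)))) as (rc & cc & Sg & Hrc & Hcc & HSr & HSc & _).
{ apply summable_scal. 2: apply summable_inv_sq.
  assert (0 <= Bs) by exact (HBs 0%nat). assert (0 < / kap ^ 4) by (apply Rinv_0_lt_compat, pow_lt; auto). nra. }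
{ intros i j. unfold T, b.
  pose proof (Hpiece i j (INR (S j)) ltac:(apply Rabs_pos_eq; generalize (HS j); lra)) as P1.
  pose proof (Hpiece i j (- INR (S j)) ltac:(rewrite Rabs_Ropp; apply Rabs_pos_eq; generalize (HS j); lra)) as P2.
  rewrite RtoC_opp in P2. fold (INR (S i) * tau - INR (S j))%C in P2.
  match goal with |- Cmod (?a + ?c - (?d + ?e)) <= _ => replace (a + c - (d + e))%C with ((a - d) + (c - e))%C by ring end.
  eapply Rle_trans; [apply Cmod_triangle|]. lra. }
{ intros i n. rewrite Rsum_scal. specialize (HBs n).
  replace (2 * / kap ^ 4 * Bs * / (INR (S i) * INR (S i))) with (2 * / kap ^ 4 * / (INR (S i) * INR (S i)) * Bs) by ring.
  apply Rmult_le_compat_l; auto. assert (0 < / kap ^ 4) by (apply Rinv_0_lt_compat, pow_lt; auto).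
  assert (0 < / (INR (S i) * INR (S i))). { apply Rinv_0_lt_compat. generalize (HS i). nra. }
  nra. }
set (rb := fun i => (- / (INR (S i) * tau - / 2) + / (INR (S i) * tau + / 2))%C).
assert (Hrb : forall i, Cser (b i) (rb i)).
{ intros i. eapply Clim_ext; [intros N; symmetry; apply (Csum_tele (INR (S i) * tau) N (nz1 i) (nz2 i))|].
  replace (rb i) with (rb i + (0 - 0))%C by ring.
  apply Clim_add. exact (Clim_const (rb i)).
  assert (Hz : forall s : nat -> C, (forall N, kap * INR (S N) <= Cmod (s N)) -> Clim (fun N => / s N)%C 0).
  { intros s Hs. apply Clim_dominated_0 with (fun N => / kap / INR (S N))%C.
    2: apply (Clim_div_nat (/ kap)%C S); auto.
    intros N. assert (0 < kap * INR (S N)) by (generalize (HS N); nra).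
    rewrite Cmod_inv by (apply Cmod_gt_0; specialize (Hs N); lra).
    unfold Cdiv. rewrite <- Cinv_mul, <- RtoC_mult, Cmod_inv, Cmod_R, Rabs_pos_eq by (try apply RtoC_neq_0; lra).
    apply Rinv_le_contravar; auto. }
  apply Clim_sub; apply Hz; intros N.
  - replace (INR (S i) * tau - INR N - / 2)%C with (INR (S i) * tau + RtoC (- INR N - / 2))%C
      by (rewrite H2C, RtoC_minus, RtoC_opp; ring).
    eapply Rle_trans; [|apply Hlow]. apply Rmult_le_compat_l; [lra|]. rewrite (S_INR N).
    rewrite Rabs_left1 by (generalize (pos_INR N); lra). generalize (HS i); lra.
  - rewrite H2C, <- Cplus_assoc, <- RtoC_plus.
    eapply Rle_trans; [|apply Hlow]. apply Rmult_le_compat_l; [lra|]. rewrite (S_INR N).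
    rewrite Rabs_pos_eq by (generalize (pos_INR N); lra). generalize (HS i); lra. }
assert (HrbS : Cser rb (A - Sg)%C).
{ apply Cser_ext with (fun i => rT i - rc i)%C. 2: now apply Cser_sub.
  intros i. apply (Cser_unique (b i)); auto.
  apply Cser_ext with (fun j => T i j - (T i j - b i j))%C. intros; ring. apply Cser_sub; auto. }
set (z := fun N => (RtoC (INR N + / 2) * t')%C).
assert (Hz : forall N, off_integers (kap' / 2) (z N)).
{ intros N. apply off_integers_lattice; auto. generalize (pos_INR N). lra. }
(* After [N] columns the telescoping leaves boundary terms in every row. Summed over the rows they
   form the partial fraction series of the cotangent at [z N = (N + 1/2) t']. *)
set (V := fun N => (/ tau * (cotpi (z N) - / z N))%C).
assert (HV : forall N, (Csum cT N - Csum cc N = (A - Sg) + V N)%C).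
{ intros N. apply (Cser_unique (fun i => Csum (b i) N)).
  - apply Cser_ext with (fun i => Csum (T i) N - Csum (fun j => T i j - b i j) N)%C.
    { intros i. rewrite <- Csum_sub. apply Csum_ext. intros; ring. }
    apply Cser_sub; apply Cser_Csum; auto.
  - apply Cser_ext with (fun i => rb i + / tau * (/ (z N + INR (S i)) + / (z N - INR (S i))))%C.
    + intros i. unfold b. rewrite (Csum_tele (INR (S i) * tau) N (nz1 i) (nz2 i)). unfold rb. f_equal.
      rewrite Cmult_plus_distr_l, <- !Cinv_mul.
      replace (INR (S i) * tau - INR N - / 2)%C with (tau * (z N + INR (S i)))%C.
      replace (INR (S i) * tau + INR N + / 2)%C with (- (tau * (z N - INR (S i))))%C.
      * destruct (off_integers_neq _ _ i (Hz N)) as (_ & h1 & h2). field. auto.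
      * unfold z, t'. rewrite RtoC_plus, <- H2C. field. auto using C2_neq_0.
      * unfold z, t'. rewrite RtoC_plus, <- H2C. field. auto using C2_neq_0.
    + apply Cser_add; auto. apply Cser_scal. now apply cotpi_partial_fractions with (kap' / 2). }
assert (HVl : Clim V (- (PI * Ci) / tau)%C).
{ unfold V. replace (- (PI * Ci) / tau)%C with (/ tau * (PI * Ci * (0 + 1) * / (0 - 1) - 0))%C by (field; auto).
  apply Clim_scal. apply Clim_sub.
  - unfold cotpi, Cdiv.
    (* The imaginary part of [z N] tends to infinity, so [qq (z N)] tends to 0 and the cotangent to
       [- PI * Ci]: this is the anomaly of the weight two series. *)
    assert (Hq : Clim (fun N => qq (z N)) 0).
    { apply Clim_ext with (fun N => Cexp (2 * PI * (Ci * (t' / 2))) * qq t' ^ N)%C.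
      { intros N. rewrite <- qq_scal. unfold qq. rewrite <- Cexp_add. f_equal. unfold z.
        rewrite RtoC_plus, <- H2C, RtoC_mult. field; auto using C2_neq_0. }
      replace (RtoC 0) with (Cexp (2 * PI * (Ci * (t' / 2))) * 0)%C by ring. apply Clim_scal.
      apply (Cser_term_lim _ _ (Cser_geom (qq t') (Cmod_qq_lt_1 t' Ht'))). }
    apply Clim_mul. apply Clim_scal, Clim_add; auto using Clim_const.
    apply Clim_inv. replace (0 - 1)%C with (- RtoC 1)%C by ring. apply Copp_neq_0, C1_nz.
    apply Clim_sub; auto using Clim_const.
  - apply Clim_dominated_0 with (fun N => 2 / kap' / INR (S N))%C.
    2: apply (Clim_div_nat (2 / kap')%C S); auto.
    intros N. destruct (off_integers_neq _ _ 0 (Hz N)) as [h0 _]. rewrite Cmod_inv by auto.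
    replace (2 / kap' / INR (S N))%C with (RtoC (/ (kap' / 2 * INR (S N)))).
    2: { rewrite RtoC_inv, RtoC_mult, RtoC_div by (try lra; generalize (HS N); nra).
         assert (RtoC kap' <> 0) by (apply RtoC_neq_0; lra). field. auto using C2_neq_0. }
    assert (0 < kap' / 2 * INR (S N)) by (generalize (HS N); nra).
    rewrite Cmod_R, Rabs_pos_eq by (left; now apply Rinv_0_lt_compat).
    apply Rinv_le_contravar; auto. unfold z.
    replace (RtoC (INR N + / 2) * t')%C with (RtoC (INR N + / 2) * t' + RtoC 0)%C by ring.
    eapply Rle_trans; [|apply HK']. rewrite Rabs_R0, S_INR, Rabs_pos_eq by (generalize (pos_INR N); lra).
    generalize (pos_INR N). nra. }
assert (E : (B - Sg = (A - Sg) + - (PI * Ci) / tau)%C).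
{ apply (Clim_unique (fun N => Csum cT N - Csum cc N)%C). now apply Clim_sub.
  apply Clim_ext with (fun N => (A - Sg) + V N)%C. auto. apply Clim_add; auto using Clim_const. }
assert (E' : (B = A - PI * Ci / tau)%C).
{ replace B with (B - Sg + Sg)%C by ring. rewrite E. unfold Cdiv. ring. }
unfold A, B in E'. unfold Cdiv in *.
transitivity (/ tau ^ 2 * - (4 * PI ^ 2) * L' - PI ^ 2 * / 6)%C. ring. rewrite E'. ring.
Qed.

(** * Complex derivatives and the logarithmic derivative of eta *)

(** Written with the remainder instead of a quotient, so that [h = 0] needs no exclusion and
    explicit estimates apply directly. *)
Definition Cderiv (f : C -> C) (z l : C) : Prop :=
  forall eps, 0 < eps -> exists del, 0 < del /\
    forall h, Cmod h < del -> Cmod (f (z + h)%C - f z - l * h) <= eps * Cmod h.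

Lemma Cderiv_quadratic f z l K del : 0 < del ->
  (forall h, Cmod h < del -> Cmod (f (z + h)%C - f z - l * h) <= K * Cmod h ^ 2) -> Cderiv f z l.
Proof.
intros Hd H eps He. pose proof (Rabs_pos K).
exists (Rmin del (eps / (Rabs K + 1))). split.
{ apply Rmin_glb_lt; auto. apply Rdiv_lt_0_compat; lra. }
intros h Hh. pose proof (Rmin_l del (eps / (Rabs K + 1))). pose proof (Rmin_r del (eps / (Rabs K + 1))).
pose proof (Cmod_ge_0 h).
eapply Rle_trans; [apply H; lra|]. 
assert (Cmod h * (Rabs K + 1) <= eps) by (apply Rle_div_r; lra).
assert (K * Cmod h <= Cmod h * (Rabs K + 1)). { generalize (Rle_abs K). nra. }
replace (K * Cmod h ^ 2) with (K * Cmod h * Cmod h) by ring. apply Rmult_le_compat_r; lra.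
Qed.

Lemma Cderiv_eq_l f z l l' : l = l' -> Cderiv f z l -> Cderiv f z l'.
Proof. now intros ->. Qed.

Lemma Cderiv_const c z : Cderiv (fun _ => c) z 0.
Proof.
intros eps He. exists 1. split. lra. intros h _. replace (c - c - 0 * h)%C with (RtoC 0) by ring.
rewrite Cmod_0. generalize (Cmod_ge_0 h). nra.
Qed.

Lemma Cderiv_id z : Cderiv (fun x => x) z 1.
Proof.
intros eps He. exists 1. split. lra. intros h _. replace (z + h - z - 1 * h)%C with (RtoC 0) by ring.
rewrite Cmod_0. generalize (Cmod_ge_0 h). nra.
Qed.

Lemma Cderiv_lipschitz f z l : Cderiv f z l -> exists M del, 0 < M /\ 0 < del /\
  forall h, Cmod h < del -> Cmod (f (z + h)%C - f z) <= M * Cmod h.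
Proof.
intros H. destruct (H 1) as [del [Hd Hb]]; [lra|]. exists (1 + Cmod l), del.
pose proof (Cmod_ge_0 l). split; [lra|]. split; auto. intros h Hh. specialize (Hb h Hh).
replace (f (z + h)%C - f z)%C with ((f (z + h)%C - f z - l * h) + l * h)%C by ring.
eapply Rle_trans; [apply Cmod_triangle|]. rewrite Cmod_mult. lra.
Qed.

Lemma Cderiv_comp f g z lf lg : Cderiv g z lg -> Cderiv f (g z) lf -> Cderiv (fun x => f (g x)) z (lf * lg).
Proof.
intros Hg Hf. destruct (Cderiv_lipschitz g z lg Hg) as (M & d0 & HM & Hd0 & HL).
intros eps He. pose proof (Cmod_ge_0 lf).
destruct (Hf (eps / (2 * M))) as [d1 [Hd1 H1]]. { apply Rdiv_lt_0_compat; lra. }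
destruct (Hg (eps / (2 * (Cmod lf + 1)))) as [d2 [Hd2 H2]]. { apply Rdiv_lt_0_compat; lra. }
exists (Rmin (Rmin d0 d2) (d1 / M)). split.
{ repeat apply Rmin_glb_lt; auto. apply Rdiv_lt_0_compat; auto. }
intros h Hh. pose proof (Cmod_ge_0 h).
pose proof (Rmin_l (Rmin d0 d2) (d1 / M)). pose proof (Rmin_r (Rmin d0 d2) (d1 / M)).
pose proof (Rmin_l d0 d2). pose proof (Rmin_r d0 d2).
specialize (HL h ltac:(lra)). specialize (H2 h ltac:(lra)).
set (k := (g (z + h)%C - g z)%C) in *.
assert (Hk : Cmod k < d1).
{ eapply Rle_lt_trans; [exact HL|]. rewrite Rmult_comm. apply Rlt_div_r; auto. lra. }
specialize (H1 k Hk). replace (g z + k)%C with (g (z + h)%C) in H1 by (unfold k; ring).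
replace (f (g (z + h)%C) - f (g z) - lf * lg * h)%C with ((f (g (z + h)%C) - f (g z) - lf * k) + lf * (k - lg * h))%C by ring.
eapply Rle_trans; [apply Cmod_triangle|]. rewrite Cmod_mult.
assert (eps / (2 * M) * Cmod k <= eps / 2 * Cmod h).
{ replace (eps / 2 * Cmod h) with (eps / (2 * M) * (M * Cmod h)) by (field; lra).
  apply Rmult_le_compat_l; auto. left. apply Rdiv_lt_0_compat; lra. }
assert (Cmod lf * Cmod (k - lg * h) <= eps / 2 * Cmod h).
{ replace (eps / 2 * Cmod h) with ((Cmod lf + 1) * (eps / (2 * (Cmod lf + 1)) * Cmod h)) by (field; lra).
  apply Rmult_le_compat; auto using Cmod_ge_0. lra. }
lra.
Qed.

Lemma Cderiv_mul f g z lf lg : Cderiv f z lf -> Cderiv g z lg ->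
  Cderiv (fun x => f x * g x)%C z (lf * g z + f z * lg)%C.
Proof.
intros Hf Hg. destruct (Cderiv_lipschitz g z lg Hg) as (M & d0 & HM & Hd0 & HL).
pose proof (Cmod_ge_0 (f z)) as K1. pose proof (Cmod_ge_0 lf) as K2. pose proof (Cmod_ge_0 (g z)) as K3.
intros eps He.
destruct (Hf (eps / (3 * (Cmod (g z) + M)))) as [d1 [Hd1 H1]]. { apply Rdiv_lt_0_compat; lra. }
destruct (Hg (eps / (3 * (Cmod (f z) + 1)))) as [d2 [Hd2 H2]]. { apply Rdiv_lt_0_compat; lra. }
set (d3 := eps / (3 * (Cmod lf + 1) * M)).
assert (Hd3 : 0 < d3) by (apply Rdiv_lt_0_compat; nra).
exists (Rmin (Rmin d0 1) (Rmin (Rmin d1 d2) d3)). split.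
{ repeat apply Rmin_glb_lt; auto. lra. }
intros h Hh. pose proof (Cmod_ge_0 h) as Hh0.
assert (Cmod h < d0 /\ Cmod h < 1 /\ Cmod h < d1 /\ Cmod h < d2 /\ Cmod h < d3) as (h0 & h1 & h2 & h3 & h4).
{ generalize (Rmin_l (Rmin d0 1) (Rmin (Rmin d1 d2) d3)) (Rmin_r (Rmin d0 1) (Rmin (Rmin d1 d2) d3)).
  generalize (Rmin_l d0 1) (Rmin_r d0 1) (Rmin_l (Rmin d1 d2) d3) (Rmin_r (Rmin d1 d2) d3).
  generalize (Rmin_l d1 d2) (Rmin_r d1 d2). intros. repeat split; lra. }
specialize (HL h h0). specialize (H1 h h2). specialize (H2 h h3).
replace (f (z + h)%C * g (z + h)%C - f z * g z - (lf * g z + f z * lg) * h)%C with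
 ((f (z + h)%C - f z - lf * h) * g (z + h)%C + f z * (g (z + h)%C - g z - lg * h) + lf * h * (g (z + h)%C - g z))%C by ring.
eapply Rle_trans; [apply Cmod_triangle|]. eapply Rle_trans; [apply Rplus_le_compat_r, Cmod_triangle|].
rewrite !Cmod_mult.
assert (Hg1 : Cmod (g (z + h)%C) <= Cmod (g z) + M).
{ generalize (Cmod_triangle_sub (g (z + h)%C) (g z)). nra. }
assert (Cmod (f (z + h)%C - f z - lf * h) * Cmod (g (z + h)%C) <= eps / 3 * Cmod h).
{ replace (eps / 3 * Cmod h) with (eps / (3 * (Cmod (g z) + M)) * Cmod h * (Cmod (g z) + M)) by (field; lra).
  apply Rmult_le_compat; auto using Cmod_ge_0. }
assert (Cmod (f z) * Cmod (g (z + h)%C - g z - lg * h) <= eps / 3 * Cmod h).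
{ replace (eps / 3 * Cmod h) with ((Cmod (f z) + 1) * (eps / (3 * (Cmod (f z) + 1)) * Cmod h)) by (field; lra).
  apply Rmult_le_compat; auto using Cmod_ge_0. lra. }
assert (Cmod lf * Cmod h * Cmod (g (z + h)%C - g z) <= eps / 3 * Cmod h).
{ apply Rle_trans with ((Cmod lf + 1) * d3 * (M * Cmod h)).
  - apply Rmult_le_compat; auto using Cmod_ge_0. apply Rmult_le_pos; auto. apply Rmult_le_compat; lra.
  - unfold d3. right. field. lra. }
lra.
Qed.

Lemma Cderiv_plus f g z lf lg : Cderiv f z lf -> Cderiv g z lg -> Cderiv (fun x => f x + g x)%C z (lf + lg).
Proof.
intros Hf Hg eps He. destruct (Hf (eps / 2)) as [d1 [Hd1 H1]]; [lra|].
destruct (Hg (eps / 2)) as [d2 [Hd2 H2]]; [lra|].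
exists (Rmin d1 d2). split. now apply Rmin_glb_lt. intros h Hh.
generalize (Rmin_l d1 d2) (Rmin_r d1 d2). intros. specialize (H1 h ltac:(lra)). specialize (H2 h ltac:(lra)).
replace (f (z + h)%C + g (z + h)%C - (f z + g z) - (lf + lg) * h)%C with
  ((f (z + h)%C - f z - lf * h) + (g (z + h)%C - g z - lg * h))%C by ring.
eapply Rle_trans; [apply Cmod_triangle|]. lra.
Qed.

Lemma Cderiv_scal c f z l : Cderiv f z l -> Cderiv (fun x => c * f x)%C z (c * l).
Proof.
intros H. apply Cderiv_eq_l with (0 * f z + c * l)%C. ring.
apply (Cderiv_mul (fun _ => c)); auto using Cderiv_const.
Qed.

Lemma Cderiv_Cinv (z : C) : z <> 0 -> Cderiv Cinv z (- / z ^ 2)%C.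
Proof.
intros Hz. pose proof (proj1 (Cmod_gt_0 z) Hz) as Hz'.
apply Cderiv_quadratic with (K := 2 / Cmod z ^ 3) (del := Cmod z / 2). lra.
intros h Hh. assert (Hl : Cmod z / 2 <= Cmod (z + h)).
{ replace (z + h)%C with (z - - h)%C by ring. generalize (Cmod_triangle_sub z (- h)). rewrite Cmod_opp. lra. }
assert (Hzh : (z + h)%C <> 0) by (apply Cmod_gt_0; lra).
replace (/ (z + h) - / z - - / z ^ 2 * h)%C with (h ^ 2 * / (z ^ 2 * (z + h)))%C by (field; auto).
rewrite Cmod_mult, Cmod_inv by (apply Cmult_neq_0; auto; now apply Cpow_nz).
rewrite Cmod_mult, !Cmod_pow, Rmult_comm. apply Rmult_le_compat_r. apply pow2_ge_0.
replace (2 / Cmod z ^ 3) with (/ (Cmod z ^ 2 * (Cmod z / 2))) by (field; lra).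
assert (0 < Cmod z ^ 2) by (apply pow_lt; auto).
apply Rinv_le_contravar. apply Rmult_lt_0_compat; lra. apply Rmult_le_compat_l; lra.
Qed.

Lemma Cderiv_Cexp z : Cderiv Cexp z (Cexp z).
Proof.
apply Cderiv_quadratic with (K := Cmod (Cexp z) * 3) (del := 1 / 2). lra.
intros h Hh. rewrite Cexp_add.
replace (Cexp z * Cexp h - Cexp z - Cexp z * h)%C with (Cexp z * (Cexp h - 1 - h))%C by ring.
rewrite Cmod_mult, Rmult_assoc. apply Rmult_le_compat_l. apply Cmod_ge_0. apply Cexp_taylor_small. lra.
Qed.

Lemma summable_sq_geom r : 0 <= r < 1 -> summable (fun k => INR (S k) ^ 2 * r ^ k).
Proof.
(* [th] is the arithmetic mean of [r], 1, 1, hence [r <= th^3]. Two of the factors [th^k] absorb the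
   square of [k + 1], the third is summed as a geometric series. *)
intros Hr. set (th := (r + 2) / 3). assert (Hth : 2 / 3 <= th < 1) by (unfold th; lra).
assert (H3 : r <= th ^ 3).
{ unfold th. assert (((r + 2) / 3) ^ 3 - r = (r - 1) ^ 2 * (r + 8) / 27) by field. generalize (pow2_ge_0 (r - 1)). nra. }
assert (Hlin : forall k, INR (S k) * th ^ k <= / (1 - th)).
{ intros k. apply Rle_trans with (Rsum (fun j => th ^ j) (S k)).
  - induction k. simpl. lra. change (INR (S (S k)) * th ^ S k <= Rsum (fun j => th ^ j) (S k) + th ^ S k).
    rewrite S_INR. replace (th ^ S k) with (th * th ^ k) by reflexivity.
    assert (0 <= th ^ k) by (apply pow_le; lra). assert (0 <= INR (S k)) by apply pos_INR.
    assert (th * (INR (S k) * th ^ k) <= 1 * (INR (S k) * th ^ k)) by (apply Rmult_le_compat_r; nra). nra.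
  - assert (Rsum (fun j => th ^ j) (S k) = (1 - th ^ S k) * / (1 - th)) as ->.
    { generalize (S k). clear - Hth. intros n. induction n; simpl. field; lra. rewrite IHn. field. lra. }
    assert (0 < / (1 - th)) by (apply Rinv_0_lt_compat; lra). assert (0 <= th ^ S k) by (apply pow_le; lra). nra. }
apply summable_le with (fun k => / (1 - th) ^ 2 * th ^ k).
- intros k. assert (0 <= th ^ k) by (apply pow_le; lra). assert (0 <= r ^ k) by (apply pow_le; lra).
  split. apply Rmult_le_pos; auto. apply pow2_ge_0.
  apply Rle_trans with (INR (S k) ^ 2 * (th ^ 3) ^ k).
  apply Rmult_le_compat_l. apply pow2_ge_0. apply pow_incr. lra.
  rewrite <- pow_mult, Nat.mul_comm, pow_mult.
  replace (INR (S k) ^ 2 * (th ^ k) ^ 3) with ((INR (S k) * th ^ k) ^ 2 * th ^ k) by ring.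
  apply Rmult_le_compat_r; auto. rewrite <- pow_inv. apply pow_incr. split; auto.
  apply Rmult_le_pos; auto. apply pos_INR.
- apply summable_scal. rewrite <- pow_inv. apply pow2_ge_0. apply summable_geom. lra.
Qed.

Lemma Cmod_one_sub_ge q n : Cmod q < 1 -> 1 - Cmod q <= Cmod (1 - q ^ S n).
Proof.
intros Hq. generalize (Cmod_triangle_sub 1 (q ^ S n)). rewrite Cmod_1, Cmod_pow. simpl.
pose proof (Cmod_ge_0 q). assert (Cmod q ^ n <= 1). { rewrite <- (pow1 n). apply pow_incr. lra. }
assert (0 <= Cmod q ^ n) by now apply pow_le. nra.
Qed.

Definition euler_q (tau : C) : C := qpoch (qq tau) (qq tau).

(** The quotient of the products at [tau + h] and at [tau] is itself a product of factors
    [1 + u h k], where [u h k] is [lam k * h] up to second order. [Cprod_sub_1_sub_Csum_le] then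
    gives the derivative with neither a complex logarithm nor uniform convergence of holomorphic
    functions. *)
Lemma Cderiv_euler_q tau S1 : 0 < Im tau ->
  Cser (fun k => INR (S k) * qq tau ^ S k / (1 - qq tau ^ S k))%C S1 ->
  Cderiv euler_q tau (euler_q tau * (- (2 * PI * Ci) * S1))%C.
Proof.
intros Ht HS1. pose proof (Cmod_qq_lt_1 tau Ht) as Hq. set (q := qq tau) in *. set (r := Cmod q) in *.
assert (Hr0 : 0 < r) by (apply Cmod_gt_0, qq_neq_0).
(* Room for the increment: when [s = 2 * PI * Cmod h] is at most [s0], the nome grows at most by the
   factor [exp s], and [r * exp s <= rho < 1]. *)
set (rho := (1 + r) / 2). assert (Hrho : r < rho < 1) by (unfold rho; lra).
set (s0 := Rmin (ln (rho / r)) 1).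
assert (Hln : 0 < ln (rho / r)). { rewrite <- ln_1. apply ln_increasing; [lra|]. apply Rlt_div_r; lra. }
assert (Hs0 : 0 < s0) by (apply Rmin_glb_lt; lra).
destruct (summable_sq_geom rho) as [Hg0 [G HG]]; [lra|].
assert (HG0 : 0 <= G) by exact (HG 0%nat).
(* [13] is the 12 of [Cexp_taylor] plus 1 for the linear term; [/ (1 - r)] bounds the denominators
   [1 - q^k]. *)
set (cst := 13 * / (1 - r)). assert (Hc : 0 < cst).
{ unfold cst. apply Rmult_lt_0_compat; [lra|]. apply Rinv_0_lt_compat; lra. }
set (lam := fun k => (- (2 * PI * Ci) * (INR (S k) * q ^ S k / (1 - q ^ S k)))%C).
assert (Hlam : Cser lam (- (2 * PI * Ci) * S1)%C) by now apply Cser_scal.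
set (P := euler_q tau). assert (HP : P <> 0) by (apply qpoch_neq_0_lt; auto).
set (u := fun (h : C) k => (- q ^ S k * (qq (INR (S k) * h) - 1) / (1 - q ^ S k))%C).
assert (Hmain : forall h, 2 * PI * Cmod h <= s0 ->
  let s := 2 * PI * Cmod h in
  (forall k, Cmod (u h k) <= s * (cst * (INR (S k) ^ 2 * rho ^ k))) /\
  (forall k, Cmod (u h k - lam k * h) <= s ^ 2 * (cst * (INR (S k) ^ 2 * rho ^ k)))).
{ intros h Hh s. fold s in Hh.
  assert (Hs : 0 <= s). { unfold s. generalize PI_RGT_0 (Cmod_ge_0 h). intros. apply Rmult_le_pos; lra. }
  assert (Hs1 : s <= 1) by (generalize (Rmin_r (ln (rho / r)) 1); fold s0; lra).
  assert (Hrs : r * exp s <= rho).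
  { apply Rle_trans with (r * exp (ln (rho / r))).
    - apply Rmult_le_compat_l; [lra|]. apply exp_le_exp. generalize (Rmin_l (ln (rho / r)) 1); fold s0; lra.
    - rewrite exp_ln by (apply Rdiv_lt_0_compat; lra). right. field. lra. }
  assert (Hkey : forall k, r ^ S k * exp (INR (S k) * s) <= rho ^ k).
  { intros k. apply Rle_trans with (rho ^ S k).
    - replace (exp (INR (S k) * s)) with (exp s ^ S k).
      rewrite <- Rpow_mult_distr. apply pow_incr. split; auto. generalize (exp_pos s). nra.
      generalize (S k). intros n. induction n. simpl. now rewrite Rmult_0_l, exp_0.
      rewrite S_INR, Rmult_plus_distr_r, exp_plus, <- IHn, Rmult_1_l. simpl. ring.
    - simpl. assert (0 <= rho ^ k) by (apply pow_le; lra). nra. }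
  assert (Htay : forall k, Cmod (qq (INR (S k) * h) - 1 - 2 * PI * Ci * (INR (S k) * h)) <=
     12 * (INR (S k) * s) ^ 2 * exp (INR (S k) * s)).
  { intros k. set (x := (RtoC (2 * PI) * (Ci * (INR (S k) * h)))%C).
    assert (Cmod x = INR (S k) * s) as Hx.
    { unfold x, s. rewrite !Cmod_mult, Cmod_Ci, !Cmod_R, !Rabs_pos_eq. ring. apply pos_INR.
      generalize PI_RGT_0; lra. }
    rewrite <- Hx. replace (2 * PI * Ci * (INR (S k) * h))%C with x by (unfold x; rewrite RtoC_mult; ring).
    apply Cexp_taylor. }
  assert (Hdiv : forall k (x : C) y, Cmod x <= 13 * (INR (S k) ^ 2 * y) * exp (INR (S k) * s) -> 0 <= y ->
    Cmod (- q ^ S k * x / (1 - q ^ S k)) <= y * (cst * (INR (S k) ^ 2 * rho ^ k))).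
  { intros k x y Hx Hy. pose proof (Cmod_one_sub_ge q k Hq) as Hl. fold r in Hl.
    rewrite Cmod_div by (apply Cmod_gt_0; lra). rewrite Cmod_mult, Cmod_opp, Cmod_pow. fold r.
    unfold Rdiv.
    assert (0 <= r ^ S k) by (apply pow_le; lra).
    apply Rle_trans with (r ^ S k * (13 * (INR (S k) ^ 2 * y) * exp (INR (S k) * s)) * / (1 - r)).
    - apply Rmult_le_compat. apply Rmult_le_pos; auto using Cmod_ge_0.
      left; apply Rinv_0_lt_compat; lra.
      apply Rmult_le_compat_l; auto. apply Rinv_le_contravar; lra.
    - replace (r ^ S k * (13 * (INR (S k) ^ 2 * y) * exp (INR (S k) * s)) * / (1 - r)) with
       (cst * INR (S k) ^ 2 * y * (r ^ S k * exp (INR (S k) * s))) by (unfold cst; ring).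
      replace (y * (cst * (INR (S k) ^ 2 * rho ^ k))) with (cst * INR (S k) ^ 2 * y * rho ^ k) by ring.
      apply Rmult_le_compat_l; auto. apply Rmult_le_pos; auto. apply Rmult_le_pos. lra. apply pow2_ge_0. }
  assert (He1 : forall k, 1 <= exp (INR (S k) * s)).
  { intros k. rewrite <- exp_0. apply exp_le_exp. apply Rmult_le_pos; auto. apply pos_INR. }
  assert (HS : forall k, 1 <= INR (S k)) by (intros k; rewrite S_INR; generalize (pos_INR k); lra).
  split; intros k; specialize (Htay k); specialize (He1 k); specialize (HS k).
  - unfold u. apply Hdiv; auto.
    replace (qq (INR (S k) * h) - 1)%C with
      ((qq (INR (S k) * h) - 1 - 2 * PI * Ci * (INR (S k) * h)) + 2 * PI * Ci * (INR (S k) * h))%C by ring.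
    eapply Rle_trans; [apply Cmod_triangle|].
    replace (Cmod (2 * PI * Ci * (INR (S k) * h))) with (INR (S k) * s).
    2: { unfold s. rewrite !Cmod_mult, Cmod_Ci, !Cmod_R, !Rabs_pos_eq. ring. apply pos_INR.
         generalize PI_RGT_0; lra. lra. }
    set (n := INR (S k)) in *. set (e := exp (n * s)) in *.
    assert (12 * (n * s) ^ 2 * e <= 12 * (n ^ 2 * s) * e).
    { apply Rmult_le_compat_r; [lra|]. assert (0 <= n ^ 2 * s) by (apply Rmult_le_pos; [apply pow2_ge_0|auto]). nra. }
    assert (n * s <= n ^ 2 * s * e).
    { assert (0 <= n * s) by (apply Rmult_le_pos; lra).
      assert (0 <= (n - 1) * (n * s)) by (apply Rmult_le_pos; lra).
      assert (0 <= n ^ 2 * s * (e - 1)).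
      { apply Rmult_le_pos; [|lra]. apply Rmult_le_pos; auto. apply pow2_ge_0. }
      nra. }
    lra.
  - replace (u h k - lam k * h)%C with
     (- q ^ S k * (qq (INR (S k) * h) - 1 - 2 * PI * Ci * (INR (S k) * h)) / (1 - q ^ S k))%C
     by (unfold u, lam, Cdiv; ring).
    apply Hdiv. eapply Rle_trans; [apply Htay|].
    set (n := INR (S k)) in *. set (e := exp (n * s)) in *.
    rewrite Rpow_mult_distr. assert (0 <= n ^ 2 * s ^ 2) by (apply Rmult_le_pos; apply pow2_ge_0). nra.
    apply pow2_ge_0. }
(* With [2 * PI <= 8], the first bound gives [s <= s0] and the second gives [s * cst * G <= 1 / 2],
   the range of [exp_sub_1_sub_le]. *)
set (del := Rmin (s0 / 8) (/ (16 * (cst * G + 1)))).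
assert (HcG : 0 <= cst * G) by (apply Rmult_le_pos; lra).
assert (Hdel : 0 < del). { apply Rmin_glb_lt; [lra|]. apply Rinv_0_lt_compat; lra. }
apply Cderiv_quadratic with (del := del) (K := Cmod P * (64 * (2 * (cst * G) ^ 2 + cst * G))); auto.
intros h Hh. pose proof (Cmod_ge_0 h) as Hh0.
assert (Hd1 : Cmod h < s0 / 8) by (generalize (Rmin_l (s0 / 8) (/ (16 * (cst * G + 1)))); fold del; lra).
assert (Hd2 : Cmod h < / (16 * (cst * G + 1))) by (generalize (Rmin_r (s0 / 8) (/ (16 * (cst * G + 1)))); fold del; lra).
assert (Hs8 : 2 * PI * Cmod h <= 8 * Cmod h) by (generalize PI_4; nra).
destruct (Hmain h ltac:(lra)) as [Hu Hul]. clear Hmain. cbv zeta in Hu, Hul.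
set (s := 2 * PI * Cmod h) in *.
assert (Hs : 0 <= s). { unfold s. generalize PI_RGT_0. intros. apply Rmult_le_pos; lra. }
assert (Hsum : forall n, Rsum (fun k => cst * (INR (S k) ^ 2 * rho ^ k)) n <= cst * G).
{ intros n. rewrite Rsum_scal. apply Rmult_le_compat_l; [lra|]. apply HG. }
assert (Hratio : Clim (fun n => Cprod (fun k => 1 + u h k)%C n) (euler_q (tau + h)%C / P)%C).
{ apply Clim_ext with (fun n => qpoch_part (qq (tau + h)) (qq (tau + h)) n * / qpoch_part q q n)%C.
  - intros n. induction n; [simpl; field; exact C1_nz|]. cbn [qpoch_part Cprod]. rewrite <- IHn.
    rewrite <- !Cpow_S, Cinv_mul. unfold u. rewrite qq_scal, qq_add. fold q. rewrite Cpow_mult_l.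
    assert (1 - q ^ S n <> 0)%C by (apply one_sub_neq_0, Cmod_pow_lt_1; auto; lia).
    pose proof (qpoch_part_neq_0 q n Hq). field. auto.
  - apply Clim_mul.
    + apply qpoch_lim. rewrite qq_add, Cmod_mult. fold q r.
      apply Rle_lt_trans with (r * exp s). apply Rmult_le_compat_l; [lra|].
      unfold qq. eapply Rle_trans; [apply Cmod_Cexp_le|]. apply exp_le_exp.
      rewrite !Cmod_mult, Cmod_Ci, Cmod_R, Rabs_pos_eq by (generalize PI_RGT_0; lra). unfold s; lra.
      apply Rle_lt_trans with rho; [|lra].
      apply Rle_trans with (r * exp (ln (rho / r))).
      * apply Rmult_le_compat_l; [lra|]. apply exp_le_exp. generalize (Rmin_l (ln (rho / r)) 1); fold s0; lra.
      * rewrite exp_ln by (apply Rdiv_lt_0_compat; lra). right. field. lra.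
    + apply Clim_inv; auto. now apply qpoch_lim. }
assert (Hbound : forall n, Cmod (Cprod (fun k => 1 + u h k)%C n - 1 - Csum (fun k => lam k * h)%C n) <=
   2 * (s * (cst * G)) ^ 2 + s ^ 2 * (cst * G)).
{ intros n.
  replace (Cprod (fun k => 1 + u h k)%C n - 1 - Csum (fun k => lam k * h)%C n)%C with
   ((Cprod (fun k => 1 + u h k)%C n - 1 - Csum (u h) n) + Csum (fun k => u h k - lam k * h)%C n)%C
   by (rewrite Csum_sub; ring).
  eapply Rle_trans; [apply Cmod_triangle|]. apply Rplus_le_compat.
  - eapply Rle_trans; [apply (Cprod_sub_1_sub_Csum_le (u h) _ n Hu)|].
    set (X := Rsum _ n).
    assert (HX : 0 <= X <= s * (cst * G)).
    { unfold X. rewrite Rsum_scal. split.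
      apply Rmult_le_pos; auto. apply Rsum_nonneg. intros k. apply Rmult_le_pos; [lra|]. apply Hg0.
      apply Rmult_le_compat_l; auto. }
    assert (s * (cst * G) <= 1 / 2).
    { apply Rle_trans with (8 * / (16 * (cst * G + 1)) * (cst * G)).
      apply Rmult_le_compat_r; lra. apply Rmult_le_reg_r with (16 * (cst * G + 1)). lra.
      field_simplify; lra. }
    eapply Rle_trans; [apply Rle_abs|]. eapply Rle_trans; [apply exp_sub_1_sub_le; rewrite Rabs_pos_eq; lra|].
    apply Rmult_le_compat_l; [lra|]. apply pow_incr. lra.
  - eapply Rle_trans; [apply (Cmod_Csum_le _ _ n Hul)|]. rewrite Rsum_scal.
    apply Rmult_le_compat_l; auto. apply pow2_ge_0. }
assert (Hlin : Cmod (euler_q (tau + h)%C / P - 1 - (- (2 * PI * Ci) * S1) * h) <=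
   2 * (s * (cst * G)) ^ 2 + s ^ 2 * (cst * G)).
{ replace ((- (2 * PI * Ci) * S1) * h)%C with (h * (- (2 * PI * Ci) * S1))%C by ring.
  refine (Clim_le_Cmod _ _ _ Hbound _). apply Clim_sub. apply Clim_sub; auto using Clim_const.
  apply (Cser_ext (fun k => h * lam k)%C). intros; ring. now apply Cser_scal. }
match goal with |- Cmod ?X <= _ => replace X with
  (P * (euler_q (tau + h)%C / P - 1 - (- (2 * PI * Ci) * S1) * h))%C by (unfold P in *; field; auto) end.
rewrite Cmod_mult, (Rmult_assoc (Cmod P)). apply Rmult_le_compat_l. apply Cmod_ge_0.
eapply Rle_trans; [exact Hlin|].
assert (s ^ 2 <= 64 * Cmod h ^ 2).
{ replace (64 * Cmod h ^ 2) with ((8 * Cmod h) ^ 2) by ring. apply pow_incr. lra. }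
replace (2 * (s * (cst * G)) ^ 2 + s ^ 2 * (cst * G)) with ((2 * (cst * G) ^ 2 + cst * G) * s ^ 2) by ring.
replace (64 * (2 * (cst * G) ^ 2 + cst * G) * Cmod h ^ 2) with ((2 * (cst * G) ^ 2 + cst * G) * (64 * Cmod h ^ 2)) by ring.
apply Rmult_le_compat_l; auto. generalize (pow2_ge_0 (cst * G)). lra.
Qed.

(** * The transformation of eta^2 under inversion *)

Lemma summable_id_geom r : 0 <= r < 1 -> summable (fun k => INR (S k) * r ^ S k).
Proof.
intros Hr. apply summable_le with (2 := summable_sq_geom r Hr). intros k.
assert (0 <= r ^ k) by (apply pow_le; lra). assert (1 <= INR (S k)) by (rewrite S_INR; generalize (pos_INR k); lra).
simpl (r ^ S k). split. repeat apply Rmult_le_pos; lra.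
replace (INR (S k) ^ 2 * r ^ k) with (INR (S k) * (INR (S k) * r ^ k)) by ring.
apply Rmult_le_compat_l; [lra|]. apply Rmult_le_compat_r; lra.
Qed.

Lemma Cser_id_geom (x : C) : Cmod x < 1 -> Cser (fun i => INR (S i) * x ^ S i)%C (x / (1 - x) ^ 2)%C.
Proof.
intros Hx. pose proof (one_sub_neq_0 x Hx) as Hx1.
destruct (Cser_cv (fun i => INR (S i) * x ^ S i)%C (fun k => INR (S k) * Cmod x ^ S k)) as [s Hs].
- apply summable_id_geom. split; auto using Cmod_ge_0.
- intros k. rewrite Cmod_mult, Cmod_R, Cmod_pow, Rabs_pos_eq by apply pos_INR. lra.
- replace (x / (1 - x) ^ 2)%C with s; auto.
  assert (Hg : Cser (fun i => x * x ^ S i)%C (x * (/ (1 - x) - 1))%C).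
  { apply Cser_scal. apply (Cser_unshift (fun i => x ^ i)%C). now apply Cser_geom. }
  assert (E : s = (x + (x * s + x * (/ (1 - x) - 1)))%C).
  { apply (Cser_unique (fun i => INR (S i) * x ^ S i)%C); auto.
    replace (x + (x * s + x * (/ (1 - x) - 1)))%C with (INR 1 * x ^ 1 + (x * s + x * (/ (1 - x) - 1)))%C
      by (simpl (INR 1); ring).
    apply (Cser_shift (fun i => INR (S i) * x ^ S i)%C).
    eapply Cser_ext; [|apply (Cser_add _ _ _ _ (Cser_scal x _ _ Hs) Hg)].
    intros k. cbv beta. rewrite (S_INR (S k)), RtoC_plus, (Cpow_S x (S k)). ring. }
  assert (E2 : (s * (1 - x) = x + x * (/ (1 - x) - 1))%C).
  { transitivity (s - x * s)%C. ring. rewrite E at 1. ring. }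
  replace s with (s * (1 - x) / (1 - x))%C by (field; auto). rewrite E2. field. auto.
Qed.

(** Both are iterated sums of [m * q^(m n)]. The first form arises from the logarithmic derivative
    of the product, the second from the lattice sum. *)
Lemma lambert_swap q : Cmod q < 1 -> exists L,
  Cser (fun k => INR (S k) * q ^ S k / (1 - q ^ S k))%C L /\
  Cser (fun i => q ^ S i / (1 - q ^ S i) ^ 2)%C L.
Proof.
intros Hq. set (r := Cmod q) in *. assert (Hr : 0 <= r < 1) by (split; auto; apply Cmod_ge_0).
destruct (summable_geom r Hr) as [Hg0 [G HG]].
assert (HG0 : 0 <= G) by exact (HG 0%nat).
destruct (fubini (fun i j => INR (S i) * (q ^ S i) ^ S j)%C (fun i j => INR (S i) * r ^ S i * r ^ j)
  (fun i => G * (INR (S i) * r ^ S i))) as (rr & cc & L & Hr1 & Hc1 & HrL & HcL & _).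
- apply summable_scal; auto. now apply summable_id_geom.
- intros i j. rewrite Cmod_mult, Cmod_R, !Cmod_pow, Rabs_pos_eq by apply pos_INR. fold r.
  rewrite Rmult_assoc. apply Rmult_le_compat_l. apply pos_INR. simpl ((r ^ S i) ^ S j).
  assert (0 <= r ^ S i) by (apply pow_le; lra). apply Rmult_le_compat_l; auto.
  apply pow_incr. split; auto. simpl.
  assert (r ^ i <= 1) by (rewrite <- (pow1 i); apply pow_incr; lra). assert (0 <= r ^ i) by (apply pow_le; lra). nra.
- intros i n. rewrite Rsum_scal, Rmult_comm. apply Rmult_le_compat_r; auto.
  apply Rmult_le_pos. apply pos_INR. apply pow_le; lra.
- exists L. split.
  + apply Cser_ext with (2 := HrL). intros i. apply (Cser_unique (fun j => INR (S i) * (q ^ S i) ^ S j)%C); auto.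
    assert (Hqi : Cmod (q ^ S i)%C < 1) by (apply Cmod_pow_lt_1; auto; lia).
    replace (INR (S i) * q ^ S i / (1 - q ^ S i))%C with (INR (S i) * (q ^ S i * / (1 - q ^ S i)))%C by (unfold Cdiv; ring).
    apply Cser_scal. apply Cser_ext with (fun j => q ^ S i * (q ^ S i) ^ j)%C. reflexivity.
    apply Cser_scal. now apply Cser_geom.
  + apply Cser_ext with (2 := HcL). intros j. apply (Cser_unique (fun i => INR (S i) * (q ^ S i) ^ S j)%C); auto.
    apply Cser_ext with (fun i => INR (S i) * (q ^ S j) ^ S i)%C.
    { intros i. rewrite <- !Cpow_mult_r. do 2 f_equal. lia. }
    apply Cser_id_geom. apply Cmod_pow_lt_1; auto; lia.
Qed.

Definition eta_sq (tau : C) : C := (eta tau ^ 2)%C.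

Lemma euler_q_neq_0 tau : 0 < Im tau -> euler_q tau <> 0.
Proof. intros H. apply qpoch_neq_0_lt; now apply Cmod_qq_lt_1. Qed.

Lemma eta_neq_0 tau : 0 < Im tau -> eta tau <> 0.
Proof. intros H. apply Cmult_neq_0. apply Cexp_neq_0. now apply euler_q_neq_0. Qed.

Lemma eta_sq_neq_0 tau : 0 < Im tau -> eta_sq tau <> 0.
Proof. intros H. now apply Cpow_nz, eta_neq_0. Qed.

Lemma eta_sq_euler tau : eta_sq tau = (qq (tau / 12) * euler_q tau ^ 2)%C.
Proof.
unfold eta_sq, eta, euler_q. rewrite Cpow_mult_l. f_equal.
rewrite <- Cexp_pow. unfold qq. f_equal. unfold Rdiv. simpl (INR 2).
rewrite RtoC_mult, RtoC_inv by lra. rewrite RtoC_plus. field.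
Qed.

(** The factor is [PI * Ci / 6] times [1 - 24 L], where [1 - 24 L] is the normalized Eisenstein
    series of weight two. *)
Lemma Cderiv_eta_sq tau L : 0 < Im tau ->
  Cser (fun i => qq tau ^ S i / (1 - qq tau ^ S i) ^ 2)%C L ->
  Cderiv eta_sq tau (eta_sq tau * (PI * Ci / 6 - 4 * PI * Ci * L))%C.
Proof.
intros H HL. destruct (lambert_swap (qq tau) (Cmod_qq_lt_1 tau H)) as [L' [H1 H2]].
assert (L' = L) as -> by (eapply Cser_unique; eauto).
pose proof (Cderiv_euler_q tau L H H1) as HP.
set (c := (2 * PI * Ci / 12)%C).
assert (Hf : forall t, eta_sq t = (Cexp (c * t) * (euler_q t * euler_q t))%C).
{ intros t. rewrite eta_sq_euler. f_equal. 2: ring. unfold qq, c. f_equal. rewrite RtoC_mult. field. }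
apply Cderiv_eq_l with (Cexp (c * tau) * (c * 1) * (euler_q tau * euler_q tau) + Cexp (c * tau) *
  (euler_q tau * (- (2 * PI * Ci) * L) * euler_q tau + euler_q tau * (euler_q tau * (- (2 * PI * Ci) * L))))%C.
{ rewrite Hf. unfold c. field. }
intros eps He. 
destruct (Cderiv_mul (fun t => Cexp (c * t)) (fun t => euler_q t * euler_q t)%C tau
  (Cexp (c * tau) * (c * 1))%C (euler_q tau * (- (2 * PI * Ci) * L) * euler_q tau + euler_q tau * (euler_q tau * (- (2 * PI * Ci) * L)))%C)
  with (eps := eps) as [del [Hd Hb]]; auto.
- apply (Cderiv_comp Cexp (fun t => c * t)%C). apply Cderiv_scal, Cderiv_id. apply Cderiv_Cexp.
- now apply Cderiv_mul.
- exists del. split; auto. intros h Hh. rewrite !Hf. now apply Hb.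
Qed.

(** The half-plane is convex, so it suffices to move along a segment. Real and imaginary parts are
    1-Lipschitz, hence have zero real derivative there, and the real theorem applies to each. *)
Lemma constant_on_upper_half_plane f : (forall z, 0 < Im z -> Cderiv f z 0) ->
  forall z w, 0 < Im z -> 0 < Im w -> f z = f w.
Proof.
intros Hf z w Hz Hw. set (gam := fun s : R => (z + s * (w - z))%C).
assert (Hg : forall s, 0 <= s <= 1 -> 0 < Im (gam s)).
{ intros s Hs. replace (Im (gam s)) with ((1 - s) * Im z + s * Im w).
  2: { unfold gam. destruct z, w. simpl. ring. }
  destruct (Req_dec s 0) as [->|]. lra. nra. }
assert (Hcomp : forall (pi : C -> R), (forall a b, Rabs (pi a - pi b) <= Cmod (a - b)) ->
   pi (f z) = pi (f w)).
{ intros pi Hpi. replace (f z) with (f (gam 0)) by (unfold gam; f_equal; ring).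
  replace (f w) with (f (gam 1)) by (unfold gam; f_equal; ring).
  apply (eq_is_derive (fun s => pi (f (gam s)))); [|lra].
  intros t Ht. apply is_derive_Reals. intros eps He. pose proof (Cmod_ge_0 (w - z)) as Hwz.
  destruct (Hf (gam t) (Hg t Ht) (eps / (2 * (Cmod (w - z) + 1)))) as [del [Hd Hb]].
  { apply Rdiv_lt_0_compat; lra. }
  assert (Hd' : 0 < del / (Cmod (w - z) + 1)) by (apply Rdiv_lt_0_compat; lra).
  exists (mkposreal _ Hd'). intros h Hh0 Hh. simpl in Hh.
  replace (@zero R_NormedModule) with 0 by reflexivity. rewrite Rminus_0_r.
  unfold Rdiv at 1. rewrite Rabs_mult, Rabs_inv.
  assert (Hah : 0 < Rabs h) by now apply Rabs_pos_lt.
  apply Rlt_div_l; auto.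
  assert (E : gam (t + h) = (gam t + h * (w - z))%C) by (unfold gam; rewrite RtoC_plus; ring).
  eapply Rle_lt_trans; [apply Hpi|]. rewrite E.
  assert (Hm : Cmod (h * (w - z)) = Rabs h * Cmod (w - z)) by now rewrite Cmod_mult, Cmod_R.
  specialize (Hb (h * (w - z))%C). rewrite Hm in Hb.
  apply Rlt_div_r in Hh; [|lra].
  specialize (Hb ltac:(nra)).
  replace (f (gam t + h * (w - z))%C - f (gam t) - 0 * (h * (w - z)))%C with (f (gam t + h * (w - z))%C - f (gam t))%C in Hb by ring.
  eapply Rle_lt_trans; [exact Hb|].
  apply Rle_lt_trans with (eps / 2 * Rabs h); [|nra].
  replace (eps / 2 * Rabs h) with (eps / (2 * (Cmod (w - z) + 1)) * (Rabs h * (Cmod (w - z) + 1))) by (field; lra).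
  apply Rmult_le_compat_l. left; apply Rdiv_lt_0_compat; lra. apply Rmult_le_compat_l; lra. }
assert (HR := Hcomp Re). assert (HI := Hcomp Im).
rewrite (surjective_pairing (f z)), (surjective_pairing (f w)). f_equal.
- apply HR. intros a b. replace (Re a - Re b) with (Re (a - b)) by reflexivity. apply Rabs_Re_le.
- apply HI. intros a b. replace (Im a - Im b) with (Im (a - b)) by reflexivity. apply Rabs_Im_le.
Qed.

Theorem eta_sq_inversion tau : 0 < Im tau -> eta_sq (- / tau) = (- Ci * tau * eta_sq tau)%C.
Proof.
intros Ht.
set (D := fun t => (eta_sq (- / t) * / (t * eta_sq t))%C).
assert (HD : forall t, 0 < Im t -> Cderiv D t 0).
{ intros t H. pose proof (Im_opp_inv t H) as H'. pose proof (Im_pos_neq_0 t H) as Ht0.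
  destruct (lambert_swap _ (Cmod_qq_lt_1 t H)) as [L [_ HL]].
  destruct (lambert_swap _ (Cmod_qq_lt_1 _ H')) as [L' [_ HL']].
  pose proof (lambert_transform t L L' H HL HL') as E.
  pose proof (Cderiv_eta_sq t L H HL) as D1. pose proof (Cderiv_eta_sq _ L' H' HL') as D2.
  set (a := eta_sq t) in *. set (b := eta_sq (- / t)) in *.
  assert (Ha : a <> 0) by now apply eta_sq_neq_0.
  set (l := (PI * Ci / 6 - 4 * PI * Ci * L)%C) in *. set (l' := (PI * Ci / 6 - 4 * PI * Ci * L')%C) in *.
  apply Cderiv_eq_l with (b * l' * (- (1) * (- / t ^ 2)) * / (t * a) +
     b * (- / (t * a) ^ 2 * (1 * a + t * (a * l))))%C.
  - transitivity (b / (t * a) * (l' / t ^ 2 - / t - l))%C. field. auto.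
    replace (l' / t ^ 2 - / t - l)%C with (RtoC 0). ring.
    assert (HCi : (Ci * Ci = - (1))%C) by (unfold Ci, Cmult, Copp, RtoC; simpl; f_equal; ring).
    pose proof CPI_neq_0 as HP.
    (* Scaled by [Ci / PI], [lambert_transform] relates the two logarithmic derivatives; its last
       term contributes [Ci * Ci / t = - / t], which accounts for the factor [t] in [D]. *)
    transitivity (Ci / PI * ((- (4 * PI ^ 2) * L' / t ^ 2 - PI ^ 2 / 6) - (- (4 * PI ^ 2) * L - PI ^ 2 / 6 / t ^ 2 - PI * Ci / t)))%C.
    + rewrite E. ring.
    + transitivity (l' / t ^ 2 + (Ci * Ci) / t - l)%C. unfold l, l'. field. auto.
      rewrite HCi. field. auto.
  - apply (Cderiv_mul (fun t => eta_sq (- / t)) (fun t => / (t * eta_sq t))%C).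
    + apply (Cderiv_comp eta_sq (fun t => - / t)%C); auto.
      intros eps He. destruct (Cderiv_scal (- (1))%C Cinv t _ (Cderiv_Cinv t Ht0) eps He) as [del [Hd Hb]].
      exists del. split; auto. intros h Hh. specialize (Hb h Hh).
      match goal with |- Cmod ?X <= _ => replace X with (- (1) * / (t + h) - - (1) * / t - - (1) * - / t ^ 2 * h)%C by ring end. auto.
    + apply (Cderiv_comp Cinv (fun t => t * eta_sq t)%C).
      apply Cderiv_mul; auto using Cderiv_id. apply Cderiv_Cinv. now apply Cmult_neq_0. }
assert (Hi : 0 < Im Ci) by (simpl; lra).
pose proof (constant_on_upper_half_plane D HD tau Ci Ht Hi) as E.
unfold D in E. replace (- / Ci)%C with Ci in E by (rewrite Ci_inv; ring).
pose proof (eta_sq_neq_0 tau Ht). pose proof (eta_sq_neq_0 Ci Hi). pose proof (Im_pos_neq_0 tau Ht).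
pose proof Ci_neq_0.
replace (eta_sq (- / tau)) with (eta_sq (- / tau) * / (tau * eta_sq tau) * (tau * eta_sq tau))%C by (field; auto).
rewrite E. rewrite Cinv_mul, Ci_inv. field. auto.
Qed.

Lemma qq_quarter : qq (RtoC (1 / 4)) = Ci.
Proof.
unfold qq, Cexp. simpl.
replace (2 * PI * (0 * (1 / 4) - 1 * 0) - 0 * (0 * 0 + 1 * (1 / 4))) with 0 by field.
replace (2 * PI * (0 * 0 + 1 * (1 / 4)) + 0 * (0 * (1 / 4) - 1 * 0)) with (PI / 2) by field.
rewrite exp_0, cos_PI2, sin_PI2. unfold Ci. f_equal; ring.
Qed.

Lemma eta_sq_translation tau : eta_sq (tau + 1) = (qq (RtoC (1 / 12)) * eta_sq tau)%C.
Proof.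
rewrite !eta_sq_euler. unfold euler_q. rewrite qq_add, qq_1, Cmult_1_r.
replace ((tau + 1) / 12)%C with (RtoC (1 / 12) + tau / 12)%C.
rewrite qq_add. ring. rewrite RtoC_div by lra. field.
Qed.

(** * The multiplier system of eta^2 *)

Definition zeta12 (n : Z) : C := qq (RtoC (IZR n / 12)).

Lemma zeta12_add n m : zeta12 (n + m) = (zeta12 n * zeta12 m)%C.
Proof. unfold zeta12. rewrite <- qq_add, <- RtoC_plus, plus_IZR. do 2 f_equal. field. Qed.

Lemma zeta12_0 : zeta12 0 = 1%C.
Proof. unfold zeta12. replace (0 / 12) with 0 by field. apply qq_0. Qed.

Lemma zeta12_neq_0 n : zeta12 n <> 0.
Proof. apply qq_neq_0. Qed.

Lemma zeta12_opp n : zeta12 (- n) = (/ zeta12 n)%C.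
Proof.
assert (E : (zeta12 (- n) * zeta12 n = 1)%C) by (rewrite <- zeta12_add, Z.add_opp_diag_l; apply zeta12_0).
replace (zeta12 (- n)) with (zeta12 (- n) * zeta12 n * / zeta12 n)%C by (field; apply zeta12_neq_0).
rewrite E. ring.
Qed.

Lemma zeta12_mul_12 k : zeta12 (12 * k) = 1%C.
Proof.
unfold zeta12. rewrite mult_IZR. replace (12 * IZR k / 12) with (IZR k) by field.
destruct (Z_le_gt_dec 0 k) as [h|h].
- rewrite <- (Z2Nat.id k h), <- INR_IZR_INZ. apply qq_INR.
- replace (RtoC (IZR k)) with (- INR (Z.to_nat (- k)))%C.
  rewrite qq_opp, qq_INR. field; exact C1_nz.
  rewrite <- RtoC_opp. f_equal. rewrite INR_IZR_INZ, Z2Nat.id, opp_IZR by lia. ring.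
Qed.

Lemma zeta12_eq n m : ((n - m) mod 12 = 0)%Z -> zeta12 n = zeta12 m.
Proof.
intros H. replace n with (m + 12 * ((n - m) / 12))%Z.
rewrite zeta12_add, zeta12_mul_12. ring. generalize (Z_div_mod_eq_full (n - m) 12). lia.
Qed.

(** Closed form, meaningful modulo 12, of the exponent in the multiplier of [eta^2]. *)
Definition psi (a b c d : Z) : Z :=
  ((1 - c * c) * (b * d + 3 * (c - 1) * d + c + 3) + c * (a + d - 3))%Z.

(** Decides whether [g = 0] implies [f = 0] modulo [N] by running through all residues. The modulus
    12 is split into 3 and 4, that is 81 and 256 quadruples instead of 20736. *)
Definition residues_check (N : nat) (f g : Z -> Z -> Z -> Z -> Z) : bool :=
  let l := map Z.of_nat (seq 0 N) in
  forallb (fun a => forallb (fun b => forallb (fun c => forallb (fun d =>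
    implb (g a b c d mod Z.of_nat N =? 0)%Z (f a b c d mod Z.of_nat N =? 0)%Z) l) l) l) l.

Definition respects (f : Z -> Z -> Z -> Z -> Z) : Prop := forall N a b c d a' b' c' d',
  eqm N a a' -> eqm N b b' -> eqm N c c' -> eqm N d d' -> eqm N (f a b c d) (f a' b' c' d').

Lemma residues_check_correct N f g : respects f -> respects g -> (0 < N)%nat -> residues_check N f g = true ->
  forall a b c d, (g a b c d = 0)%Z -> (f a b c d mod Z.of_nat N = 0)%Z.
Proof.
intros Hf Hg HN H a b c d E.
assert (Hin : forall x, In (x mod Z.of_nat N)%Z (map Z.of_nat (seq 0 N))).
{ intros x. apply in_map_iff. exists (Z.to_nat (x mod Z.of_nat N)).
  pose proof (Z.mod_pos_bound x (Z.of_nat N) ltac:(lia)). split. lia. apply in_seq. lia. }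
unfold residues_check in H. cbv zeta in H.
rewrite forallb_forall in H. specialize (H _ (Hin a)).
rewrite forallb_forall in H. specialize (H _ (Hin b)).
rewrite forallb_forall in H. specialize (H _ (Hin c)).
rewrite forallb_forall in H. specialize (H _ (Hin d)).
assert (M : forall x, eqm (Z.of_nat N) x (x mod Z.of_nat N)).
{ intros x. unfold eqm. now rewrite Zmod_mod. }
pose proof (Hf _ _ _ _ _ _ _ _ _ (M a) (M b) (M c) (M d)) as Ef.
pose proof (Hg _ _ _ _ _ _ _ _ _ (M a) (M b) (M c) (M d)) as Eg.
unfold eqm in Ef, Eg. rewrite E in Eg. rewrite <- Eg, <- Ef, Zmod_0_l in H.
simpl in H. now apply Z.eqb_eq in H.
Qed.

Lemma residues_check_12 f g : respects f -> respects g ->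
  residues_check 3 f g = true -> residues_check 4 f g = true ->
  forall a b c d, (g a b c d = 0)%Z -> (f a b c d mod 12 = 0)%Z.
Proof.
intros Hf Hg H3 H4 a b c d E.
pose proof (residues_check_correct 3 f g Hf Hg ltac:(lia) H3 a b c d E) as M3.
pose proof (residues_check_correct 4 f g Hf Hg ltac:(lia) H4 a b c d E) as M4.
change (Z.of_nat 3) with 3%Z in M3. change (Z.of_nat 4) with 4%Z in M4.
apply Z.mod_divide in M3; [|lia]. apply Z.mod_divide in M4; [|lia].
(* With value [3 x = 4 y], the witness is [x - y] because [12 (x - y) = 4 (3 x) - 3 (4 y)]. *)
destruct M3 as [x Hx]. destruct M4 as [y Hy]. apply Z.mod_divide; [lia|]. exists (x - y)%Z. lia.
Qed.

Ltac solve_respects :=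
  unfold respects, psi; intros;
  repeat first [assumption | reflexivity | apply Zplus_eqm | apply Zminus_eqm | apply Zmult_eqm | apply Zopp_eqm].

(** This and [psi_S] describe left multiplication by the generators. They match the laws of
    [eta_sq]: translation multiplies by a primitive twelfth root of unity, exponent 1, and inversion
    by [- Ci], exponent -3. *)
Lemma psi_T a b c d : (a * d - b * c = 1)%Z -> ((psi (a + c) (b + d) c d - (psi a b c d + 1)) mod 12 = 0)%Z.
Proof.
intros H. apply (residues_check_12 (fun a b c d => psi (a + c) (b + d) c d - (psi a b c d + 1))%Z
  (fun a b c d => a * d - b * c - 1)%Z); try solve_respects; try (vm_compute; reflexivity). lia.
Qed.

Lemma psi_S a b c d : (a * d - b * c = 1)%Z -> ((psi (- c) (- d) a b - (psi a b c d + -3)) mod 12 = 0)%Z.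
Proof.
intros H. apply (residues_check_12 (fun a b c d => psi (- c) (- d) a b - (psi a b c d + -3))%Z
  (fun a b c d => a * d - b * c - 1)%Z); try solve_respects; try (vm_compute; reflexivity). lia.
Qed.

(** The multipliers of the four factors of [g] cancel on [Gamma_0(10)]. *)
Lemma psi_level_10 a b c d : (a * d - b * (10 * c) = 1)%Z ->
  ((psi a (2 * b) (5 * c) d + 2 * psi a (5 * b) (2 * c) d
    - (2 * psi a b (10 * c) d + psi a (10 * b) c d)) mod 12 = 0)%Z.
Proof.
intros H. apply (residues_check_12 (fun a b c d => psi a (2 * b) (5 * c) d + 2 * psi a (5 * b) (2 * c) d
    - (2 * psi a b (10 * c) d + psi a (10 * b) c d))%Z
  (fun a b c d => a * d - b * (10 * c) - 1)%Z); try solve_respects; try (vm_compute; reflexivity). lia.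
Qed.

(** * Automorphy factors and the action of SL_2(Z) *)

Definition auto_factor (c d : Z) (tau : C) : C := (IZR c * tau + IZR d)%C.

Lemma auto_factor_neq_0 a b c d tau : (a * d - b * c = 1)%Z -> 0 < Im tau -> auto_factor c d tau <> 0.
Proof.
intros H Ht E. assert (HI : IZR c * Im tau = 0).
{ transitivity (Im (auto_factor c d tau)). unfold auto_factor. destruct tau; simpl; ring. rewrite E. reflexivity. }
apply Rmult_integral in HI. destruct HI as [HI|HI]; [|lra].
assert (HR : IZR d = 0).
{ transitivity (Re (auto_factor c d tau)). unfold auto_factor. rewrite HI. destruct tau; simpl; ring.
  rewrite E. reflexivity. }
apply eq_IZR in HI. apply eq_IZR in HR. subst. lia.
Qed.

Lemma Im_mobius_pos a b c d tau : (a * d - b * c = 1)%Z -> 0 < Im tau -> 0 < Im (mobius a b c d tau).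
Proof.
intros H Ht. pose proof (auto_factor_neq_0 a b c d tau H Ht) as Hn. apply Cmod_gt_0 in Hn.
assert (HZ : IZR a * IZR d - IZR b * IZR c = 1).
{ rewrite <- !mult_IZR, <- minus_IZR, H. reflexivity. }
assert (Hm : 0 < Cmod (auto_factor c d tau) ^ 2) by now apply pow_lt.
rewrite Cmod2_alt in Hm.
replace (Im (mobius a b c d tau)) with (Im tau / (Re (auto_factor c d tau) ^ 2 + Im (auto_factor c d tau) ^ 2)).
now apply Rdiv_lt_0_compat.
revert Hm. unfold mobius, auto_factor. destruct tau as [x y]. simpl.
rewrite !Rmult_0_l, !Rminus_0_r, !Rplus_0_r, !Rmult_1_r. intros Hm.
transitivity ((IZR a * IZR d - IZR b * IZR c) * y / ((IZR c * x + IZR d) * (IZR c * x + IZR d) + IZR c * y * (IZR c * y))).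
rewrite HZ. field. lra. field. lra.
Qed.

Lemma mobius_T a b c d tau : auto_factor c d tau <> 0 -> mobius (a + c) (b + d) c d tau = (mobius a b c d tau + 1)%C.
Proof. intros H. unfold mobius. fold (auto_factor c d tau). rewrite !plus_IZR, !RtoC_plus.
unfold auto_factor in *. field. auto. Qed.

Lemma mobius_S a b c d tau : auto_factor c d tau <> 0 -> auto_factor a b tau <> 0 ->
  mobius (- c) (- d) a b tau = (- / mobius a b c d tau)%C.
Proof.
intros H H'. unfold mobius, auto_factor in *. rewrite !opp_IZR, !RtoC_opp.
field. auto.
Qed.

Definition eta_sq_rule (a b c d : Z) : Prop := forall tau, 0 < Im tau ->
  eta_sq (mobius a b c d tau) = (zeta12 (psi a b c d) * auto_factor c d tau * eta_sq tau)%C.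

Lemma eta_sq_rule_T a b c d : (a * d - b * c = 1)%Z ->
  eta_sq_rule a b c d <-> eta_sq_rule (a + c) (b + d) c d.
Proof.
intros H. unfold eta_sq_rule.
assert (E : forall tau, 0 < Im tau -> eta_sq (mobius (a + c) (b + d) c d tau) = (zeta12 1 * eta_sq (mobius a b c d tau))%C).
{ intros tau Ht. rewrite mobius_T by (apply (auto_factor_neq_0 a b); auto). apply eta_sq_translation. }
rewrite (zeta12_eq _ _ (psi_T a b c d H)), zeta12_add.
split; intros HR tau Ht; specialize (HR tau Ht); rewrite (E tau Ht) in *.
- rewrite HR. ring.
- pose proof (zeta12_neq_0 1). 
  replace (eta_sq (mobius a b c d tau)) with (/ zeta12 1 * (zeta12 1 * eta_sq (mobius a b c d tau)))%C by (field; auto).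
  rewrite HR. field. auto.
Qed.

Lemma eta_sq_rule_T_iter a b c d k : (a * d - b * c = 1)%Z ->
  eta_sq_rule a b c d <-> eta_sq_rule (a + k * c) (b + k * d) c d.
Proof.
intros H. revert k. apply Z_ind_succ_pred.
- replace (a + 0 * c)%Z with a by ring. replace (b + 0 * d)%Z with b by ring. reflexivity.
- intros k. rewrite (eta_sq_rule_T (a + k * c) (b + k * d) c d) by lia.
  replace (a + (k + 1) * c)%Z with (a + k * c + c)%Z by ring.
  replace (b + (k + 1) * d)%Z with (b + k * d + d)%Z by ring. reflexivity.
Qed.

Lemma zeta12_m3 : zeta12 (-3) = (- Ci)%C.
Proof.
change (-3)%Z with (- (3))%Z. rewrite zeta12_opp. unfold zeta12. replace (3 / 12) with (1 / 4) by field. rewrite qq_quarter. apply Ci_inv.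
Qed.

Lemma eta_sq_rule_S a b c d : (a * d - b * c = 1)%Z -> eta_sq_rule a b c d -> eta_sq_rule (- c) (- d) a b.
Proof.
intros H HR tau Ht.
pose proof (auto_factor_neq_0 a b c d tau H Ht) as Hn.
assert (Hn' : auto_factor a b tau <> 0) by (apply (auto_factor_neq_0 (- c) (- d) a b tau); auto; lia).
rewrite mobius_S by auto. rewrite eta_sq_inversion by now apply Im_mobius_pos.
rewrite (HR tau Ht), (zeta12_eq _ _ (psi_S a b c d H)), zeta12_add, zeta12_m3.
unfold mobius. fold (auto_factor c d tau) (auto_factor a b tau). field. auto.
Qed.

Lemma mobius_1 tau : mobius 1 0 0 1 tau = tau.
Proof. unfold mobius. field. Qed.

Lemma mobius_m1 tau : mobius (-1) 0 0 (-1) tau = tau.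
Proof. unfold mobius. field. Qed.

Lemma zeta12_6 : zeta12 6 = (- (1))%C.
Proof. unfold zeta12. replace (6 / 12) with (1 / 2) by field. apply qq_half. Qed.

(** Euclid's algorithm on the first column. *)
Theorem eta_sq_transform a b c d : (a * d - b * c = 1)%Z -> eta_sq_rule a b c d.
Proof.
assert (G : forall n a b c d, (Z.abs_nat c <= n)%nat -> (a * d - b * c = 1)%Z -> eta_sq_rule a b c d).
2: { intros H. now apply (G (Z.abs_nat c)). }
clear. induction n as [|n IH]; intros a b c d Hc H.
- assert (c = 0)%Z by lia. subst c. assert (a * d = 1)%Z by lia.
  destruct (Z.eq_mul_1 _ _ H0) as [-> | ->].
  + assert (d = 1)%Z by lia. subst d. 
    pose proof (proj1 (eta_sq_rule_T_iter 1 0 0 1 b eq_refl)) as G.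
    replace (1 + b * 0)%Z with 1%Z in G by ring. replace (0 + b * 1)%Z with b in G by ring.
    apply G. intros tau Ht. rewrite mobius_1.
    replace (psi 1 0 0 1) with 0%Z by reflexivity. rewrite zeta12_0. unfold auto_factor. ring.
  + assert (d = -1)%Z by lia. subst d.
    pose proof (proj1 (eta_sq_rule_T_iter (-1) 0 0 (-1) (- b) eq_refl)) as G.
    replace (-1 + - b * 0)%Z with (-1)%Z in G by ring. replace (0 + - b * -1)%Z with b in G by ring.
    apply G. intros tau Ht. rewrite mobius_m1.
    (* Minus the identity acts trivially: the multiplier -1 cancels the automorphy factor -1. *)
    replace (psi (-1) 0 0 (-1)) with 6%Z by reflexivity. rewrite zeta12_6. unfold auto_factor. ring.
- destruct (Z.eq_dec c 0) as [E|E]. apply (IH a b c d); auto. lia.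
  apply (eta_sq_rule_T_iter a b c d (- (a / c)) H).
  set (r := (a + - (a / c) * c)%Z). set (s := (b + - (a / c) * d)%Z).
  assert (Hdet : (r * d - s * c = 1)%Z) by (unfold r, s; lia).
  assert (Hr : (Z.abs r < Z.abs c)%Z).
  { assert (r = a mod c)%Z as -> by (unfold r; rewrite Z.mod_eq by auto; ring).
    generalize (Z.mod_pos_bound a c) (Z.mod_neg_bound a c). lia. }
  (* The reduced matrix is the inversion matrix times [(c, d; -r, -s)], whose lower left entry is
     smaller than [c] in absolute value. *)
  replace r with (- (- r))%Z by ring. replace s with (- (- s))%Z by ring.
  apply eta_sq_rule_S. lia. apply IH; lia.
Qed.

(** * Invariance of the eta quotient *)

Lemma Im_scal_pos n tau : (0 < n)%nat -> 0 < Im tau -> 0 < Im (INR n * tau).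
Proof.
intros Hn H. replace (Im (INR n * tau)) with (INR n * Im tau) by (destruct tau; simpl; ring).
apply Rmult_lt_0_compat; auto. now apply lt_0_INR.
Qed.

Lemma g_eta_sq tau : g tau = (eta_sq (INR 2 * tau) * eta_sq (INR 5 * tau) ^ 2 /
  (eta_sq (INR 1 * tau) ^ 2 * eta_sq (INR 10 * tau)))%C.
Proof.
unfold g, eta_sq. replace (RtoC (INR 2)) with (RtoC 2) by (f_equal; simpl; ring).
replace (RtoC (INR 5)) with (RtoC 5) by (f_equal; simpl; ring).
replace (RtoC (INR 10)) with (RtoC 10) by (f_equal; simpl; ring).
replace (INR 1 * tau)%C with tau by (simpl; ring).
rewrite <- !Cpow_mult_r. reflexivity.
Qed.

Lemma g_neq_0 tau : 0 < Im tau -> g tau <> 0.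
Proof.
intros H. rewrite g_eta_sq.
assert (N : forall n, (0 < n)%nat -> eta_sq (INR n * tau) <> 0) by (intros; apply eta_sq_neq_0, Im_scal_pos; auto).
apply Cdiv_neq_0; apply Cmult_neq_0; [|apply Cpow_nz|apply Cpow_nz|]; apply N; lia.
Qed.

(** Conjugation by the diagonal matrix [(n, 0; 0, 1)]; it stays integral because [n] divides the
    lower left entry. *)
Lemma mobius_scal n a b c d tau : (0 < n)%nat ->
  (INR n * mobius a b (Z.of_nat n * c) d tau)%C = mobius a (Z.of_nat n * b) c d (INR n * tau).
Proof.
intros Hn. unfold mobius, Cdiv. rewrite !mult_IZR, <- !INR_IZR_INZ, !RtoC_mult.
replace (IZR c * (INR n * tau))%C with (INR n * IZR c * tau)%C by ring. ring.
Qed.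

Lemma auto_factor_scal n c d tau : auto_factor c d (INR n * tau) = auto_factor (Z.of_nat n * c) d tau.
Proof. unfold auto_factor. rewrite mult_IZR, <- INR_IZR_INZ, RtoC_mult. ring. Qed.

Lemma eta_sq_scal_transform n a b c d tau : (0 < n)%nat -> (a * d - b * (Z.of_nat n * c) = 1)%Z -> 0 < Im tau ->
  eta_sq (INR n * mobius a b (Z.of_nat n * c) d tau) =
  (zeta12 (psi a (Z.of_nat n * b) c d) * auto_factor (Z.of_nat n * c) d tau * eta_sq (INR n * tau))%C.
Proof.
intros Hn H Ht. rewrite mobius_scal, eta_sq_transform, auto_factor_scal; auto. lia.
now apply Im_scal_pos.
Qed.

Theorem g_invariant a b c d tau : (a * d - b * c = 1)%Z -> (10 | c)%Z -> 0 < Im tau ->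
  g (mobius a b c d tau) = g tau.
Proof.
intros H [c' ->] Ht. rewrite Z.mul_comm in *.
rewrite !g_eta_sq.
assert (E : forall n m, (Z.of_nat n * m = 10)%Z -> (0 < n)%nat ->
  eta_sq (INR n * mobius a b (10 * c') d tau) =
  (zeta12 (psi a (Z.of_nat n * b) (m * c') d) * auto_factor (10 * c') d tau * eta_sq (INR n * tau))%C).
{ intros n m Hm Hn. replace (10 * c')%Z with (Z.of_nat n * (m * c'))%Z by (rewrite Z.mul_assoc, Hm; ring).
  apply eta_sq_scal_transform; auto.
  replace (Z.of_nat n * (m * c'))%Z with (Z.of_nat n * m * c')%Z by ring. rewrite Hm. lia. }
rewrite (E 2%nat 5%Z eq_refl), (E 5%nat 2%Z eq_refl), (E 1%nat 10%Z eq_refl), (E 10%nat 1%Z eq_refl) by lia.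
change (Z.of_nat 2) with 2%Z. change (Z.of_nat 5) with 5%Z. change (Z.of_nat 10) with 10%Z.
change (Z.of_nat 1) with 1%Z. rewrite !Z.mul_1_l.
assert (Hz : (zeta12 (psi a (2 * b) (5 * c') d) * zeta12 (psi a (5 * b) (2 * c') d) ^ 2 =
   zeta12 (psi a b (10 * c') d) ^ 2 * zeta12 (psi a (10 * b) c' d))%C).
{ pose proof (zeta12_eq _ _ (psi_level_10 a b c' d ltac:(lia))) as Hz.
  replace (2 * psi a (5 * b) (2 * c') d)%Z with (psi a (5 * b) (2 * c') d + psi a (5 * b) (2 * c') d)%Z in Hz by ring.
  replace (2 * psi a b (10 * c') d)%Z with (psi a b (10 * c') d + psi a b (10 * c') d)%Z in Hz by ring.
  rewrite !zeta12_add in Hz.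
  transitivity (zeta12 (psi a (2 * b) (5 * c') d) * (zeta12 (psi a (5 * b) (2 * c') d) * zeta12 (psi a (5 * b) (2 * c') d)))%C.
  ring. rewrite Hz. ring. }
pose proof (auto_factor_neq_0 a b (10 * c') d tau ltac:(lia) Ht) as HJ.
set (J := auto_factor (10 * c') d tau) in *.
pose proof (zeta12_neq_0 (psi a b (10 * c') d)). pose proof (zeta12_neq_0 (psi a (10 * b) c' d)).
set (z1 := zeta12 (psi a b (10 * c') d)) in *. set (z10 := zeta12 (psi a (10 * b) c' d)) in *.
set (z2 := zeta12 (psi a (2 * b) (5 * c') d)) in *. set (z5 := zeta12 (psi a (5 * b) (2 * c') d)) in *.
assert (N : forall n, (0 < n)%nat -> eta_sq (INR n * tau) <> 0) by (intros; apply eta_sq_neq_0, Im_scal_pos; auto).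
pose proof (N 1%nat ltac:(lia)). pose proof (N 10%nat ltac:(lia)). clear N.
generalize dependent (eta_sq (INR 1 * tau)). generalize dependent (eta_sq (INR 10 * tau)).
generalize (eta_sq (INR 2 * tau)) (eta_sq (INR 5 * tau)). intros A2 A5 A10 HA10 A1 HA1.
(* Numerator and denominator both have total weight 3 in [eta_sq], so [J^3] cancels and only the
   roots of unity are left to compare. *)
transitivity ((z2 * z5 ^ 2) * (J ^ 3 * A2 * A5 ^ 2) / (z1 ^ 2 * z10 * (J ^ 3 * (A1 ^ 2 * A10))))%C.
field. auto. rewrite Hz. field. auto.
Qed.

(** * Holomorphy on the upper half-plane *)

Lemma holomorphic_eta_sq tau : 0 < Im tau -> exists l, Cderiv eta_sq tau l.
Proof.
intros H. destruct (lambert_swap _ (Cmod_qq_lt_1 tau H)) as [L [_ HL]].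
eexists. exact (Cderiv_eta_sq tau L H HL).
Qed.

Lemma holomorphic_g tau : 0 < Im tau -> exists l, Cderiv g tau l.
Proof.
intros H.
assert (D : forall n, (0 < n)%nat -> exists l, Cderiv (fun t => eta_sq (INR n * t)) tau l).
{ intros n Hn. destruct (holomorphic_eta_sq (INR n * tau)) as [l Hl]. now apply Im_scal_pos.
  exists (l * (INR n * 1))%C. apply (Cderiv_comp eta_sq (fun t => INR n * t)%C); auto.
  apply Cderiv_scal, Cderiv_id. }
destruct (D 2%nat ltac:(lia)) as [l2 H2]. destruct (D 5%nat ltac:(lia)) as [l5 H5].
destruct (D 1%nat ltac:(lia)) as [l1 H1]. destruct (D 10%nat ltac:(lia)) as [l10 H10].
assert (N : forall n, (0 < n)%nat -> eta_sq (INR n * tau) <> 0) by (intros; apply eta_sq_neq_0, Im_scal_pos; auto).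
eexists. intros eps He.
edestruct (Cderiv_mul (fun t => eta_sq (INR 2 * t) * (eta_sq (INR 5 * t) * eta_sq (INR 5 * t)))%C
  (fun t => / (eta_sq (INR 1 * t) * eta_sq (INR 1 * t) * eta_sq (INR 10 * t)))%C tau) with (eps := eps) as [del [Hd Hb]]; auto.
- apply Cderiv_mul; [exact H2|]. apply Cderiv_mul; exact H5.
- apply (Cderiv_comp Cinv). apply Cderiv_mul; [apply Cderiv_mul; exact H1|exact H10].
  apply Cderiv_Cinv. apply Cmult_neq_0; [apply Cmult_neq_0|]; apply N; lia.
- exists del. split; auto. intros h Hh. specialize (Hb h Hh).
  assert (E : forall t, g t = (eta_sq (INR 2 * t) * (eta_sq (INR 5 * t) * eta_sq (INR 5 * t)) *
    / (eta_sq (INR 1 * t) * eta_sq (INR 1 * t) * eta_sq (INR 10 * t)))%C).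
  { intros t. rewrite g_eta_sq. unfold Cdiv.
    replace (eta_sq (INR 1 * t) ^ 2)%C with (eta_sq (INR 1 * t) * eta_sq (INR 1 * t))%C by ring. ring. }
  rewrite !E. exact Hb.
Qed.

Definition hauptmodul_expr (tau : C) : C := (/ g tau - 2 + 3 * g tau)%C.

Lemma holomorphic_hauptmodul_expr tau : 0 < Im tau -> exists l, Cderiv hauptmodul_expr tau l.
Proof.
intros H. destruct (holomorphic_g tau H) as [l Hl]. eexists.
apply (Cderiv_plus (fun t => / g t - 2)%C (fun t => 3 * g t)%C). 
- apply (Cderiv_plus (fun t => / g t)%C (fun t => - (2))%C). 2: apply Cderiv_const.
  apply (Cderiv_comp Cinv g); eauto. apply Cderiv_Cinv. now apply g_neq_0.
- apply Cderiv_scal, Hl.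
Qed.

Lemma Cderiv_ex_derive f z l : Cderiv f z l -> holo_at f z.
Proof.
intros H. exists l. split.
- apply is_linear_scal_l.
- intros x Hx. apply (is_filter_lim_locally_unique (K := C_AbsRing) (V := AbsRing_NormedModule C_AbsRing) z) in Hx. subst x.
  intros [eps He]. destruct (H eps He) as [del [Hd Hb]].
  apply (locally_le_locally_norm (K := C_AbsRing) (V := AbsRing_NormedModule C_AbsRing)).
  exists (mkposreal _ Hd). intros y Hy. simpl.
  assert (Hy' : Cmod (y - z) < del) by exact Hy. specialize (Hb _ Hy').
  assert (Ez : @eq C (z + (y - z))%C y) by ring. rewrite Ez in Hb.
  change (Cmod (f y - f z - (y - z) * l) <= eps * Cmod (y - z)).
  assert (Es : @eq C ((y - z) * l)%C (l * (y - z))%C) by ring. rewrite Es. exact Hb.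
Qed.

(** * Functions given by a power series near 0 *)

(** The coefficients carry an explicit geometric bound instead of a radius of convergence, so
    closure under each operation is a comparison with a geometric series. *)
Definition power_series_on (F : C -> C) (a : nat -> C) (r M : R) : Prop :=
  0 < r /\ (forall n, Cmod (a n) * r ^ n <= M) /\
  forall x, Cmod x < r -> Cser (fun n => a n * x ^ n)%C (F x).

Definition analytic0 (F : C -> C) : Prop := exists a r M, power_series_on F a r M.

Lemma coef_bound_le a r M r' : (forall n, Cmod (a n) * r ^ n <= M) -> 0 <= r' <= r ->
  forall n, Cmod (a n) * r' ^ n <= M.
Proof.
intros H Hr n. eapply Rle_trans; [|apply H]. apply Rmult_le_compat_l. apply Cmod_ge_0. now apply pow_incr.
Qed.

Lemma coef_bound_nonneg a r M : (forall n, Cmod (a n) * r ^ n <= M) -> 0 <= M.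
Proof. intros H. specialize (H O). simpl in H. generalize (Cmod_ge_0 (a O)). lra. Qed.

Lemma coef_term_le a r M x : 0 < r -> (forall n, Cmod (a n) * r ^ n <= M) ->
  forall n, Cmod (a n * x ^ n) <= M * (Cmod x / r) ^ n.
Proof.
intros Hr H n. rewrite Cmod_mult, Cmod_pow. unfold Rdiv. rewrite Rpow_mult_distr.
replace (Cmod (a n) * Cmod x ^ n) with (Cmod (a n) * r ^ n * (Cmod x ^ n * (/ r) ^ n)).
- apply Rmult_le_compat_r; auto. apply Rmult_le_pos; apply pow_le. apply Cmod_ge_0.
  left; now apply Rinv_0_lt_compat.
- rewrite pow_inv. field. apply pow_nonzero. lra.
Qed.

Lemma summable_coef r M x : 0 < r -> 0 <= M -> Cmod x < r -> summable (fun n => M * (Cmod x / r) ^ n).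
Proof.
intros Hr HM Hx. apply summable_scal; auto. apply summable_geom. split.
apply Rdiv_le_0_compat; auto using Cmod_ge_0. apply Rlt_div_l; lra.
Qed.

Lemma analytic0_const c : analytic0 (fun _ => c).
Proof.
exists (fun n => match n with O => c | _ => 0%C end), 1, (Cmod c). split. lra. split.
- intros [|n]; simpl. lra. rewrite Cmod_0. generalize (Cmod_ge_0 c). lra.
- intros x _. apply Clim_ext_eventually with (N0 := 1%nat) (2 := Clim_const c).
  intros n Hn. induction Hn as [|m Hm IH]. simpl. ring.
  cbn [Csum]. rewrite <- IH. destruct m as [|m]; try lia. ring.
Qed.

Lemma analytic0_id : analytic0 (fun x => x).
Proof.
exists (fun n => match n with 1%nat => 1%C | _ => 0%C end), 1, 1. split. lra. split.
- intros [|[|n]]; simpl; rewrite ?Cmod_0, ?Cmod_1; lra.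
- intros x _.
  apply Clim_ext_eventually with (N0 := 2%nat) (2 := Clim_const x).
  intros n Hn. induction Hn as [|m Hm IH]. simpl. ring.
  cbn [Csum]. rewrite <- IH. destruct m as [|[|m]]; try lia. ring.
Qed.

Lemma analytic0_add F G : analytic0 F -> analytic0 G -> analytic0 (fun x => F x + G x)%C.
Proof.
intros (a & r & M & Hr & HM & HF) (b & r' & M' & Hr' & HM' & HG).
pose proof (Rmin_l r r'). pose proof (Rmin_r r r').
exists (fun n => a n + b n)%C, (Rmin r r'), (M + M').
assert (0 < Rmin r r') by now apply Rmin_glb_lt. split; auto. split.
- intros n. pose proof (coef_bound_le a r M (Rmin r r') HM ltac:(lra) n).
  pose proof (coef_bound_le b r' M' (Rmin r r') HM' ltac:(lra) n).
  assert (0 <= Rmin r r' ^ n) by (apply pow_le; lra).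
  generalize (Cmod_triangle (a n) (b n)). nra.
- intros x Hx. apply Cser_ext with (fun n => a n * x ^ n + b n * x ^ n)%C. intros; ring.
  apply Cser_add; [apply HF|apply HG]; lra.
Qed.

(** Coefficients after multiplication by [x^i]. *)
Definition pad (i : nat) (b : nat -> C) (j : nat) : C := if (i <=? j)%nat then b (j - i)%nat else 0%C.

Lemma Csum_pad i b n : Csum (pad i b) (i + n) = Csum b n.
Proof.
rewrite Csum_split. rewrite (Csum_ext (fun k => pad i b (i + k)) b).
2: { intros k _. unfold pad. destruct (Nat.leb_spec i (i + k)); try lia. f_equal. lia. }
rewrite (Csum_ext (pad i b) (fun _ => 0 * 0)%C i), Csum_scal. ring.
intros k Hk. unfold pad. destruct (Nat.leb_spec i k); try lia. ring.
Qed.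

Lemma Cser_pad i b s : Cser b s -> Cser (pad i b) s.
Proof.
intros H. apply Clim_ext_eventually with (N0 := i) (u := fun n => Csum b (n - i)).
- intros n Hn. rewrite <- (Csum_pad i). f_equal. lia.
- intros eps He. destruct (H eps He) as [N HN]. exists (N + i)%nat. intros n Hn. apply HN. lia.
Qed.

Lemma Rsum_pad_le i b B n : (forall k, 0 <= b k) -> (forall m, Rsum b m <= B) ->
  Rsum (fun j => if (i <=? j)%nat then b (j - i)%nat else 0) n <= B.
Proof.
intros Hb HB. assert (HB0 : 0 <= B) by exact (HB 0%nat).
assert (E : forall m, Rsum (fun j => if (i <=? j)%nat then b (j - i)%nat else 0) (i + m) = Rsum b m).
{ induction m.
  - rewrite Nat.add_0_r. simpl.
    assert (Hz : forall k, (k <= i)%nat -> Rsum (fun j => if (i <=? j)%nat then b (j - i)%nat else 0) k = 0).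
    { induction k; simpl; intros; auto. rewrite IHk by lia. destruct (Nat.leb_spec i k); try lia. ring. }
    apply Hz. lia.
  - rewrite Nat.add_succ_r. simpl Rsum. rewrite IHm. destruct (Nat.leb_spec i (i + m)); try lia.
    do 2 f_equal. lia. }
eapply Rle_trans; [|apply (HB n)]. rewrite <- E. apply Rsum_mono; [|lia].
intros k. destruct (i <=? k)%nat; auto. lra.
Qed.

Lemma Csum_pad_swap (f g : nat -> C) j n : (j < n)%nat ->
  Csum (fun i => pad i (fun k => f i * g k)%C j) n = Csum (fun i => f i * g (j - i)%nat)%C (S j).
Proof.
intros Hn. replace n with (S j + (n - S j))%nat by lia. rewrite Csum_split.
rewrite (Csum_ext (fun i => pad i (fun k => f i * g k)%C j) (fun i => f i * g (j - i)%nat)%C (S j)).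
2: { intros k Hk. unfold pad. destruct (Nat.leb_spec k j); auto. lia. }
rewrite (Csum_ext _ (fun _ => 0 * 0)%C (n - S j)), Csum_scal. ring.
intros k Hk. unfold pad. destruct (Nat.leb_spec (S j + k) j); try lia. ring.
Qed.

Definition cauchy_coef (a b : nat -> C) (n : nat) : C := Csum (fun i => a i * b (n - i)%nat)%C (S n).

(** Row [i] of the array is the second series times term [i] of the first, moved [i] places to the
    right. Column [j] is then the finite convolution of index [j], and [fubini_eq] compares the two
    sums. *)
Lemma Cser_cauchy a b r M M' x s t : 0 < r -> (forall n, Cmod (a n) * r ^ n <= M) ->
  (forall n, Cmod (b n) * r ^ n <= M') -> Cmod x < r ->
  Cser (fun n => a n * x ^ n)%C s -> Cser (fun n => b n * x ^ n)%C t ->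
  Cser (fun n => cauchy_coef a b n * x ^ n)%C (s * t)%C.
Proof.
intros Hr HM HM' Hx Hs Ht.
pose proof (coef_bound_nonneg a r M HM) as M0. pose proof (coef_bound_nonneg b r M' HM') as M0'.
pose proof (coef_term_le a r M x Hr HM) as Ha. pose proof (coef_term_le b r M' x Hr HM') as Hb.
destruct (summable_coef r M' x Hr M0' Hx) as [Hp [B HB]].
assert (HB0 : 0 <= B) by exact (HB 0%nat).
apply (fubini_eq (fun i => pad i (fun k => (a i * x ^ i) * (b k * x ^ k))%C)
  (fun i j => M * (Cmod x / r) ^ i * (if (i <=? j)%nat then M' * (Cmod x / r) ^ (j - i) else 0))
  (fun i => B * (M * (Cmod x / r) ^ i)) (fun i => (a i * x ^ i) * t)%C).
- apply summable_scal; auto. now apply summable_coef.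
- intros i j. unfold pad. destruct (i <=? j)%nat.
  + rewrite Cmod_mult. apply Rmult_le_compat; auto using Cmod_ge_0.
  + rewrite Cmod_0. lra.
- intros i n. rewrite Rsum_scal, Rmult_comm. apply Rmult_le_compat_r.
  eapply Rle_trans; [apply Cmod_ge_0|apply Ha].
  apply (Rsum_pad_le i (fun k => M' * (Cmod x / r) ^ k)); auto.
- intros i. apply Cser_pad. now apply Cser_scal.
- intros j. apply Clim_ext_eventually with (N0 := S j) (2 := Clim_const (cauchy_coef a b j * x ^ j)%C).
  intros n Hn. rewrite (Csum_pad_swap (fun i => a i * x ^ i)%C (fun k => b k * x ^ k)%C) by lia.
  unfold cauchy_coef. rewrite (Cmult_comm _ (x ^ j)), <- Csum_scal. apply Csum_ext. intros i Hi.
  replace (x ^ j)%C with (x ^ i * x ^ (j - i))%C by (rewrite <- Cpow_add_r; f_equal; lia). ring.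
- apply Cser_ext with (fun i => t * (a i * x ^ i))%C. intros; ring.
  rewrite Cmult_comm. now apply Cser_scal.
Qed.

Lemma analytic0_mul F G : analytic0 F -> analytic0 G -> analytic0 (fun x => F x * G x)%C.
Proof.
intros (a & r0 & M & Hr0 & HM0 & HF) (b & r' & M' & Hr' & HM0' & HG).
set (r := Rmin r0 r'). assert (Hr : 0 < r) by now apply Rmin_glb_lt.
assert (H1 : r <= r0) by apply Rmin_l. assert (H2 : r <= r') by apply Rmin_r.
pose proof (coef_bound_le a r0 M r HM0 ltac:(lra)) as HM.
pose proof (coef_bound_le b r' M' r HM0' ltac:(lra)) as HM'.
pose proof (coef_bound_nonneg a r M HM) as M0. pose proof (coef_bound_nonneg b r M' HM') as M0'.
(* The convolution of index [n] has [n + 1] terms; halving the radius absorbs this factor through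
   [n + 1 <= 2^n]. *)
exists (cauchy_coef a b), (r / 2), (M * M'). split. lra. split.
- intros n. assert (Hn : Cmod (cauchy_coef a b n) * r ^ n <= INR (S n) * (M * M')).
  { unfold cauchy_coef. eapply Rle_trans.
    - apply Rmult_le_compat_r. apply pow_le; lra.
      apply (Cmod_Csum_le _ (fun i => Cmod (a i * b (n - i)%nat))). intros; lra.
    - rewrite Rmult_comm, <- Rsum_scal.
      apply Rle_trans with (Rsum (fun _ => M * M') (S n)).
      + apply Rsum_le. intros k Hk. rewrite Cmod_mult.
        replace (r ^ n) with (r ^ k * r ^ (n - k)) by (rewrite <- pow_add; f_equal; lia).
        replace (r ^ k * r ^ (n - k) * (Cmod (a k) * Cmod (b (n - k)%nat))) with
          ((Cmod (a k) * r ^ k) * (Cmod (b (n - k)%nat) * r ^ (n - k))) by ring.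
        apply Rmult_le_compat; auto; apply Rmult_le_pos; auto using Cmod_ge_0; apply pow_le; lra.
      + right. generalize (S n). clear. induction n. simpl; ring. simpl Rsum. rewrite IHn, S_INR. ring. }
  unfold Rdiv. rewrite Rpow_mult_distr, <- Rmult_assoc, pow_inv.
  assert (Hp : 0 < 2 ^ n) by (apply pow_lt; lra).
  apply Rle_div_l; auto. eapply Rle_trans; [exact Hn|]. rewrite Rmult_comm.
  apply Rmult_le_compat_l. now apply Rmult_le_pos.
  generalize (lt_pow2 n). intros Hl. apply Rle_trans with (INR (2 ^ n)). now apply le_INR.
  rewrite pow_INR. replace (INR 2) with 2 by (simpl; ring). lra.
- intros x Hx. apply (Cser_cauchy a b r M M'); auto. lra. apply HF; lra. apply HG; lra.
Qed.

Lemma analytic0_pow F n : analytic0 F -> analytic0 (fun x => F x ^ n)%C.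
Proof.
intros H. induction n; simpl. apply analytic0_const. now apply analytic0_mul.
Qed.

Lemma analytic0_scal c F : analytic0 F -> analytic0 (fun x => c * F x)%C.
Proof. intros H. apply analytic0_mul; auto using analytic0_const. Qed.

(** * Reciprocals of power series *)

Lemma Cser_at_0 a : Cser (fun n => a n * 0 ^ n)%C (a O).
Proof.
replace (a O) with (a O * 0 ^ 0 + 0)%C by (simpl; ring).
apply (Cser_shift (fun n => a n * 0 ^ n)%C). apply Clim_ext with (fun _ => 0%C). 2: apply Clim_const.
induction n; auto. cbn [Csum]. rewrite <- IHn, Cpow_S. ring.
Qed.

(** Each coefficient of the reciprocal depends on all earlier ones. Carrying the table of values up
    to [n] as a function makes this course-of-values recursion structural. *)
Fixpoint inv_coef_upto (a : nat -> C) (n : nat) : nat -> C :=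
  match n with
  | O => fun _ => (/ a O)%C
  | S k => fun j => if (j <=? k)%nat then inv_coef_upto a k j
      else (- / a O * Csum (fun i => a (S i) * inv_coef_upto a k (k - i)%nat) (S k))%C
  end.

Definition inv_coef (a : nat -> C) (n : nat) : C := inv_coef_upto a n n.

Lemma inv_coef_upto_eq a n j : (j <= n)%nat -> inv_coef_upto a n j = inv_coef a j.
Proof.
induction n; intros H. now replace j with O by lia.
destruct (Nat.eq_dec j (S n)) as [->|]. reflexivity.
cbn [inv_coef_upto]. destruct (Nat.leb_spec j n); try lia. apply IHn. lia.
Qed.

Lemma inv_coef_S a n : inv_coef a (S n) = (- / a O * Csum (fun i => a (S i) * inv_coef a (n - i)%nat) (S n))%C.
Proof.
unfold inv_coef at 1. cbn [inv_coef_upto]. destruct (Nat.leb_spec (S n) n); try lia.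
f_equal. apply Csum_ext. intros i Hi. f_equal. apply inv_coef_upto_eq. lia.
Qed.

Lemma cauchy_inv_coef (a : nat -> C) n : a O <> 0 -> cauchy_coef a (inv_coef a) n = if (n =? 0)%nat then 1%C else 0%C.
Proof.
intros Ha. unfold cauchy_coef. destruct n as [|n].
- simpl. unfold inv_coef. simpl. field. auto.
- rewrite Csum_shift, Nat.sub_0_r, inv_coef_S.
  change (Csum (fun k => a (S k) * inv_coef a (S n - S k)%nat)%C (S n))
    with (Csum (fun i => a (S i) * inv_coef a (n - i)%nat)%C (S n)).
  simpl (S n =? 0)%nat. cbv iota. field. auto.
Qed.

Lemma inv_coef_bound (a : nat -> C) r M : a O <> 0 -> 0 < r -> (forall n, Cmod (a n) * r ^ n <= M) ->
  forall n, Cmod (inv_coef a n) <= / Cmod (a O) * ((1 + M / Cmod (a O)) / r) ^ n.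
Proof.
intros Ha Hr HM. pose proof (proj1 (Cmod_gt_0 _) Ha) as HA. set (A := Cmod (a O)) in *.
assert (HMA : A <= M). { specialize (HM O). simpl in HM. fold A in HM. lra. }
set (be := M / A). assert (Hbe : 0 < be) by (apply Rdiv_lt_0_compat; lra).
set (K := (1 + be) / r). assert (HK : 0 < K) by (apply Rdiv_lt_0_compat; lra).
assert (Hr' : 0 < / r) by now apply Rinv_0_lt_compat.
(* [K] is chosen with [K - / r = be / r], so the sum is geometric with the closed form on the right,
   and the bound by powers of [K] reproduces itself under the recurrence. *)
assert (Hgeo : forall n, be * Rsum (fun i => (/ r) ^ S i * K ^ (n - i)) (S n) <= K ^ S n - (/ r) ^ S n).
{ induction n.
  - simpl. right. unfold K. field. lra.
  - set (X := Rsum (fun i => (/ r) ^ S i * K ^ (n - i)) (S n)) in *.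
    assert (E : Rsum (fun i => (/ r) ^ S i * K ^ (S n - i)) (S (S n)) = K * X + (/ r) ^ S (S n)).
    { change (Rsum (fun i => (/ r) ^ S i * K ^ (S n - i)) (S n) + (/ r) ^ S (S n) * K ^ (S n - S n) = K * X + (/ r) ^ S (S n)).
      rewrite Nat.sub_diag. simpl (K ^ 0). rewrite Rmult_1_r. f_equal. unfold X. rewrite <- Rsum_scal.
      apply Rsum_ext. intros k Hk. replace (S n - k)%nat with (S (n - k)) by lia. simpl. ring. }
    rewrite E. apply Rmult_le_compat_l with (r := K) in IHn; [|lra].
    replace (K ^ S (S n) - (/ r) ^ S (S n)) with (K * (K ^ S n - (/ r) ^ S n) + be * (/ r) ^ S (S n)).
    lra. simpl. unfold K. field. lra. }
induction n as [n IH] using (well_founded_induction lt_wf).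
destruct n as [|n].
- unfold inv_coef. simpl. rewrite Cmod_inv by auto. fold A. lra.
- rewrite inv_coef_S, Cmod_mult, Cmod_opp, Cmod_inv by auto. fold A.
  apply Rmult_le_compat_l. left; now apply Rinv_0_lt_compat.
  eapply Rle_trans; [apply (Cmod_Csum_le _ (fun i => Cmod (a (S i)) * Cmod (inv_coef a (n - i)%nat)))|].
  { intros k. rewrite Cmod_mult. lra. }
  apply Rle_trans with (be * Rsum (fun i => (/ r) ^ S i * K ^ (n - i)) (S n)).
  + rewrite <- Rsum_scal. apply Rsum_le. intros k Hk.
    replace (be * ((/ r) ^ S k * K ^ (n - k))) with ((M * (/ r) ^ S k) * (/ A * K ^ (n - k))) by (unfold be; field; lra).
    apply Rmult_le_compat; auto using Cmod_ge_0.
    * specialize (HM (S k)). rewrite pow_inv. apply Rle_div_r; auto. now apply pow_lt.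
    * apply IH. lia.
  + eapply Rle_trans; [apply Hgeo|]. assert (0 < (/ r) ^ S n) by now apply pow_lt. lra.
Qed.

Lemma analytic0_inv (F : C -> C) : analytic0 F -> F 0 <> 0 -> analytic0 (fun x => / F x)%C.
Proof.
intros (a & r & M & Hr & HM & HF) H0.
assert (Ha : a O <> 0).
{ intros E. apply H0. transitivity (a O); [|exact E]. apply (Cser_unique (fun n => a n * 0 ^ n)%C); [|apply Cser_at_0].
  apply HF. now rewrite Cmod_0. }
pose proof (inv_coef_bound a r M Ha Hr HM) as Hb.
pose proof (proj1 (Cmod_gt_0 _) Ha) as HA.
pose proof (coef_bound_nonneg a r M HM) as M0.
set (K := (1 + M / Cmod (a O)) / r) in *.
assert (HMA : 0 <= M / Cmod (a O)) by (apply Rdiv_le_0_compat; auto).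
assert (HK : 0 < K) by (apply Rdiv_lt_0_compat; lra).
assert (HK' : 0 < / K) by now apply Rinv_0_lt_compat.
assert (HKr : / K <= r).
{ apply Rmult_le_reg_l with K; auto. rewrite Rinv_r by lra.
  replace (K * r) with (1 + M / Cmod (a O)) by (unfold K; field; lra). lra. }
assert (Hb' : forall n, Cmod (inv_coef a n) * (/ K) ^ n <= / Cmod (a O)).
{ intros n. rewrite pow_inv. apply Rle_div_l. now apply pow_lt. apply Hb. }
exists (inv_coef a), (/ K), (/ Cmod (a O)). split; auto. split; auto.
intros x Hx.
destruct (Cser_cv (fun n => inv_coef a n * x ^ n)%C (fun n => / Cmod (a O) * (Cmod x / / K) ^ n)) as [s Hs].
- apply summable_coef; auto. left; now apply Rinv_0_lt_compat.
- now apply coef_term_le.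
- assert (E : (F x * s = 1)%C).
  { apply (Cser_unique (fun n => cauchy_coef a (inv_coef a) n * x ^ n)%C).
    - apply (Cser_cauchy a (inv_coef a) (/ K) M (/ Cmod (a O))); auto.
      apply coef_bound_le with r; auto. lra. apply HF. lra.
    - apply Clim_ext_eventually with (N0 := 1%nat) (2 := Clim_const 1%C).
      intros n Hn. induction Hn as [|n Hn IHn]; cbn [Csum]; [|rewrite <- IHn]; rewrite cauchy_inv_coef by auto.
      simpl. ring. destruct n; try lia. simpl (S n =? 0)%nat. cbv iota. ring. }
  assert (F x <> 0). { intros E0. rewrite E0 in E. apply C1_nz. rewrite <- E. ring. }
  replace (/ F x)%C with s; auto. replace s with (/ F x * (F x * s))%C by (field; auto). rewrite E. ring.
Qed.

(** Coefficients after replacing [x] by [x^e]. *)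
Definition stride (e : nat) (a : nat -> C) (n : nat) : C :=
  if (n mod e =? 0)%nat then a (n / e)%nat else 0%C.

Lemma Csum_stride e a x m : (0 < e)%nat ->
  Csum (fun n => stride e a n * x ^ n)%C (e * m) = Csum (fun n => a n * (x ^ e) ^ n)%C m.
Proof.
intros He. induction m. now rewrite Nat.mul_0_r.
rewrite Nat.mul_succ_r, Csum_split, IHm. cbn [Csum]. f_equal.
destruct e as [|e]; [lia|]. rewrite Csum_shift.
rewrite (Csum_ext _ (fun _ => 0 * 0)%C e), Csum_scal.
- rewrite Nat.add_0_r. unfold stride. rewrite Nat.mul_comm, Nat.Div0.mod_mul, Nat.div_mul by lia. simpl (0 =? 0)%nat.
  cbv iota. rewrite Nat.mul_comm, Cpow_mult_r. ring.
- intros k Hk. unfold stride. rewrite (Nat.mul_comm (S e)), Nat.add_comm, Nat.Div0.mod_add, Nat.mod_small by lia.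
  simpl. ring.
Qed.

Lemma analytic0_comp_monomial F c e : (0 < e)%nat -> analytic0 F -> analytic0 (fun x => F (c * x ^ e)%C).
Proof.
intros He (a & r & M & Hr & HM & HF).
pose proof (coef_bound_nonneg a r M HM) as M0. pose proof (Cmod_ge_0 c) as Hc.
(* The 1 gives [r1^e <= r1], the other entry gives [Cmod c * r1 <= r]; adding 1 to [Cmod c] avoids
   division by zero. *)
set (r1 := Rmin 1 (r / (Cmod c + 1))).
assert (Hr1 : 0 < r1). { apply Rmin_glb_lt; [lra|]. apply Rdiv_lt_0_compat; lra. }
assert (Hr11 : r1 <= 1) by apply Rmin_l.
assert (Hrc : Cmod c * r1 <= r).
{ apply Rle_trans with ((Cmod c + 1) * (r / (Cmod c + 1))).
  apply Rmult_le_compat; try lra. apply Rmin_r. right. field. lra. }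
set (b := stride e (fun n => a n * c ^ n)%C).
assert (Hb : forall n, Cmod (b n) * r1 ^ n <= M).
{ intros n. unfold b, stride. destruct (Nat.eqb_spec (n mod e) 0) as [E|E].
  - pose proof (Nat.div_mod_eq n e) as Hn. rewrite E, Nat.add_0_r in Hn. set (m := (n / e)%nat) in *. rewrite Hn.
    rewrite Cmod_mult, Cmod_pow. eapply Rle_trans; [|apply (HM m)]. rewrite Rmult_assoc.
    apply Rmult_le_compat_l. apply Cmod_ge_0. rewrite pow_mult, <- Rpow_mult_distr.
    assert (Hre : 0 <= r1 ^ e <= r1).
    { split. apply pow_le; lra. destruct e as [|e']; [lia|]. simpl.
      assert (r1 ^ e' <= 1) by (rewrite <- (pow1 e'); apply pow_incr; lra).
      assert (0 <= r1 ^ e') by (apply pow_le; lra). nra. }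
    apply pow_incr. split. nra. nra.
  - rewrite Cmod_0. lra. }
exists b, r1, M. split; auto. split; auto.
intros x Hx.
assert (Hxr : Cmod (c * x ^ e) < r).
{ rewrite Cmod_mult, Cmod_pow. pose proof (Cmod_ge_0 x).
  assert (Hxe : Cmod x ^ e <= Cmod x).
  { destruct e as [|e']; [lia|]. simpl.
    assert (Cmod x ^ e' <= 1) by (rewrite <- (pow1 e'); apply pow_incr; lra).
    assert (0 <= Cmod x ^ e') by (apply pow_le; lra). nra. }
  assert (0 <= Cmod x ^ e) by now apply pow_le.
  destruct (Req_dec (Cmod c) 0) as [E|E]. rewrite E. lra.
  apply Rle_lt_trans with (Cmod c * Cmod x). nra. apply Rlt_le_trans with (Cmod c * r1); nra. }
destruct (Cser_cv (fun n => b n * x ^ n)%C (fun n => M * (Cmod x / r1) ^ n)) as [s Hs].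
- now apply summable_coef.
- now apply coef_term_le.
- replace (F (c * x ^ e)%C) with s; auto.
  apply (Clim_unique (fun m => Csum (fun n => b n * x ^ n)%C (e * m))).
  + apply (Clim_subseq _ _ (fun m => e * m)%nat); auto. intros m. nia.
  + apply Clim_ext with (2 := HF _ Hxr). intros m. unfold b. rewrite Csum_stride by auto.
    apply Csum_ext. intros n _. rewrite Cpow_mult_l. ring.
Qed.

(** Coefficients of the polynomial [(1 - x) ... (1 - x^N)]. *)
Fixpoint euler_poly (N : nat) : nat -> C :=
  match N with
  | O => fun n => if (n =? 0)%nat then 1%C else 0%C
  | S k => fun n => (euler_poly k n - pad (S k) (euler_poly k) n)%C
  end.

Lemma Cser_euler_poly N x : Cser (fun n => euler_poly N n * x ^ n)%C (qpoch_part x x N).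
Proof.
induction N.
- apply Clim_ext_eventually with (N0 := 1%nat) (2 := Clim_const 1%C).
  intros n Hn. induction Hn as [|n Hn IHn]; cbn [Csum]; [|rewrite <- IHn].
  simpl. ring. destruct n; try lia. simpl. ring.
- simpl qpoch_part. replace (qpoch_part x x N * (1 - x * x ^ N))%C with (qpoch_part x x N - x ^ S N * qpoch_part x x N)%C
    by (simpl; ring).
  apply Cser_ext with (fun n => euler_poly N n * x ^ n - pad (S N) (fun k => x ^ S N * (euler_poly N k * x ^ k)) n)%C.
  + intros n. cbn [euler_poly]. unfold pad. destruct (Nat.leb_spec (S N) n); [|ring].
    replace (x ^ n)%C with (x ^ S N * x ^ (n - S N))%C by (rewrite <- Cpow_add_r; f_equal; lia). ring.
  + apply Cser_sub; auto. apply Cser_pad. now apply Cser_scal.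
Qed.

(** Already the sum of all moduli weighted by powers of [1/2] is bounded: the factor [1 - x^(N+1)]
    enlarges it at most by [1 + (1/2)^(N+1)], and the product of these is below [exp 2]. Uniformity
    in [N] is what [tannery] needs. *)
Lemma euler_poly_bound N n : Cmod (euler_poly N n) * (1 / 2) ^ n <= exp 2.
Proof.
assert (H : forall N K, Rsum (fun n => Cmod (euler_poly N n) * (1 / 2) ^ n) K <= exp (Rsum (fun k => (1/2) ^ k) N)).
{ clear. induction N; intros K.
  - simpl. rewrite exp_0. destruct K. simpl; lra.
    assert (E : forall m, Rsum (fun n => Cmod (if (n =? 0)%nat then 1%C else 0%C) * (1/2) ^ n) (S m) = 1).
    { induction m. simpl. rewrite Cmod_1. ring.
      change (Rsum (fun n => Cmod (if (n =? 0)%nat then 1%C else 0%C) * (1/2) ^ n) (S m) + Cmod 0 * (1/2) ^ (S m) = 1).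
      rewrite IHm, Cmod_0. ring. }
    rewrite E. lra.
  - simpl (Rsum _ (S N)). rewrite exp_plus. set (B := exp (Rsum _ N)) in *.
    apply Rle_trans with (Rsum (fun n => Cmod (euler_poly N n) * (1/2) ^ n +
      (1 / 2) ^ S N * (if (S N <=? n)%nat then Cmod (euler_poly N (n - S N)) * (1/2) ^ (n - S N) else 0)) K).
    + apply Rsum_le. intros n _. cbn [euler_poly]. unfold pad.
      assert (0 <= (1/2) ^ n) by (apply pow_le; lra).
      destruct (Nat.leb_spec (S N) n).
      * rewrite <- (Rmult_assoc ((1/2) ^ S N)), (Rmult_comm ((1/2) ^ S N)), Rmult_assoc, <- pow_add.
        replace (S N + (n - S N))%nat with n by lia. rewrite <- Rmult_plus_distr_r.
        apply Rmult_le_compat_r; auto. apply Cmod_triangle_minus.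
      * rewrite Rmult_0_r, Rplus_0_r. replace (euler_poly N n - 0)%C with (euler_poly N n) by ring. lra.
    + rewrite Rsum_add, Rsum_scal.
      assert (H0 : forall k, 0 <= Cmod (euler_poly N k) * (1 / 2) ^ k).
      { intros k. apply Rmult_le_pos. apply Cmod_ge_0. apply pow_le; lra. }
      pose proof (Rsum_pad_le (S N) (fun k => Cmod (euler_poly N k) * (1/2) ^ k) B K H0 IHN).
      specialize (IHN K). cbv beta in *. set (P := Rsum (fun j => if (S N <=? j)%nat then Cmod (euler_poly N (j - S N)%nat) * (1/2) ^ (j - S N) else 0) K) in *.
      assert (Hp : 0 < (1/2) ^ N) by (apply pow_lt; lra). simpl ((1/2) ^ S N).
      generalize (exp_ineq1_le ((1/2) ^ N)). assert (0 < B) by apply exp_pos. intros.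
      assert ((1/2) ^ N * P <= (1/2) ^ N * B) by (apply Rmult_le_compat_l; lra). 
      assert (B * (1 + (1/2) ^ N) <= B * exp ((1/2) ^ N)) by (apply Rmult_le_compat_l; lra).
      assert (0 <= (1/2) ^ N * B) by nra. nra. }
eapply Rle_trans. 2: apply Rle_trans with (1 := H N (S n)).
- simpl. assert (0 <= Rsum (fun n => Cmod (euler_poly N n) * (1 / 2) ^ n) n); [|lra].
  apply Rsum_nonneg. intros k. apply Rmult_le_pos. apply Cmod_ge_0. apply pow_le; lra.
- apply exp_le_exp. clear. assert (E : Rsum (fun k => (1/2) ^ k) N = 2 - 2 * (1/2) ^ N).
  { induction N; simpl. lra. rewrite IHN. simpl. lra. }
  rewrite E. generalize (pow_le (1/2) N ltac:(lra)). lra.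
Qed.

Lemma euler_poly_stable N n : (n <= N)%nat -> euler_poly N n = euler_poly n n.
Proof.
intros H. induction H as [|N HN IH]; auto. cbn [euler_poly]. rewrite IH. unfold pad.
destruct (Nat.leb_spec (S N) n); try lia. ring.
Qed.

(** The coefficient of [x^n] is unaffected by factors [1 - x^k] with [k > n], so it stabilizes at
    [euler_poly n n]. *)
Lemma analytic0_euler : analytic0 (fun x => qpoch x x).
Proof.
exists (fun n => euler_poly n n), (1 / 2), (exp 2). split. lra. split.
{ intros n. apply euler_poly_bound. }
intros x Hx.
destruct (tannery (fun N n => euler_poly N n * x ^ n)%C (fun n => euler_poly n n * x ^ n)%C
  (fun n => exp 2 * (Cmod x / (1 / 2)) ^ n) (fun N => qpoch_part x x N)) as [S [HS1 HS2]].
- apply summable_coef; try lra. left; apply exp_pos.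
- intros N n. apply (coef_term_le (euler_poly N)). lra. intros; apply euler_poly_bound.
- intros n. apply Clim_mul; auto using Clim_const.
  apply Clim_ext_eventually with (N0 := n) (2 := Clim_const (euler_poly n n)).
  intros N HN. symmetry. now apply euler_poly_stable.
- intros N. apply Cser_euler_poly.
- replace (qpoch x x) with S; auto. apply (Clim_unique _ _ _ HS2). apply qpoch_lim. lra.
Qed.

(** * Expansions at the cusps *)

Definition nome (h : nat) (tau : C) : C := Cexp (RtoC (2 * PI / INR h) * (Ci * tau))%C.

(** Factor [(n a, n b; c, d)] as [gamma' (al, be; 0, de)] with [gamma'] in SL_2(Z). *)
Lemma hecke_factorization (n a b c d : Z) : (0 < n)%Z -> (a * d - b * c = 1)%Z ->
  exists a1 b1 c1 d1 al be de : Z, (a1 * d1 - b1 * c1 = 1 /\ 0 < al /\ 0 < de /\ al * de = n /\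
   n * a = a1 * al /\ n * b = a1 * be + b1 * de /\ c = c1 * al /\ d = c1 * be + d1 * de)%Z.
Proof.
intros Hn H. set (al := Z.gcd (n * a) c).
destruct (Z.gcd_divide_l (n * a) c) as [a1 Ha1]. destruct (Z.gcd_divide_r (n * a) c) as [c1 Hc1].
fold al in Ha1, Hc1.
assert (Hal : (0 < al)%Z).
{ pose proof (Z.gcd_nonneg (n * a) c) as H0. fold al in H0.
  destruct (Z.eq_dec al 0) as [E|E]; [|lia]. rewrite E in Ha1, Hc1.
  assert (a = 0)%Z by nia. subst a. lia. }
assert (Hg : exists y x, (y * (n * a) + x * c = al)%Z).
{ destruct (Z.gcd_bezout (n * a) c al eq_refl) as [y [x Hxy]]. eauto. }
destruct Hg as [y [x Hxy]].
assert (Hdet : (a1 * y - (- x) * c1 = 1)%Z).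
{ rewrite Ha1 in Hxy. rewrite Hc1 in Hxy at 1.
  apply (Z.mul_reg_r _ _ al); [lia|]. lia. }
set (de := (a1 * d - n * b * c1)%Z).
assert (Hde : (al * de = n)%Z).
{ unfold de. transitivity (n * a * d - n * b * c)%Z. rewrite Ha1 at 1. rewrite Hc1 at 1. ring.
  replace (n * a * d - n * b * c)%Z with (n * (a * d - b * c))%Z by ring. rewrite H. ring. }
(* [al] is the gcd of the first column, the Bezout coefficients complete [(a1, c1)] to a unimodular
   matrix, and [(be, de)] is the inverse of that matrix applied to the second column [(n b, d)]. *)
exists a1, (- x)%Z, c1, y, al, (y * (n * b) + x * d)%Z, de.
assert (0 < de)%Z by nia.
repeat split; auto.
- transitivity ((a1 * y - - x * c1) * (n * b))%Z. rewrite Hdet; ring. unfold de. ring.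
- transitivity ((a1 * y - - x * c1) * d)%Z. rewrite Hdet; ring. unfold de. ring.
Qed.

Lemma eta_sq_cusp (n : nat) a b c d : (a * d - b * c = 1)%Z -> (0 < n)%nat -> (Z.of_nat n | 10)%Z ->
  exists (K : C) (k : nat) (F : C -> C), K <> 0 /\ analytic0 F /\ F 0 <> 0 /\
    forall tau, 0 < Im tau ->
      eta_sq (INR n * mobius a b c d tau) = (K * auto_factor c d tau * nome 120 tau ^ k * F (nome 120 tau))%C.
Proof.
intros H Hn [m Hm].
destruct (hecke_factorization (Z.of_nat n) a b c d ltac:(lia) H)
  as (a1 & b1 & c1 & d1 & al & be & de & Hdet & Hal & Hde & Hn' & E1 & E2 & E3 & E4).
(* The leading exponent [al / (12 de)] must equal [k / 120]; from [10 = m * al * de] one gets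
   [k = 10 al / de = m * al^2]. *)
set (k := Z.to_nat (al * (m * al))).
assert (Hk : (Z.of_nat k * de = 10 * al)%Z).
{ unfold k. rewrite Z2Nat.id by nia. rewrite Hm, <- Hn'. ring. }
assert (Hk0 : (0 < k)%nat) by nia.
assert (Hde0 : RtoC (IZR de) <> 0) by (apply RtoC_neq_0; apply not_0_IZR; lia).
set (kap := qq (IZR be / (12 * IZR de))%C).
(* [/ de] converts the automorphy factor of the unimodular part at [t'] into [c tau + d]; [kap] is
   the constant phase that [be] contributes to the twelfth root of the nome of [t']. *)
exists (zeta12 (psi a1 b1 c1 d1) * / IZR de * kap)%C, k, (fun x => qpoch (kap ^ 12 * x ^ (12 * k)) (kap ^ 12 * x ^ (12 * k)) ^ 2)%C.
assert (HF : analytic0 (fun x => qpoch (kap ^ 12 * x ^ (12 * k)) (kap ^ 12 * x ^ (12 * k)) ^ 2)%C).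
{ apply analytic0_pow. apply (analytic0_comp_monomial (fun x => qpoch x x)). lia. apply analytic0_euler. }
split. { apply Cmult_neq_0; [apply Cmult_neq_0|]. apply zeta12_neq_0. 
  intros E. apply C1_nz. rewrite <- (Cinv_r (IZR de)), E by auto. ring. apply qq_neq_0. }
split; auto. split.
{ apply Cpow_nz. replace (kap ^ 12 * 0 ^ (12 * k))%C with (RtoC 0).
  apply qpoch_neq_0_lt; rewrite Cmod_0; lra.
  replace (12 * k)%nat with (S (12 * k - 1)) by lia. rewrite (Cpow_S 0). ring. }
intros tau Ht.
set (t' := ((IZR al * tau + IZR be) / IZR de)%C).
assert (Ht' : 0 < Im t').
{ replace (Im t') with (IZR al * Im tau / IZR de).
  - apply Rdiv_lt_0_compat. apply Rmult_lt_0_compat; auto. now apply IZR_lt. now apply IZR_lt.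
  - unfold t', Cdiv. rewrite <- RtoC_inv by (apply not_0_IZR; lia). destruct tau. simpl. field. apply not_0_IZR; lia. }
assert (EC : forall u v w z s t : Z, (u = v * w + z * t)%Z -> RtoC (IZR u) = (IZR v * IZR w + IZR z * IZR t)%C).
{ intros u v w z _ t ->. now rewrite plus_IZR, !mult_IZR, RtoC_plus, !RtoC_mult. }
assert (HnaC : (INR n * IZR a = IZR a1 * IZR al)%C) by (rewrite INR_IZR_INZ, <- !RtoC_mult, <- !mult_IZR; now rewrite E1).
assert (HcC : (RtoC (IZR c) = IZR c1 * IZR al)%C) by (rewrite <- RtoC_mult, <- mult_IZR; now rewrite <- E3).
assert (HnbC : (INR n * IZR b = IZR a1 * IZR be + IZR b1 * IZR de)%C).
{ rewrite INR_IZR_INZ, <- !RtoC_mult, <- RtoC_plus, <- !mult_IZR, <- plus_IZR. now rewrite E2. }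
assert (HdC : (RtoC (IZR d) = IZR c1 * IZR be + IZR d1 * IZR de)%C).
{ rewrite <- !RtoC_mult, <- RtoC_plus, <- !mult_IZR, <- plus_IZR. now rewrite <- E4. }
pose proof (auto_factor_neq_0 a b c d tau H Ht) as HJ.
pose proof (auto_factor_neq_0 a1 b1 c1 d1 t' Hdet Ht') as HJ'.
assert (EJ : (auto_factor c d tau = auto_factor c1 d1 t' * IZR de)%C).
{ unfold auto_factor, t'. rewrite HcC, HdC. field. auto. }
assert (EM : (INR n * mobius a b c d tau = mobius a1 b1 c1 d1 t')%C).
{ unfold mobius. fold (auto_factor c d tau) (auto_factor c1 d1 t'). rewrite EJ.
  transitivity ((INR n * IZR a * tau + INR n * IZR b) / (auto_factor c1 d1 t' * IZR de))%C. unfold Cdiv; ring.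
  rewrite HnaC, HnbC. unfold t'. field. auto. }
rewrite EM, (eta_sq_transform _ _ _ _ Hdet t' Ht'), eta_sq_euler, EJ.
set (w := qq (t' / 12)).
assert (Hw : w = (kap * nome 120 tau ^ k)%C).
{ unfold w, kap, nome, qq. rewrite <- Cexp_pow, <- Cexp_add. f_equal. unfold t'.
  assert (HkC : (RtoC (INR k) * IZR de = 10 * IZR al)%C).
  { rewrite INR_IZR_INZ, <- !RtoC_mult, <- !mult_IZR. now rewrite Hk. }
  replace (RtoC (INR k)) with (10 * IZR al / IZR de)%C by (rewrite <- HkC; field; auto).
  rewrite RtoC_div by (simpl; lra). replace (RtoC (INR 120)) with (RtoC 120) by (f_equal; simpl; ring).
  rewrite RtoC_mult. field. auto. }
assert (Hq : qq t' = (kap ^ 12 * nome 120 tau ^ (12 * k))%C).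
{ replace t' with (INR 12 * (t' / 12))%C. rewrite qq_scal. fold w. rewrite Hw, Cpow_mult_l, <- Cpow_mult_r.
  now rewrite (Nat.mul_comm 12 k). replace (RtoC (INR 12)) with (RtoC 12) by (f_equal; simpl; ring). field. }
unfold euler_q. rewrite Hq, Hw. field. auto.
Qed.

(** The exponents [k1] and [k2] are kept apart because the order at the cusp may have either sign.
    That [F] does not vanish at any nome, and not only near 0, comes from the nonvanishing of eta on
    the half-plane. *)
Lemma g_cusp a b c d : (a * d - b * c = 1)%Z ->
  exists (K : C) (k1 k2 : nat) (F : C -> C), K <> 0 /\ analytic0 F /\ F 0 <> 0 /\
    forall tau, 0 < Im tau ->
      g (mobius a b c d tau) = (K * nome 120 tau ^ k1 / nome 120 tau ^ k2 * F (nome 120 tau))%C /\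
      F (nome 120 tau) <> 0.
Proof.
intros H.
destruct (eta_sq_cusp 1 a b c d H ltac:(lia) ltac:(now exists 10%Z)) as (K1 & e1 & F1 & HK1 & HF1 & HF1' & H1).
destruct (eta_sq_cusp 2 a b c d H ltac:(lia) ltac:(now exists 5%Z)) as (K2 & e2 & F2 & HK2 & HF2 & HF2' & H2).
destruct (eta_sq_cusp 5 a b c d H ltac:(lia) ltac:(now exists 2%Z)) as (K5 & e5 & F5 & HK5 & HF5 & HF5' & H5).
destruct (eta_sq_cusp 10 a b c d H ltac:(lia) ltac:(now exists 1%Z)) as (K10 & e10 & F10 & HK10 & HF10 & HF10' & H10).
exists (K2 * K5 ^ 2 / (K1 ^ 2 * K10))%C, (e2 + 2 * e5)%nat, (2 * e1 + e10)%nat,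
  (fun x => F2 x * F5 x ^ 2 * / (F1 x ^ 2 * F10 x))%C.
split. { apply Cdiv_neq_0; apply Cmult_neq_0; auto using Cpow_nz. }
split. { apply analytic0_mul. apply analytic0_mul; auto using analytic0_pow.
  apply (analytic0_inv (fun x => F1 x ^ 2 * F10 x)%C). apply analytic0_mul; auto using analytic0_pow.
  apply Cmult_neq_0; auto using Cpow_nz. }
split. { apply (Cdiv_neq_0 (F2 0 * F5 0 ^ 2) (F1 0 ^ 2 * F10 0))%C; apply Cmult_neq_0; auto using Cpow_nz. }
intros tau Ht.
assert (N : forall n K e F, (0 < n)%nat ->
  eta_sq (INR n * mobius a b c d tau) = (K * auto_factor c d tau * nome 120 tau ^ e * F (nome 120 tau))%C ->
  F (nome 120 tau) <> 0).
{ intros n K e F Hn E E0. apply (eta_sq_neq_0 (INR n * mobius a b c d tau)).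
  apply Im_scal_pos; auto. now apply Im_mobius_pos. rewrite E, E0. ring. }
pose proof (N 1%nat _ _ _ ltac:(lia) (H1 tau Ht)) as N1. pose proof (N 2%nat _ _ _ ltac:(lia) (H2 tau Ht)) as N2.
pose proof (N 5%nat _ _ _ ltac:(lia) (H5 tau Ht)) as N5. pose proof (N 10%nat _ _ _ ltac:(lia) (H10 tau Ht)) as N10.
clear N.
assert (HX : nome 120 tau <> 0) by apply Cexp_neq_0.
pose proof (auto_factor_neq_0 a b c d tau H Ht) as HJ.
rewrite g_eta_sq, (H1 tau Ht), (H2 tau Ht), (H5 tau Ht), (H10 tau Ht). 
set (X := nome 120 tau) in *. set (J := auto_factor c d tau) in *.
split.
- replace (2 * e5)%nat with (e5 + e5)%nat by lia. replace (2 * e1)%nat with (e1 + e1)%nat by lia.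
  rewrite !Cpow_add_r. pose proof (Cpow_nz X e1 HX). pose proof (Cpow_nz X e10 HX).
  field. repeat split; auto.
- apply (Cdiv_neq_0 (F2 X * F5 X ^ 2) (F1 X ^ 2 * F10 X))%C; apply Cmult_neq_0; auto using Cpow_nz.
Qed.

Lemma Cser_is_series a l : Cser a l -> @is_series C_AbsRing C_NormedModule a l.
Proof.
intros H. apply filterlim_locally. intros [eps He].
destruct (H eps He) as [N HN]. exists N. intros n Hn.
apply C_NormedModule_mixin_compat1. 
assert (E : forall m, sum_n a m = Csum a (S m)).
{ induction m. rewrite sum_O. simpl. now rewrite Cplus_0_l. rewrite sum_Sn, IHm. reflexivity. }
rewrite E. apply (HN (S n)). lia.
Qed.

Lemma nome_small h r : (0 < h)%nat -> 0 < r -> exists Y, forall tau, Y < Im tau -> Cmod (nome h tau) < r.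
Proof.
intros Hh Hr. assert (Hh' : 0 < INR h) by now apply lt_0_INR.
pose proof PI_RGT_0 as HPI.
exists (- ln r * (INR h / (2 * PI))). intros tau Ht. unfold nome. rewrite Cmod_Cexp.
rewrite <- (exp_ln r Hr). apply exp_increasing.
replace (Re _) with (- (2 * PI / INR h * Im tau)) by (destruct tau; simpl; ring).
assert (Hc : 0 < 2 * PI / INR h) by (apply Rdiv_lt_0_compat; lra).
apply Rmult_lt_compat_l with (r := 2 * PI / INR h) in Ht; auto.
replace (2 * PI / INR h * (- ln r * (INR h / (2 * PI)))) with (- ln r) in Ht by (field; lra). lra.
Qed.

Theorem meromorphic_at_cusps_hauptmodul_expr (f : C -> C) :
  (forall tau, 0 < Im tau -> f tau = hauptmodul_expr tau) -> meromorphic_at_cusps f.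
Proof.
intros Hf a b c d H.
destruct (g_cusp a b c d H) as (K & k1 & k2 & F & HK & HF & HF0 & Hg).
assert (HA : analytic0 (fun x => / K * x ^ (2 * k2) * / F x + - (2) * x ^ (k1 + k2) + 3 * K * x ^ (2 * k1) * F x)%C).
{ apply (analytic0_add (fun x => / K * x ^ (2 * k2) * / F x + - (2) * x ^ (k1 + k2))%C).
  apply (analytic0_add (fun x => / K * x ^ (2 * k2) * / F x)%C).
  - apply (analytic0_mul (fun x => / K * x ^ (2 * k2))%C); auto using analytic0_inv, analytic0_scal, analytic0_pow, analytic0_id.
  - apply analytic0_scal, analytic0_pow, analytic0_id.
  - apply (analytic0_mul (fun x => 3 * K * x ^ (2 * k1))%C); auto. apply analytic0_scal, analytic0_pow, analytic0_id. }
destruct HA as (co & r & M & Hr & _ & Hser).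
destruct (nome_small 120 r ltac:(lia) Hr) as [Y HY].
(* [X^(k1 + k2)] clears the poles of both [g], of order [k2 - k1], and [/ g], of order [k1 - k2],
   whatever the sign. *)
exists 120%nat, (k1 + k2)%nat, co, Y. split. lia. intros tau Ht HtY.
fold (nome 120 tau). cbv zeta. set (X := nome 120 tau).
apply Cser_is_series. specialize (Hser X (HY tau HtY)).
destruct (Hg tau Ht) as [E NF]. fold X in E, NF.
replace (f (mobius a b c d tau) * X ^ (k1 + k2))%C with
  (/ K * X ^ (2 * k2) * / F X + - (2) * X ^ (k1 + k2) + 3 * K * X ^ (2 * k1) * F X)%C; auto.
rewrite Hf by now apply Im_mobius_pos. unfold hauptmodul_expr. rewrite E.
assert (HX : X <> 0) by apply Cexp_neq_0.
replace (2 * k1)%nat with (k1 + k1)%nat by lia. replace (2 * k2)%nat with (k2 + k2)%nat by lia.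
rewrite !Cpow_add_r. pose proof (Cpow_nz X k1 HX). pose proof (Cpow_nz X k2 HX). field. auto.
Qed.

Lemma meromorphic_on_H_hauptmodul_expr (f : C -> C) :
  (forall tau, 0 < Im tau -> f tau = hauptmodul_expr tau) -> meromorphic_on_H f.
Proof.
(* Pole order 0, since the function is holomorphic; the radius [Im z0] keeps the disc inside the
   half-plane. *)
intros Hf z0 Hz0. exists O, hauptmodul_expr, (Im z0). split; auto. split. lra.
assert (Him : forall z, Cmod (z - z0) < Im z0 -> 0 < Im z).
{ intros z Hz. pose proof (Rabs_Im_le (z - z0)) as Hi.
  replace (Im (z - z0)) with (Im z - Im z0) in Hi by reflexivity.
  apply Rabs_le_between in Hi. lra. }
split.
- intros z Hz. destruct (holomorphic_hauptmodul_expr z (Him z Hz)) as [l Hl]. exact (Cderiv_ex_derive _ _ _ Hl).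
- intros z Hz _. rewrite Hf by now apply Him. simpl. ring.
Qed.

Theorem theorem3p8 :
  modular_function_Gamma0 10
    (fun tau => Cplus (Cpow (g1 tau) 4) (Cpow (g2 tau) 4)) /\
  forall tau : C, 0 < Im tau ->
    Cplus (Cpow (g1 tau) 4) (Cpow (g2 tau) 4) =
    Cplus (Cminus (Cinv (g tau)) (RtoC 2)) (Cmult (RtoC 3) (g tau)).
Proof.
split; [|exact g1_g2_identity]. split; [|split].
- exact (meromorphic_on_H_hauptmodul_expr _ g1_g2_identity).
- intros a b c d H Hc tau Ht. rewrite !g1_g2_identity by auto using Im_mobius_pos.
  now rewrite g_invariant.
- exact (meromorphic_at_cusps_hauptmodul_expr _ g1_g2_identity).
Qed.
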